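(* Let $i:Y^k\to(X^n,g)$ be an immersion with $1\le k<n$ and $n\ge3$, with $n\ne4$. Then $$\mathcal I:=(k-1)\bigl(-\overline\Delta\mathsf G+2\mathsf G\,\mathcal P_\alpha{}^\alpha\bigr)+(k-6)\Bigl[\bigl(\mathring L^2_{\alpha\beta}-W_{\alpha\gamma\beta}{}^\gamma\bigr)\mathcal P^{\alpha\beta}+\overline\nabla^\alpha\bigl(\mathcal C_\alpha-\mathsf D^{\beta\alpha'}\mathring L_{\alpha\beta\alpha'}\bigr)+\frac{k-3}{n-4}\mathcal B_\alpha{}^\alpha-(k-3)|\mathsf D|^2\Bigr]$$ is conformally invariant of weight $-4$.
   Context: **Curvature.** $\nabla$ is the Levi-Civita connection of $g$; $R_{abcd}$ is determined by $\nabla_a\nabla_b\tau_c-\nabla_b\nabla_a\tau_c=R_{abc}{}^d\tau_d$; $R_{ab}=R_{acb}{}^c$, $R=R_a{}^a$, $\mathsf J=\frac{R}{2(n-1)}$, $\mathsf P_{ab}=\frac1{n-2}(R_{ab}-\mathsf Jg_{ab})$, $W_{abcd}=R_{abcd}-\mathsf P_{ac}g_{bd}-\mathsf P_{bd}g_{ac}+\mathsf P_{ad}g_{bc}+\mathsf P_{bc}g_{ad}$, $C_{abc}=\nabla_a\mathsf P_{bc}-\nabla_b\mathsf P_{ac}$, $B_{ab}=\nabla^cC_{cab}+W_{acbd}\mathsf P^{cd}$. Round parentheses on indices denote symmetrization: $T_{(ab)}=\frac12(T_{ab}+T_{ba})$. **Submanifold.** $i^*TX=TY\oplus NY$ ($g$-orthogonal);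 abstract indices $\alpha,\beta,\gamma,\dots$ denote projection to $TY$, primed indices projection to $NY$, Latin indices label $i^*TX$; indices are raised and lowered with $g$. $\overline\nabla$ is the connection on $TY$ and $NY$ obtained by projecting $\nabla$; $\overline\Delta=\overline\nabla^\alpha\overline\nabla_\alpha$. $L(U,V)=(\nabla_UV)^\perp$ is the second fundamental form $L_{\alpha\beta\alpha'}$, $H_{\alpha'}=\frac1kL_\alpha{}^\alpha{}_{\alpha'}$, $\mathring L_{\alpha\beta\alpha'}=L_{\alpha\beta\alpha'}-H_{\alpha'}g_{\alpha\beta}$, $\mathring L^2_{\alpha\beta}=\mathring L^\gamma{}_{\alpha\alpha'}\mathring L_{\gamma\beta}{}^{\alpha'}$, $|\mathring L|^2=\mathring L_{\alpha\beta\alpha'}\mathring L^{\alpha\beta\alpha'}$. Define $\mathsf G=\frac1{2(k-1)}\bigl(|\mathring L|^2-W_{\alpha\beta}{}^{\alpha\beta}\bigr)$ (when $k=1$ the product $(k-1)\mathsf G$ is read as $\frac12(|\mathring L|^2-W_{\alpha\beta}{}^{\alpha\beta})=0$); $\mathsf D_{\alpha\alpha'}=\mathsf P_{\alpha\alpha'}-\overline\nabla_\alpha H_{\alpha'}$, $|\mathsf D|^2=\mathsf D_{\alpha\alpha'}\mathsf D^{\alpha\alpha'}$; $\mathcal P_{\alpha\beta}=\mathsf P_{\alpha\beta}+H^{\alpha'}\mathring L_{\alpha\beta\alpha'}+\frac12H^{\alpha'}H_{\alpha'}g_{\alpha\beta}$; $\mathcal C_{abc}=C_{abc}-H^{\alpha'}W_{abc\alpha'}$,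 $\mathcal C_a=\mathcal C_{\beta a}{}^\beta$; $\mathcal B_{\alpha\beta}=B_{\alpha\beta}+2(n-4)H^{\alpha'}C_{\alpha'(\alpha\beta)}+(n-4)H^{\alpha'}H^{\beta'}W_{\alpha\alpha'\beta\beta'}$. A scalar $T$, assigning to each immersion $i:Y^k\to(X^n,g)$ a function $T^g$ on $Y$, is conformally invariant of weight $w$ if $T^{e^{2\Upsilon}g}=e^{w\,i^*\Upsilon}T^g$ for all immersions and all $\Upsilon\in C^\infty(X)$. *)

(* Defs.v *)
From HB Require Import structures.
From mathcomp Require Import all_boot all_order all_algebra.
From mathcomp Require Import all_classical all_reals all_analysis.

Set Implicit Arguments.
Unset Strict Implicit.
Unset Printing Implicit Defensive.

Import Order.TTheory GRing.Theory Num.Theory.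
Import numFieldNormedType.Exports.

Local Open Scope classical_set_scope.
Local Open Scope ring_scope.

Section Smoothness.
Context {R : realType}.

Definition pderiv (n : nat) (W : normedModType R) (i : 'I_n)
    (f : 'rV[R]_n -> W) : 'rV[R]_n -> W :=
  fun x => 'D_('e_i) f x.

(* C^infinity on U, for U open: every iterated partial derivative exists and
   is differentiable (hence continuous) at every point of U. *)
Definition smooth_on (n : nat) (W : normedModType R) (U : set 'rV[R]_n)
    (f : 'rV[R]_n -> W) : Prop :=
  forall (s : seq 'I_n) (x : 'rV[R]_n), U x ->
    differentiable (foldr (@pderiv n W) f s) x.

End Smoothness.

(* The maps are total functions; only their restrictions to [dom] and [ran]
   are meaningful. *)
Record chart (R : realType) (n : nat) (M : topologicalType) := Chart {
  dom : set M;
  ran : set 'rV[R]_n;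
  fwd : M -> 'rV[R]_n;
  bwd : 'rV[R]_n -> M;
  dom_open : open dom;
  ran_open : open ran;
  fwd_ran : forall p, dom p -> ran (fwd p);
  bwd_dom : forall x, ran x -> dom (bwd x);
  fwdK : forall p, dom p -> bwd (fwd p) = p;
  bwdK : forall x, ran x -> fwd (bwd x) = x;
  fwd_continuous : forall p, dom p -> {for p, continuous fwd};
  bwd_continuous : forall x, ran x -> {for x, continuous bwd}
}.

(* Smooth n-manifolds.  [chart_at p] is an arbitrary atlas chart around p, in
   which tensorial expressions at p are evaluated. *)
Record manifold (R : realType) (n : nat) := Manifold {
  carrier :> topologicalType;
  carrier_hausdorff : hausdorff_space carrier;
  carrier_second_countable : @second_countable carrier;
  atlas : set (chart R n carrier);
  chart_at : carrier -> chart R n carrier;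
  chart_at_atlas : forall p, atlas (chart_at p);
  chart_at_dom : forall p, dom (chart_at p) p;
  atlas_smooth : forall phi psi, atlas phi -> atlas psi ->
    smooth_on [set x | ran phi x /\ dom psi (bwd phi x)] (fwd psi \o bwd phi)
}.

Section ManifoldNotions.
Context {R : realType}.

Definition smooth_function (n : nat) (X : manifold R n) (u : X -> R) : Prop :=
  forall phi, atlas phi -> smooth_on (ran phi) (u \o bwd phi).

Definition in_charts (k n : nat) (Y : manifold R k) (X : manifold R n)
    (i : Y -> X) (phi : chart R k Y) (psi : chart R n X) :
    'rV[R]_k -> 'rV[R]_n :=
  fwd psi \o i \o bwd phi.

(* ['J f y] is the k x n matrix whose row alpha is the derivative of f in the
   direction alpha, so injectivity of the differential is [row_free]. *)
Definition immersion (k n : nat) (Y : manifold R k) (X : manifold R n)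
    (i : Y -> X) : Prop :=
  continuous i /\
  forall phi psi, atlas phi -> atlas psi ->
    let V := [set y | ran phi y /\ dom psi (i (bwd phi y))] in
    smooth_on V (in_charts i phi psi) /\
    forall y, V y -> row_free ('J (in_charts i phi psi) y).

(* A covariant 2-tensor field, given by its matrix of components in each
   chart, as a function of the coordinates. *)
Definition tensor2 (n : nat) (X : manifold R n) : Type :=
  chart R n X -> 'rV[R]_n -> 'M[R]_n.

Definition riemannian_metric (n : nat) (X : manifold R n)
    (g : tensor2 X) : Prop :=
  (forall phi, atlas phi ->
     [/\ smooth_on (ran phi) (g phi),
         forall x, ran phi x -> (g phi x)^T = g phi x &
         forall x, ran phi x -> forall v : 'rV[R]_n, v != 0 ->
           0 < (v *m g phi x *m v^T) 0 0]) /\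
  (forall phi psi, atlas phi -> atlas psi ->
     forall p, dom phi p -> dom psi p ->
       let A := 'J (fwd psi \o bwd phi) (fwd phi p) in
       g phi (fwd phi p) = A *m g psi (fwd psi p) *m A^T).

Definition conformal_change (n : nat) (X : manifold R n) (u : X -> R)
    (g : tensor2 X) : tensor2 X :=
  fun phi x => expR (2 * u (bwd phi x)) *: g phi x.

Definition scalar_assignment (k n : nat) : Type :=
  forall (Y : manifold R k) (X : manifold R n),
    (Y -> X) -> tensor2 X -> Y -> R.

Definition conformally_invariant (k n : nat) (T : scalar_assignment k n)
    (w : R) : Prop :=
  forall (Y : manifold R k) (X : manifold R n) (i : Y -> X) (g : tensor2 X)
    (u : X -> R),
    immersion i -> riemannian_metric g -> smooth_function u ->
    forall p : Y,
      T Y X i (conformal_change u g) p = expR (w * u (i p)) * T Y X i g p.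

End ManifoldNotions.

(* Curvature in coordinates.  Tensor components are functions of the point
   followed by the indices, in their left-to-right order; the index of a
   covariant derivative comes first. *)
Section Curvature.
Context {R : realType} {n : nat}.
Variable g : 'rV[R]_n -> 'M[R]_n.
Implicit Types (x : 'rV[R]_n) (a b c d e : 'I_n).

Definition ginv x : 'M[R]_n := invmx (g x).

(* [christoffel x c a b] is Gamma^c_{ab}. *)
Definition christoffel x c a b : R :=
  2^-1 * \sum_d ginv x c d *
    (pderiv a (fun z => g z b d) x + pderiv b (fun z => g z a d) x
     - pderiv d (fun z => g z a b) x).

Definition nabla1 (t : 'rV[R]_n -> 'I_n -> R) x a b : R :=
  pderiv a (fun z => t z b) x - \sum_d christoffel x d a b * t x d.

Definition nabla2 (t : 'rV[R]_n -> 'I_n -> 'I_n -> R) x a b c : R :=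
  pderiv a (fun z => t z b c) x
  - \sum_d christoffel x d a b * t x d c
  - \sum_d christoffel x d a c * t x b d.

Definition nabla3 (t : 'rV[R]_n -> 'I_n -> 'I_n -> 'I_n -> R) x a b c e : R :=
  pderiv a (fun z => t z b c e) x
  - \sum_d christoffel x d a b * t x d c e
  - \sum_d christoffel x d a c * t x b d e
  - \sum_d christoffel x d a e * t x b c d.

(* R_{abc}^d is determined by
     nabla_a nabla_b tau_c - nabla_b nabla_a tau_c = R_{abc}^d tau_d;
   it is read off from the coordinate covectors tau = dx^d. *)
Definition dcoord d : 'rV[R]_n -> 'I_n -> R := fun _ c => (c == d)%:R.

Definition riem_up x a b c d : R :=
  nabla2 (nabla1 (dcoord d)) x a b c - nabla2 (nabla1 (dcoord d)) x b a c.

Definition riem x a b c d : R := \sum_e riem_up x a b c e * g x e d.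

Definition ricci x a b : R := \sum_c riem_up x a c b c.

Definition scal x : R := \sum_a \sum_b ginv x a b * ricci x a b.

Definition schoutenJ x : R := scal x / (2 * (n%:R - 1)).

Definition schouten x a b : R :=
  (n%:R - 2)^-1 * (ricci x a b - schoutenJ x * g x a b).

Definition weyl x a b c d : R :=
  riem x a b c d
  - schouten x a c * g x b d - schouten x b d * g x a c
  + schouten x a d * g x b c + schouten x b c * g x a d.

Definition cotton x a b c : R :=
  nabla2 schouten x a b c - nabla2 schouten x b a c.

Definition bach x a b : R :=
  \sum_c \sum_d ginv x c d * nabla3 cotton x d c a b
  + \sum_c \sum_d weyl x a c b d *
      \sum_e \sum_m ginv x c e * ginv x d m * schouten x e m.

End Curvature.

(* A parametrized submanifold f in coordinates.  Tangential indices are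
   coordinate indices in 'I_k; a normal index is represented by an upper
   ambient index, i.e., by a vector of R^n that is g-orthogonal to the image of
   the differential of f. *)
Section Submanifold.
Context {R : realType} {k n : nat}.
Variables (g : 'rV[R]_n -> 'M[R]_n) (f : 'rV[R]_k -> 'rV[R]_n).
Implicit Types (y : 'rV[R]_k) (al be ga de : 'I_k) (a b c d : 'I_n).
Implicit Types (u v : 'I_n -> R).

Definition frame y al a : R := pderiv al (fun z => f z 0 a) y.

Definition dot y u v : R := \sum_a \sum_b g (f y) a b * u a * v b.

Definition sharp y (t : 'I_n -> R) a : R := \sum_b ginv g (f y) a b * t b.

Definition ind_metric y : 'M[R]_k :=
  \matrix_(al, be) dot y (frame y al) (frame y be).

Definition ind_inv y : 'M[R]_k := invmx (ind_metric y).

Definition tr2 y (t : 'I_k -> 'I_k -> R) : R :=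
  \sum_al \sum_be ind_inv y al be * t al be.

(* Coordinates of the projection to TY, and the projection to NY. *)
Definition tangential y v ga : R :=
  \sum_de ind_inv y ga de * dot y (frame y de) v.

Definition normal y v a : R := v a - \sum_ga tangential y v ga * frame y ga a.

(* nabla_al s, for a section s of i^*TX. *)
Definition nabla_along (s : 'rV[R]_k -> 'I_n -> R) y al a : R :=
  pderiv al (fun z => s z a) y
  + \sum_b \sum_c christoffel g (f y) a b c * frame y al b * s y c.

(* The projected connections on TY and NY: [conn_coef y ga al be] is the
   component along ga of the derivative of the be-th coordinate field in the
   direction al. *)
Definition conn_coef y ga al be : R :=
  tangential y (nabla_along (fun z => frame z be) y al) ga.

Definition nablaN (s : 'rV[R]_k -> 'I_n -> R) y al : 'I_n -> R :=
  normal y (nabla_along s y al).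

Definition nablaT (t : 'rV[R]_k -> 'I_k -> R) y al be : R :=
  pderiv al (fun z => t z be) y - \sum_ga conn_coef y ga al be * t y ga.

Definition divergence (t : 'rV[R]_k -> 'I_k -> R) y : R := tr2 y (nablaT t y).

Definition laplacian (w : 'rV[R]_k -> R) y : R :=
  divergence (fun z al => pderiv al w z) y.

Definition sff y al be : 'I_n -> R :=
  normal y (nabla_along (fun z => frame z be) y al).

Definition meanH y a : R := k%:R^-1 * tr2 y (fun al be => sff y al be a).

Definition sff0 y al be a : R := sff y al be a - meanH y a * ind_metric y al be.

Definition sff0_sq y al be : R :=
  tr2 y (fun ga de => dot y (sff0 y ga al) (sff0 y de be)).

Definition sff0_norm2 y : R :=
  \sum_al \sum_be \sum_ga \sum_de ind_inv y al ga * ind_inv y be de *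
    dot y (sff0 y al be) (sff0 y ga de).

Definition contract2 (t : 'I_n -> 'I_n -> R) u v : R :=
  \sum_a \sum_b t a b * u a * v b.

Definition contract3 (t : 'I_n -> 'I_n -> 'I_n -> R) u v u' : R :=
  \sum_a \sum_b \sum_c t a b c * u a * v b * u' c.

Definition contract4 (t : 'I_n -> 'I_n -> 'I_n -> 'I_n -> R) u v u' v' : R :=
  \sum_a \sum_b \sum_c \sum_d t a b c d * u a * v b * u' c * v' d.

Definition weylT y al be ga de : R :=
  contract4 (weyl g (f y)) (frame y al) (frame y be) (frame y ga) (frame y de).

(* W_{al ga be}^ga *)
Definition weyl_tr1 y al be : R := tr2 y (fun ga de => weylT y al ga be de).

(* W_{al be}^{al be} *)
Definition weyl_tr2 y : R :=
  \sum_al \sum_be \sum_ga \sum_de ind_inv y al ga * ind_inv y be de *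
    weylT y al be ga de.

(* For k = 1 this is 0 since x / 0 = 0, so that (k - 1) G is 0 as well. *)
Definition scriptG y : R :=
  (2 * (k%:R - 1))^-1 * (sff0_norm2 y - weyl_tr2 y).

(* P_{al al'} - nablabar_al H_al', with al' raised. *)
Definition scriptD y al a : R :=
  normal y (sharp y (fun b => \sum_c schouten g (f y) c b * frame y al c)) a
  - nablaN meanH y al a.

Definition scriptD_norm2 y : R :=
  tr2 y (fun al be => dot y (scriptD y al) (scriptD y be)).

Definition calP y al be : R :=
  contract2 (schouten g (f y)) (frame y al) (frame y be)
  + dot y (meanH y) (sff0 y al be)
  + 2^-1 * dot y (meanH y) (meanH y) * ind_metric y al be.

Definition calC y a b c : R :=
  cotton g (f y) a b c - \sum_d meanH y d * weyl g (f y) a b c d.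

(* calC_{be al}^be *)
Definition calC_tr y al : R :=
  tr2 y (fun be ga => contract3 (calC y) (frame y be) (frame y al) (frame y ga)).

Definition calB y al be : R :=
  contract2 (bach g (f y)) (frame y al) (frame y be)
  + 2 * (n%:R - 4) *
    (2^-1 * (contract3 (cotton g (f y)) (meanH y) (frame y al) (frame y be)
             + contract3 (cotton g (f y)) (meanH y) (frame y be) (frame y al)))
  + (n%:R - 4) *
    contract4 (weyl g (f y)) (frame y al) (meanH y) (frame y be) (meanH y).

(* C_al - D^{be al'} L0_{al be al'} *)
Definition calI_form y al : R :=
  calC_tr y al
  - tr2 y (fun be ga => dot y (scriptD y ga) (sff0 y al be)).

Definition calI_coord y : R :=
  (k%:R - 1) * (- laplacian scriptG y + 2 * scriptG y * tr2 y (calP y))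
  + (k%:R - 6) *
    (\sum_al \sum_be (sff0_sq y al be - weyl_tr1 y al be) *
       (\sum_ga \sum_de ind_inv y al ga * ind_inv y be de * calP y ga de)
     + divergence calI_form y
     + (k%:R - 3) / (n%:R - 4) * tr2 y (calB y)
     - (k%:R - 3) * scriptD_norm2 y).

End Submanifold.

Definition calI (R : realType) (k n : nat) : scalar_assignment k n :=
  fun (Y : manifold R k) (X : manifold R n) i g p =>
    let phi := chart_at p in
    let psi := chart_at (i p) in
    calI_coord (g psi) (in_charts i phi psi) (fwd phi p).
Arguments calI : clear implicits.

(* Main.v *)
(* Put F = L0^2 - W_{al ga be}^ga and X_al = C_al - D^{be al'} L0_{al be al'} (script C and D).
   The trace of F is 2(k-1)G, and under g -> e^{2u} g one finds F -> F and
   X -> e^{-2u} (X + F(grad u, .)).  The Codazzi equation and the contracted second Bianchi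
   identity for W give div F - d(tr F)/2 = (k-2) X.  Expanding all terms of I, the
   contributions quadratic in du cancel, and the linear ones add up to (k-6) e^{-4u} times
   <div F - d(tr F)/2 - (k-2) X, du> = 0.  The same charts are used for both metrics, so the
   computation is purely local. *)

From HB Require Import structures.
Require Import Defs.
From mathcomp Require Import all_boot all_order all_algebra.
From mathcomp Require Import all_classical all_reals all_analysis.
From mathcomp Require Import ring lra.
Set Implicit Arguments.
Unset Strict Implicit.
Unset Printing Implicit Defensive.
Import Order.TTheory GRing.Theory Num.Theory.
Import numFieldNormedType.Exports.
Local Open Scope classical_set_scope.
Local Open Scope ring_scope.

(** * Partial derivatives of smooth functions *)

(** The coefficients of the invariant are forced. Write w for u restricted to Y and t = tr F. Up to
    scale, the scalar part changes by (k-6)/2 times t|dw|^2 - <dt,dw>, and F.P inside the bracket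
    contributes -t|dw|^2/2: hence the factor k-6. Next, F.P and div X leave F(dw,dw) with
    coefficient 1 + (k-4), so the last two terms have to supply -(k-3) F(dw,dw). Its two halves have
    different sources: the norm of D gives the part with L0^2, the trace of script B the Weyl part.
    Every change term of the Bach tensor carries n-4, hence the division by n-4. The corrections by
    H in script P, C and B remove the normal part of grad u, because H changes by minus that part.
    The divergence identity is never divided by k-2, so surfaces need no separate argument; curves
    do, as G then has denominator 0. The normal bundle gets no calculus of its own: normal
    identities are proved after pairing with an ambient vector orthogonal to the frame, so
    tangential parts need not be computed. *)

Section LocalCalculus.
Context {R : realType}.

(** Differentiability is an expansion up to a little-o, which depends only on the values near x; the
    expansion is transferred and [diff_unique] then identifies the differential. *)
Lemma near_eq_differentiable (V W : normedModType R) (f h : V -> W) (x : V) :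
  (\forall z \near x, f z = h z) -> differentiable f x -> differentiable h x.
Proof.
move=> fh /diff_locallyP[cdf fE].
have hE : h \o shift x = cst (h x) + 'd f x +o_ 0 id.
  apply/eqaddoP => e e0.
  have /eqaddoP/(_ e e0) fe := fE.
  have fhx : f x = h x by apply: nbhs_singleton fh.
  have fh0 : \forall v \near (0 : V), f (v + x) = h (v + x).
    by move: fh; rewrite (near_shift 0); apply: filterS => v /=; rewrite subr0.
  near=> v; have -> : (h \o shift x - (cst (h x) + 'd f x)) v
      = (f \o shift x - (cst (f x) + 'd f x)) v.
    rewrite /= !fctE /= /shift fhx; congr (_ - _); apply/esym.
    by near: v.
  by near: v.
apply/diff_locallyP; split; first by rewrite (diff_unique cdf hE).
by rewrite (diff_unique cdf hE).
Unshelve. all: by end_near. Qed.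

Context {n : nat}.
Implicit Types (U : set 'rV[R]_n).

Lemma pderiv_eq (W : normedModType R) U (f h : 'rV[R]_n -> W) i x : open U ->
  {in U, f =1 h} -> U x -> pderiv i f x = pderiv i h x.
Proof.
move=> oU fh Ux; apply: near_eq_derive.
near=> z; apply: fh; apply/mem_set; near: z.
exact: open_nbhs_nbhs.
Unshelve. all: by end_near. Qed.

(** Smoothness of finite order, peeling the innermost derivative first. The order is what an
    induction can decrease when a derivative contains the function itself again, as for products,
    inverses, exponentials and composites. *)
Fixpoint diff_upto (W : normedModType R) U m (f : 'rV[R]_n -> W) : Prop :=
  (forall x, U x -> differentiable f x) /\
  if m is m'.+1 then forall i, diff_upto U m' (pderiv i f) else True.

Lemma smooth_onP (W : normedModType R) U (f : 'rV[R]_n -> W) :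
  smooth_on U f <-> forall m, diff_upto U m f.
Proof.
split=> [sf m|df s].
  elim: m f sf => [|m IH] f sf; (split; first exact: (sf [::])) => // i.
  by apply: IH => s x Ux; have := sf (rcons s i) x Ux; rewrite foldr_rcons.
elim/last_ind: s f df => [|s i IH] f df x Ux; first exact: (df 0%N).1.
by rewrite foldr_rcons; apply: IH => // m; apply: (df m.+1).2.
Qed.

Lemma smooth_differentiable (W : normedModType R) U (f : 'rV[R]_n -> W) x :
  smooth_on U f -> U x -> differentiable f x.
Proof. by move=> sf; apply: (sf [::]). Qed.

Lemma smooth_pderiv (W : normedModType R) U (f : 'rV[R]_n -> W) i :
  smooth_on U f -> smooth_on U (pderiv i f).
Proof. by move=> sf s x Ux; have := sf (rcons s i) x Ux; rewrite foldr_rcons. Qed.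

Lemma diff_upto_eq (W : normedModType R) U m (f h : 'rV[R]_n -> W) : open U ->
  {in U, f =1 h} -> diff_upto U m f -> diff_upto U m h.
Proof.
move=> oU; have H (f' h' : 'rV[R]_n -> W) : {in U, f' =1 h'} ->
    (forall x, U x -> differentiable f' x) -> forall x, U x -> differentiable h' x.
  move=> fh df x Ux; apply: near_eq_differentiable (df x Ux).
  near=> z; apply: fh; apply/mem_set; near: z; exact: open_nbhs_nbhs.
elim: m f h => [|m IH] f h fh [df dpf]; split=> //; try exact: H fh df.
move=> i; apply: IH (dpf i) => x /set_mem Ux; exact: pderiv_eq oU fh Ux.
Unshelve. all: by end_near. Qed.

Lemma smooth_eq (W : normedModType R) U (f h : 'rV[R]_n -> W) : open U ->
  {in U, f =1 h} -> smooth_on U f -> smooth_on U h.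
Proof.
by move=> oU fh /smooth_onP sf; apply/smooth_onP => m; apply: diff_upto_eq (sf m).
Qed.

Lemma smooth_ext (W : normedModType R) U (f h : 'rV[R]_n -> W) :
  (forall x, f x = h x) -> smooth_on U h -> smooth_on U f.
Proof. by move=> /funext ->. Qed.

Lemma diff_uptoW (W : normedModType R) U m (f : 'rV[R]_n -> W) :
  diff_upto U m.+1 f -> diff_upto U m f.
Proof.
elim: m f => [|m IH] f [df dpf]; split=> // i; exact/IH/dpf.
Qed.

Section Rules.
Variable U : set 'rV[R]_n.
Hypothesis oU : open U.
Implicit Types (f h : 'rV[R]_n -> R) (x : 'rV[R]_n) (i : 'I_n).

Lemma smooth_derivable (W : normedModType R) (f : 'rV[R]_n -> W) x v :
  smooth_on U f -> U x -> derivable f x v.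
Proof. by move=> sf Ux; apply/diff_derivable/(smooth_differentiable sf). Qed.

Lemma pderiv_cst (c : R) i x : pderiv i (fun _ => c) x = 0.
Proof. exact: derive_cst. Qed.

Lemma smooth_cst (c : R) : smooth_on U (fun _ => c).
Proof.
apply/smooth_onP => m; elim: m c => [|m IH] c; split=> // i.
have -> : pderiv i (fun _ => c) = fun _ => 0 by apply/funext => x; rewrite pderiv_cst.
exact: IH.
Qed.

Lemma diff_upto_add m f h :
  diff_upto U m f -> diff_upto U m h -> diff_upto U m (fun x => f x + h x).
Proof.
elim: m f h => [|m IH] f h [df dpf] [dh dph]; split=> //.
- by move=> x Ux; apply: differentiableD; [exact: df|exact: dh].
- by move=> x Ux; apply: differentiableD; [exact: df|exact: dh].
move=> i; apply: diff_upto_eq (IH _ _ (dpf i) (dph i)) => // x /set_mem Ux.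
by rewrite /pderiv; apply/esym/deriveD; apply/diff_derivable; [exact: df|exact: dh].
Qed.

Lemma diff_upto_mul m f h :
  diff_upto U m f -> diff_upto U m h -> diff_upto U m (fun x => f x * h x).
Proof.
elim: m f h => [|m IH] f h sf sh; have [df dpf] := sf; have [dh dph] := sh; split=> //.
- by move=> x Ux; apply: differentiableM; [exact: df|exact: dh].
- by move=> x Ux; apply: differentiableM; [exact: df|exact: dh].
move=> i; have := diff_upto_add (IH _ _ (diff_uptoW sf) (dph i)) (IH _ _ (diff_uptoW sh) (dpf i)).
apply: diff_upto_eq => // x /set_mem Ux.
by rewrite /pderiv; apply/esym/deriveM; apply/diff_derivable; [exact: df|exact: dh].
Qed.

Lemma smoothD f h : smooth_on U f -> smooth_on U h -> smooth_on U (fun x => f x + h x).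
Proof.
by move=> /smooth_onP sf /smooth_onP sh; apply/smooth_onP => m; apply: diff_upto_add.
Qed.

Lemma smoothM f h : smooth_on U f -> smooth_on U h -> smooth_on U (fun x => f x * h x).
Proof.
by move=> /smooth_onP sf /smooth_onP sh; apply/smooth_onP => m; apply: diff_upto_mul.
Qed.

Lemma smoothN f : smooth_on U f -> smooth_on U (fun x => - f x).
Proof.
move=> sf; have := smoothM (smooth_cst (-1)) sf.
by apply: smooth_eq => // x _; rewrite mulN1r.
Qed.

Lemma smoothB f h : smooth_on U f -> smooth_on U h -> smooth_on U (fun x => f x - h x).
Proof. by move=> sf sh; apply: smoothD => //; apply: smoothN. Qed.

Lemma smooth_sum (I : Type) (r : seq I) (P : pred I) (f : I -> 'rV[R]_n -> R) :
  (forall j, P j -> smooth_on U (f j)) -> smooth_on U (fun x => \sum_(j <- r | P j) f j x).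
Proof.
move=> sf; elim: r => [|j r IH].
  by under eq_fun do rewrite big_nil; apply: smooth_cst.
under eq_fun do rewrite big_cons.
case: (boolP (P j)) => // Pj; apply: smoothD => //; exact: sf.
Qed.

Lemma smooth_prod (I : Type) (r : seq I) (P : pred I) (f : I -> 'rV[R]_n -> R) :
  (forall j, P j -> smooth_on U (f j)) -> smooth_on U (fun x => \prod_(j <- r | P j) f j x).
Proof.
move=> sf; elim: r => [|j r IH].
  by under eq_fun do rewrite big_nil; apply: smooth_cst.
under eq_fun do rewrite big_cons.
case: (boolP (P j)) => // Pj; apply: smoothM => //; exact: sf.
Qed.

Lemma pderivD f h i x : smooth_on U f -> smooth_on U h -> U x ->
  pderiv i (fun z => f z + h z) x = pderiv i f x + pderiv i h x.
Proof using oU. by move=> sf sh Ux; apply: deriveD; apply: smooth_derivable. Qed.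

Lemma pderivN f i x : smooth_on U f -> U x ->
  pderiv i (fun z => - f z) x = - pderiv i f x.
Proof using oU. by move=> sf Ux; apply: deriveN; apply: smooth_derivable. Qed.

Lemma pderivB f h i x : smooth_on U f -> smooth_on U h -> U x ->
  pderiv i (fun z => f z - h z) x = pderiv i f x - pderiv i h x.
Proof using oU. by move=> sf sh Ux; apply: deriveB; apply: smooth_derivable. Qed.

Lemma pderivM f h i x : smooth_on U f -> smooth_on U h -> U x ->
  pderiv i (fun z => f z * h z) x = pderiv i f x * h x + f x * pderiv i h x.
Proof using oU.
move=> sf sh Ux; rewrite addrC [pderiv i f x * _]mulrC.
by apply: deriveM; apply: smooth_derivable.
Qed.

Lemma pderivZ (c : R) f i x : smooth_on U f -> U x ->
  pderiv i (fun z => c * f z) x = c * pderiv i f x.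
Proof using oU. by move=> sf Ux; rewrite pderivM ?pderiv_cst ?mul0r ?add0r //; apply: smooth_cst. Qed.

Lemma pderiv_sum (I : Type) (r : seq I) (P : pred I) (f : I -> 'rV[R]_n -> R) i x :
  (forall j, P j -> smooth_on U (f j)) -> U x ->
  pderiv i (fun z => \sum_(j <- r | P j) f j z) x = \sum_(j <- r | P j) pderiv i (f j) x.
Proof using oU.
move=> sf Ux; elim: r => [|j r IH].
  by under eq_fun do rewrite big_nil; rewrite pderiv_cst big_nil.
under eq_fun do rewrite big_cons.
rewrite big_cons; case: (boolP (P j)) => // Pj; rewrite pderivD ?IH //; first exact: sf.
exact: smooth_sum.
Qed.

Lemma diff_upto_inv m f : (forall x, U x -> f x != 0) ->
  diff_upto U m f -> diff_upto U m (fun x => (f x)^-1).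
Proof.
move=> f0; elim: m f f0 => [|m IH] f f0 sf; have [df dpf] := sf; split=> //.
- by move=> x Ux; apply: differentiableV; [exact: df|exact: f0].
- by move=> x Ux; apply: differentiableV; [exact: df|exact: f0].
move=> i; have sV := IH f f0 (diff_uptoW sf).
have := diff_upto_mul (diff_upto_mul sV sV)
  (diff_upto_mul ((smooth_onP _ _).1 (smooth_cst (-1)) m) (dpf i)).
apply: diff_upto_eq => // x /set_mem Ux.
rewrite {2}/pderiv deriveV ?f0 //; last exact/diff_derivable/df.
by rewrite /GRing.scale /= -exprVn expr2 mulN1r mulrN mulNr.
Qed.

Lemma smoothV f : (forall x, U x -> f x != 0) -> smooth_on U f ->
  smooth_on U (fun x => (f x)^-1).
Proof.
by move=> f0 /smooth_onP sf; apply/smooth_onP => m; apply: diff_upto_inv.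
Qed.

Lemma pderiv_expR f i x : smooth_on U f -> U x ->
  pderiv i (fun z => expR (f z)) x = expR (f x) * pderiv i f x.
Proof.
move=> sf Ux; have df := smooth_differentiable sf Ux.
have dE : differentiable (expR : R -> R) (f x) by apply/derivable1_diffP/derivable_expR.
rewrite /pderiv deriveE; last exact: (@differentiable_comp _ _ _ _ f expR).
rewrite (@diff_comp _ _ _ _ f expR) //= deriveE //.
by rewrite diff1E // derive1E (@derive_val _ _ _ _ _ _ _ (is_derive_expR _)) /GRing.scale /= mulrC.
Qed.

Lemma differentiable_expR f x : smooth_on U f -> U x ->
  differentiable (fun z => expR (f z)) x.
Proof.
move=> sf Ux; apply: (@differentiable_comp _ _ _ _ f expR).
  exact: smooth_differentiable sf Ux.
by apply/derivable1_diffP/derivable_expR.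
Qed.

Lemma smooth_expR f : smooth_on U f -> smooth_on U (fun x => expR (f x)).
Proof.
move=> sf; apply/smooth_onP => m; elim: m => [|m IH]; split=> //.
- by move=> x Ux; apply: differentiable_expR.
- by move=> x Ux; apply: differentiable_expR.
move=> i; have := diff_upto_mul IH ((smooth_onP _ _).1 (smooth_pderiv i sf) m).
by apply: diff_upto_eq => // x /set_mem Ux; rewrite pderiv_expR.
Qed.

Lemma pderiv_coord p q (F : 'rV[R]_n -> 'M[R]_(p, q)) i a b x :
  differentiable F x -> pderiv i (fun z => F z a b) x = pderiv i F x a b.
Proof. by move=> dF; rewrite /pderiv derive_mx ?mxE //; apply: diff_derivable. Qed.

Lemma smooth_coord p q (F : 'rV[R]_n -> 'M[R]_(p, q)) a b :
  smooth_on U F -> smooth_on U (fun x => F x a b).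
Proof.
have H (G : 'rV[R]_n -> 'M[R]_(p, q)) : (forall x, U x -> differentiable G x) ->
    forall x, U x -> differentiable (fun x => G x a b) x.
  move=> dG x Ux; apply: (@differentiable_comp _ _ _ _ G (fun M : 'M[R]_(p, q) => M a b)).
    exact: dG.
  exact: differentiable_coord.
move=> /smooth_onP sF; apply/smooth_onP => m.
elim: m F sF => [|m IH] F sF; have [dF _] := sF 0%N; split=> //; try exact: H.
move=> i; apply: diff_upto_eq (IH (pderiv i F) _) => //.
  by move=> x /set_mem Ux; rewrite pderiv_coord //; apply: dF.
by move=> l; apply: (sF l.+1).2.
Qed.

Lemma smooth_det p (F : 'I_p -> 'I_p -> 'rV[R]_n -> R) :
  (forall a b, smooth_on U (F a b)) -> smooth_on U (fun x => \det (\matrix_(a, b) F a b x)).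
Proof.
move=> sF; rewrite /determinant; apply: smooth_sum => s _; apply: smoothM.
  exact: smooth_cst.
apply: smooth_prod => a _.
by under eq_fun do rewrite mxE; apply: sF.
Qed.

(** Cramer's formula: determinant and adjugate are polynomial in the entries of F. *)
Lemma smooth_invmx p (F : 'rV[R]_n -> 'M[R]_p) a b :
  (forall x, U x -> F x \in unitmx) ->
  (forall a b, smooth_on U (fun x => F x a b)) -> smooth_on U (fun x => invmx (F x) a b).
Proof.
move=> uF sF.
have E x : F x = \matrix_(c, d) F x c d by apply/matrixP => c d; rewrite mxE.
have sdet : smooth_on U (fun x => \det (F x)).
  by have := smooth_det sF; under eq_fun do rewrite -E.
have sadj : smooth_on U (fun x => (\adj (F x)) a b).
  under eq_fun do rewrite mxE /cofactor.
  apply: smoothM; first exact: smooth_cst.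
  (* Minors are indexed through [lift], which requires a nonzero size; in size 0 there is no index
     [a]. *)
  case: p F uF sF E sdet a b => [|p] F uF sF E sdet a b; first by case: a.
  have := @smooth_det p (fun c d x => F x (lift b c) (lift a d)).
  move=> /(_ (fun c d => sF _ _)); apply: smooth_eq => // x _.
  by congr (\det _); apply/matrixP => c d; rewrite !mxE.
have sV := smoothV (f := fun x => \det (F x)) _ sdet.
have : smooth_on U (fun x => (\det (F x))^-1 * (\adj (F x)) a b).
  apply: smoothM sadj; apply: sV => x Ux.
  by have := uF x Ux; rewrite unitmxE unitfE.
by apply: smooth_eq => // x /set_mem Ux; rewrite /invmx uF // !mxE.
Qed.

End Rules.
End LocalCalculus.

(** * Symmetry of second partial derivatives *)

Section Schwarz.
Context {R : realType} {n : nat}.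
Implicit Types (U : set 'rV[R]_n) (F : 'rV[R]_n -> R).

Lemma differentiable_bound F x (e : R) : differentiable F x -> 0 < e ->
  exists2 d : R, 0 < d & forall v, `|v| < d ->
    `|F (v + x) - F x - 'd F x v| <= e * `|v|.
Proof.
move=> /diff_locallyP[_ /eqaddoP/(_ e)] H /H /nbhs_normP[d /= d0 Hd]; exists d => // v vd.
have := Hd v; rewrite /= sub0r normrN => /(_ vd) /=.
by rewrite !fctE /= /shift opprD addrA.
Qed.

Lemma is_derive_line F (v w : 'rV[R]_n) (t : R) : differentiable F (t *: v + w) ->
  is_derive t 1 (fun s : R => F (s *: v + w)) ('D_v F (t *: v + w)).
Proof.
move=> dF; pose g (s : R) : 'rV[R]_n := s *: v + w.
have dg : is_diff t g (fun s : R => s *: v).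
  have : is_diff t (( *:%R ^~ v) + cst w) (( *:%R ^~ v : R -> 'rV[R]_n) + 0).
    exact: is_diffD.
  by rewrite addr0.
have dFg : differentiable (F \o g) t by apply: differentiable_comp => //.
apply: DeriveDef; first exact: diff_derivable.
rewrite (deriveE _ dFg) (@diff_comp _ _ _ _ g F) //= (@diff_val _ _ _ _ _ _ _ dg) scale1r.
by rewrite deriveE.
Qed.

(** The mean value theorem along ['e_i] turns the second difference into h times a difference of two
    values of the i-th partial derivative; differentiability of the latter at the single point x
    evaluates that difference to first order. *)
Lemma mixed_difference U F (i j : 'I_n) x (e : R) : open U -> U x ->
  (forall z, U z -> differentiable F z) -> differentiable (pderiv i F) x -> 0 < e ->
  exists2 d : R, 0 < d & forall h, 0 < h < d ->
    `|F (h *: 'e_i + (h *: 'e_j + x)) - F (h *: 'e_i + x) - (F (h *: 'e_j + x) - F x)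
      - h * h * pderiv j (pderiv i F) x| <= e * (h * h).
Proof.
move=> oU Ux dF dG e0; set G := pderiv i F.
pose N := `|('e_i : 'rV[R]_n)| + `|('e_j : 'rV[R]_n)| + 1.
have N0 : 0 < N by rewrite ltr_wpDl // addr_ge0.
(* Both points lie within hN of x, so each first-order expansion errs by at most e/(2N) times hN =
   eh/2; two of them, times the h of the mean value theorem, make e h^2. *)
have [d1 d10 Hd1] := differentiable_bound dG (divr_gt0 e0 (mulr_gt0 (ltr0n R 2) N0)).
have /nbhs_normP[r /= r0 Hr] : nbhs x U by apply: open_nbhs_nbhs.
pose d := Num.min d1 r / N.
exists d; first by rewrite divr_gt0 // lt_min d10 r0.
move=> h /andP[h0 hd].
(* The boolean switches the increment along ['e_j] on or off, so that both evaluation points are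
   controlled at once. *)
have small c : 0 <= c -> c <= h -> forall b : bool,
    `|c *: ('e_i : 'rV[R]_n) + (h *+ b) *: 'e_j| <= h * N /\
    `|c *: ('e_i : 'rV[R]_n) + (h *+ b) *: 'e_j| < d1 /\ U (c *: 'e_i + (h *+ b) *: 'e_j + x).
  move=> c0 ch b.
  have L : `|c *: ('e_i : 'rV[R]_n) + (h *+ b) *: 'e_j| <= h * N.
    rewrite (le_trans (ler_normD _ _)) // !normrZ ger0_norm // /N.
    have hb : `|h *+ b| <= h by case: b; rewrite ?mulr0n ?normr0 ?mulr1n ?(gtr0_norm h0) // ltW.
    have := ler_wpM2r (normr_ge0 ('e_i : 'rV[R]_n)) ch.
    have := ler_wpM2r (normr_ge0 ('e_j : 'rV[R]_n)) hb.
    by move: h0; lra.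
  have hN : h * N < Num.min d1 r by move: hd; rewrite /d ltr_pdivlMr.
  split=> //; split; first by rewrite (le_lt_trans L) // (lt_le_trans hN) // ge_min lexx.
  apply: Hr => /=; rewrite opprD addrCA subrr addr0 normrN (le_lt_trans L) // (lt_le_trans hN) //.
  by rewrite ge_min lexx orbT.
pose phi t := F (t *: 'e_i + (h *: 'e_j + x)) - F (t *: 'e_i + x).
have phiD t : 0 <= t <= h -> is_derive t 1 phi
    (G (t *: 'e_i + (h *: 'e_j + x)) - G (t *: 'e_i + x)).
  move=> /andP[t0 th]; apply: is_deriveB; apply: is_derive_line; apply: dF.
    by have [_ [_]] := small t t0 th true; rewrite mulr1n addrA.
  by have [_ [_]] := small t t0 th false; rewrite mulr0n scale0r addr0.
have [||c /[!in_itv] /= /andP[c0 ch] E] := @MVT R phi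
    (fun t => G (t *: 'e_i + (h *: 'e_j + x)) - G (t *: 'e_i + x)) 0 h h0.
- by move=> t /[!in_itv] /= /andP[t0 th]; apply: phiD; rewrite !ltW.
- apply: derivable_within_continuous => t /[!in_itv] /= th.
  by have := phiD t th => -[].
have [L1 [L2 _]] := small c (ltW c0) (ltW ch) true.
have [K1 [K2 _]] := small c (ltW c0) (ltW ch) false.
rewrite mulr1n in L1 L2; rewrite mulr0n in K1 K2.
have B1 := Hd1 _ L2; have B2 := Hd1 _ K2.
have -> : F (h *: 'e_i + (h *: 'e_j + x)) - F (h *: 'e_i + x) - (F (h *: 'e_j + x) - F x) =
    phi h - phi 0 by rewrite /phi !scale0r !add0r.
rewrite E subr0.
have dGE : pderiv j G x = 'd G x 'e_j by rewrite /pderiv deriveE.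
rewrite dGE.
set a := G _; set b := G _.
have -> : (a - b) * h - h * h * 'd G x 'e_j =
   h * ((a - G x - 'd G x (c *: 'e_i + h *: 'e_j)) - (b - G x - 'd G x (c *: 'e_i))).
  rewrite !linearD !linearZ /= /GRing.scale /=; ring.
rewrite normrM gtr0_norm // [e * _]mulrCA ler_pM2l //.
rewrite (le_trans (ler_normB _ _)) //.
rewrite -(addrA (c *: _)) -/a in B1; rewrite scale0r addr0 -/b in B2.
have hN (q : R) : q <= h * N -> e / (2 * N) * q <= e * h / 2.
  move=> qh; have := ler_wpM2l (ltW (divr_gt0 e0 (mulr_gt0 (ltr0n R 2) N0))) qh.
  suff -> : e / (2 * N) * (h * N) = e * h / 2 by [].
  by field; rewrite gt_eqF.
have := hN _ L1; have := hN _ K1; rewrite scale0r addr0 => X Y.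
by apply: le_trans (lerD (le_trans B1 Y) (le_trans B2 X)) _; rewrite -splitr.
Qed.

(** The second difference is symmetric in i and j, so both mixed derivatives, multiplied by h^2, lie
    within e h^2/2 of the same number. *)
Lemma pderivC U F (i j : 'I_n) x : open U -> smooth_on U F -> U x ->
  pderiv i (pderiv j F) x = pderiv j (pderiv i F) x.
Proof.
move=> oU sF Ux; apply/eqP; rewrite -subr_eq0 -normr_le0; apply/ler_addgt0Pl => e e0.
rewrite addr0.
have dF z : U z -> differentiable F z by apply: smooth_differentiable sF.
have dG k : differentiable (pderiv k F) x.
  exact: smooth_differentiable (smooth_pderiv k sF) Ux.
have e20 : 0 < e / 2 by rewrite divr_gt0.
have [d1 d10 H1] := mixed_difference j oU Ux dF (dG i) e20.
have [d2 d20 H2] := mixed_difference i oU Ux dF (dG j) e20.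
pose h := Num.min d1 d2 / 2.
have m0 : 0 < Num.min d1 d2 by rewrite lt_min d10.
have h0 : 0 < h by rewrite divr_gt0.
have hm : h < Num.min d1 d2 by rewrite /h; lra.
have := H1 h; have := H2 h; rewrite h0 /=.
move: (hm); rewrite lt_min => /andP[-> ->] /(_ isT) A /(_ isT) B.
rewrite -(ler_pM2l (mulr_gt0 h0 h0)).
rewrite -[X in X * `|_|](gtr0_norm (mulr_gt0 h0 h0)) -normrM.
move: A B; rewrite [h *: 'e_j + (h *: 'e_i + x)]addrCA.
set p := F _; set q := F _; set r := F _; set s := F _.
set X := pderiv _ _ _; set Y := pderiv _ _ _ => A B.
have -> : h * h * (X - Y) = (p - r - (q - s) - h * h * Y) - (p - q - (r - s) - h * h * X).
  by ring.
apply: le_trans (ler_normB _ _) _.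
by apply: le_trans (lerD B A) _; rewrite [in leRHS]mulrC -mulrDl -splitr.
Qed.

End Schwarz.

(** * Chain rule and smoothness of composites *)

Section ChainRule.
Context {R : realType} {k n : nat}.
Variables (V : set 'rV[R]_k) (U : set 'rV[R]_n) (f : 'rV[R]_k -> 'rV[R]_n).
Hypotheses (oV : open V) (oU : open U) (sf : smooth_on V f).
Hypothesis fVU : forall y, V y -> U (f y).

Lemma pderiv_comp (h : 'rV[R]_n -> R) al y : smooth_on U h -> V y ->
  pderiv al (fun z => h (f z)) y =
  \sum_a pderiv a h (f y) * pderiv al (fun z => f z 0 a) y.
Proof.
move=> sh Vy; have df := smooth_differentiable sf Vy.
have dh := smooth_differentiable sh (fVU Vy).
rewrite /pderiv deriveE; last exact: (@differentiable_comp _ _ _ _ f h).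
rewrite (@diff_comp _ _ _ _ f h) //= [X in 'd h _ X]row_sum_delta linear_sum.
apply: eq_bigr => a _; rewrite linearZ /= [LHS]mulrC; congr (_ * _).
  by rewrite deriveE.
by have := pderiv_coord al 0 a df; rewrite /pderiv => ->; rewrite deriveE.
Qed.

(** By the chain rule a derivative of the composite is a sum of products of composites with other
    outer functions and derivatives of f; hence the induction on the order is over all h
    simultaneously. *)
Lemma smooth_comp (h : 'rV[R]_n -> R) : smooth_on U h -> smooth_on V (fun y => h (f y)).
Proof.
move=> sh; apply/smooth_onP => m; elim: m h sh => [|m IH] h sh.
  split=> // y Vy; apply: (@differentiable_comp _ _ _ _ f h).
    exact: smooth_differentiable sf Vy.
  exact: smooth_differentiable sh (fVU Vy).
split; first by case: (m) (IH h sh) => [|m'] [].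
move=> al.
apply: (@diff_upto_eq _ _ _ V m (fun y => \sum_a pderiv a h (f y) * pderiv al (fun z => f z 0 a) y)) => //.
  by move=> y /set_mem Vy; rewrite pderiv_comp.
have : forall (r : seq 'I_n), diff_upto V m (fun y => \sum_(a <- r) pderiv a h (f y) * pderiv al (fun z => f z 0 a) y).
  elim=> [|a r IHr].
    by under eq_fun do rewrite big_nil; move: m {IH}; apply/smooth_onP; exact: smooth_cst.
  under eq_fun do rewrite big_cons.
  apply: diff_upto_add => //; apply: diff_upto_mul => //.
    by apply: IH; apply: smooth_pderiv.
  by move: m {IH IHr}; apply/smooth_onP; apply/smooth_pderiv/smooth_coord.
exact.
Qed.

End ChainRule.

(* [pderiv] at a scalar function, with codomain [R] instead of the carrier of the
   normed module that the elaboration of [pderiv] infers. *)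
HB.lock Definition pd (R : realType) (n : nat) (i : 'I_n) (f : 'rV[R]_n -> R) (x : 'rV[R]_n) : R :=
  pderiv i f x.

Section ScalarDerivative.
Context {R : realType} {n : nat}.
Variable U : set 'rV[R]_n.
Hypothesis oU : open U.
Implicit Types (f h : 'rV[R]_n -> R) (x : 'rV[R]_n) (i j : 'I_n).

Lemma smooth_pd f i : smooth_on U f -> smooth_on U (pd i f).
Proof. by rewrite unlock; exact: smooth_pderiv. Qed.

Lemma pd_cst (c : R) i x : pd i (fun _ => c) x = 0.
Proof. by rewrite unlock; exact: pderiv_cst. Qed.

Lemma pd_eq f h i x : {in U, f =1 h} -> U x -> pd i f x = pd i h x.
Proof using oU. move=> fh Ux; rewrite unlock; exact: pderiv_eq fh Ux. Qed.

Lemma pdD f h i x : smooth_on U f -> smooth_on U h -> U x ->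
  pd i (fun z => f z + h z) x = pd i f x + pd i h x.
Proof using oU. by rewrite unlock; exact: pderivD. Qed.

Lemma pdN f i x : smooth_on U f -> U x -> pd i (fun z => - f z) x = - pd i f x.
Proof using oU. by rewrite unlock; exact: pderivN. Qed.

Lemma pdB f h i x : smooth_on U f -> smooth_on U h -> U x ->
  pd i (fun z => f z - h z) x = pd i f x - pd i h x.
Proof using oU. by rewrite unlock; exact: pderivB. Qed.

Lemma pdM f h i x : smooth_on U f -> smooth_on U h -> U x ->
  pd i (fun z => f z * h z) x = pd i f x * h x + f x * pd i h x.
Proof using oU. by rewrite unlock; exact: pderivM. Qed.

Lemma pdZ (c : R) f i x : smooth_on U f -> U x -> pd i (fun z => c * f z) x = c * pd i f x.
Proof using oU. by rewrite unlock; exact: pderivZ. Qed.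

Lemma pd_sum (I : Type) (r : seq I) (P : pred I) (f : I -> 'rV[R]_n -> R) i x :
  (forall l, P l -> smooth_on U (f l)) -> U x ->
  pd i (fun z => \sum_(l <- r | P l) f l z) x = \sum_(l <- r | P l) pd i (f l) x.
Proof using oU. by rewrite unlock; exact: pderiv_sum. Qed.

Lemma pd_expR f i x : smooth_on U f -> U x ->
  pd i (fun z => expR (f z)) x = expR (f x) * pd i f x.
Proof. by rewrite unlock; exact: pderiv_expR. Qed.

Lemma pdC f i j x : smooth_on U f -> U x -> pd i (pd j f) x = pd j (pd i f) x.
Proof using oU. by rewrite unlock; exact: pderivC. Qed.

End ScalarDerivative.

Lemma pd_comp (R : realType) k n (V : set 'rV[R]_k) (U : set 'rV[R]_n)
    (f : 'rV[R]_k -> 'rV[R]_n) (h : 'rV[R]_n -> R) al y :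
  smooth_on V f -> (forall y, V y -> U (f y)) -> smooth_on U h -> V y ->
  pd al (fun z => h (f z)) y = \sum_a pd a h (f y) * pd al (fun z => f z 0 a) y.
Proof.
move=> sf fVU sh Vy; rewrite unlock; exact: (pderiv_comp sf fVU al sh Vy).
Qed.

(** * Contractions *)

(** With the inverse metric for [M] this is the metric trace. The lock makes contractions atoms, so
    that tensor identities become polynomial identities for [ring]. *)
HB.lock Definition ctr (R : comPzRingType) (m : nat) (M : 'M[R]_m) (t : 'I_m -> 'I_m -> R) : R :=
  \sum_i \sum_j M i j * t i j.

Section Contraction.
Context {R : comPzRingType} {m : nat}.
Implicit Types (M : 'M[R]_m) (t : 'I_m -> 'I_m -> R) (v : 'I_m -> R).

Lemma ctrE M t : ctr M t = \sum_i \sum_j M i j * t i j.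
Proof. by rewrite ctr.unlock. Qed.

Lemma eq_ctr M t t' : (forall i j, t i j = t' i j) -> ctr M t = ctr M t'.
Proof. by move=> E; rewrite !ctrE; apply: eq_bigr => i _; apply: eq_bigr => j _; rewrite E. Qed.

Lemma ctrD M t t' : ctr M (fun i j => t i j + t' i j) = ctr M t + ctr M t'.
Proof.
rewrite !ctrE -big_split; apply: eq_bigr => i _; rewrite -big_split.
by apply: eq_bigr => j _; rewrite mulrDr.
Qed.

Lemma ctrZ M c t : ctr M (fun i j => c * t i j) = c * ctr M t.
Proof.
rewrite !ctrE mulr_sumr; apply: eq_bigr => i _; rewrite mulr_sumr.
by apply: eq_bigr => j _; rewrite mulrCA.
Qed.

Lemma ctrZr M c t : ctr M (fun i j => t i j * c) = ctr M t * c.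
Proof. by rewrite mulrC -ctrZ; apply: eq_ctr => i j; rewrite mulrC. Qed.

Lemma ctrN M t : ctr M (fun i j => - t i j) = - ctr M t.
Proof. by rewrite -mulN1r -ctrZ; apply: eq_ctr => i j; rewrite mulN1r. Qed.

Lemma ctr0 M : ctr M (fun _ _ => 0) = 0.
Proof. by rewrite !ctrE big1 // => i _; rewrite big1 // => j _; rewrite mulr0. Qed.

Lemma ctr_scale a M t : ctr (a *: M) t = a * ctr M t.
Proof.
rewrite !ctrE mulr_sumr; apply: eq_bigr => i _; rewrite mulr_sumr.
by apply: eq_bigr => j _; rewrite mxE mulrA.
Qed.

Lemma ctr_sum (I : finType) M (t : I -> 'I_m -> 'I_m -> R) :
  ctr M (fun i j => \sum_l t l i j) = \sum_l ctr M (t l).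
Proof.
rewrite ctrE; under [RHS]eq_bigr do rewrite ctrE.
rewrite [RHS]exchange_big; apply: eq_bigr => i _; rewrite [RHS]exchange_big.
by apply: eq_bigr => j _; rewrite mulr_sumr.
Qed.

Lemma ctr_sym M t : (forall i j, M i j = M j i) -> ctr M t = ctr M (fun i j => t j i).
Proof.
move=> sM; rewrite !ctrE exchange_big; apply: eq_bigr => i _; apply: eq_bigr => j _.
by rewrite sM.
Qed.

Lemma sumMD v (p q : 'I_m -> R) :
  \sum_d v d * (p d + q d) = \sum_d v d * p d + \sum_d v d * q d.
Proof. by rewrite -big_split; apply: eq_bigr => d _; rewrite mulrDr. Qed.

Lemma sumMN v (p : 'I_m -> R) : \sum_d v d * (- p d) = - \sum_d v d * p d.
Proof. by rewrite -sumrN; apply: eq_bigr => d _; rewrite mulrN. Qed.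

Lemma sumMZ v c (p : 'I_m -> R) : \sum_d v d * (c * p d) = c * \sum_d v d * p d.
Proof. by rewrite mulr_sumr; apply: eq_bigr => d _; rewrite mulrCA. Qed.

Lemma sumMZr v c (p : 'I_m -> R) : \sum_d v d * (p d * c) = (\sum_d v d * p d) * c.
Proof. by rewrite mulr_suml; apply: eq_bigr => d _; rewrite mulrA. Qed.

Definition sumlin := (sumMD, sumMN, sumMZ, sumMZr).

Lemma sum_delta (a : 'I_m) (p : 'I_m -> R) : \sum_d (d == a)%:R * p d = p a.
Proof.
rewrite (bigD1 a) //= eqxx mul1r big1 ?addr0 // => d /negbTE ->.
by rewrite mul0r.
Qed.

Lemma sum_deltar (a : 'I_m) (p : 'I_m -> R) : \sum_d p d * (d == a)%:R = p a.
Proof. by rewrite -[RHS](sum_delta a p); apply: eq_bigr => d _; rewrite mulrC. Qed.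

Variables (G Gi : 'M[R]_m).
Hypotheses (sG : forall i j, G i j = G j i) (sGi : forall i j, Gi i j = Gi j i).
Hypothesis GiG : Gi *m G = 1%:M.

Lemma sum_inv c j : \sum_i Gi c i * G i j = (c == j)%:R.
Proof. by have := congr1 (fun A : 'M[R]_m => A c j) GiG; rewrite !mxE. Qed.

(** Contracting with the metric renames an index. Rewriting matches slots and factors literally,
    hence the eight variants collected in [ctr_met]. *)
Lemma ctr_met_r v c : ctr Gi (fun i j => v i * G j c) = v c.
Proof.
rewrite !ctrE -[RHS](sum_delta c v); apply: eq_bigr => i _.
rewrite -(sum_inv i c) mulr_suml; apply: eq_bigr => j _; by rewrite mulrCA mulrC.
Qed.

Lemma ctr_met_rs v c : ctr Gi (fun i j => v i * G c j) = v c.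
Proof. by rewrite -[RHS](ctr_met_r v c); apply: eq_ctr => i j; rewrite (sG c). Qed.

Lemma ctr_met_rC v c : ctr Gi (fun i j => G j c * v i) = v c.
Proof. by rewrite -[RHS](ctr_met_r v c); apply: eq_ctr => i j; rewrite mulrC. Qed.

Lemma ctr_met_rsC v c : ctr Gi (fun i j => G c j * v i) = v c.
Proof. by rewrite -[RHS](ctr_met_rs v c); apply: eq_ctr => i j; rewrite mulrC. Qed.

Lemma ctr_met_l v c : ctr Gi (fun i j => v j * G i c) = v c.
Proof. by rewrite ctr_sym // ctr_met_r. Qed.

Lemma ctr_met_ls v c : ctr Gi (fun i j => v j * G c i) = v c.
Proof. by rewrite ctr_sym // ctr_met_rs. Qed.

Lemma ctr_met_lC v c : ctr Gi (fun i j => G i c * v j) = v c.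
Proof. by rewrite ctr_sym // ctr_met_rC. Qed.

Lemma ctr_met_lsC v c : ctr Gi (fun i j => G c i * v j) = v c.
Proof. by rewrite ctr_sym // ctr_met_rsC. Qed.

Definition ctr_met := (ctr_met_r, ctr_met_rs, ctr_met_rC, ctr_met_rsC,
  ctr_met_l, ctr_met_ls, ctr_met_lC, ctr_met_lsC).

Lemma ctr_dim : ctr Gi (fun i j => G i j) = m%:R.
Proof.
rewrite !ctrE (eq_bigr (fun _ => 1)) ?sumr_const ?card_ord // => i _.
by under eq_bigr do rewrite sG; rewrite sum_inv eqxx.
Qed.

Lemma ctr_sum_up v t c : \sum_d (\sum_e Gi d e * v e) * t d c = ctr Gi (fun d e => t d c * v e).
Proof.
rewrite !ctrE; apply: eq_bigr => d _; rewrite mulr_suml; apply: eq_bigr => e _.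
by rewrite [t d c * _]mulrC mulrA.
Qed.

End Contraction.

Lemma ctr_exch (R : comPzRingType) m p (M : 'M[R]_m) (N : 'M[R]_p)
  (t : 'I_m -> 'I_m -> 'I_p -> 'I_p -> R) :
  ctr M (fun i j => ctr N (fun k l => t i j k l)) =
  ctr N (fun k l => ctr M (fun i j => t i j k l)).
Proof.
transitivity (ctr M (fun i j => \sum_k \sum_l N k l * t i j k l)).
  by apply: eq_ctr => i j; rewrite ctrE.
rewrite [RHS]ctrE ctr_sum.
by apply: eq_bigr => k _; rewrite ctr_sum; apply: eq_bigr => l _; rewrite ctrZ.
Qed.

Ltac smooth_atom := solve [assumption | auto with smoothdb].

Ltac smooth := repeat first
  [ match goal with
    | |- forall _, smooth_on _ _ => move=> ?
    | |- forall _ _, smooth_on _ _ => move=> ? ?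
    | |- forall _ _ _, smooth_on _ _ => move=> ? ? ?
    | |- forall _ _ _ _, smooth_on _ _ => move=> ? ? ? ?
    | |- smooth_on _ (fun _ => ?c) => exact: smooth_cst
    | |- smooth_on _ (fun _ => _ + _) => apply: smoothD => //
    | |- smooth_on _ (fun _ => - _) => apply: smoothN => //
    | |- smooth_on _ (fun _ => _ * _) => apply: smoothM => //
    | |- smooth_on _ (fun _ => @bigop.body _ _ _ _ _) => apply: smooth_sum => // ? _
    | |- smooth_on _ (pd _ _) => apply: smooth_pd
    | |- smooth_on _ (fun _ => pd _ _ _) => apply: smooth_pd
    | |- smooth_on _ (fun _ => ctr _ _) => rewrite ctr.unlock
    end
  | smooth_atom ].

(** * Calculus of matrix-valued functions *)

Section MatrixDerivative.
Context {R : realType} {n p : nat}.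
Variable U : set 'rV[R]_n.
Hypothesis oU : open U.
Implicit Types (A B : 'rV[R]_n -> 'M[R]_p) (x : 'rV[R]_n).

Definition dmx (a : 'I_n) A x : 'M[R]_p := \matrix_(i, j) pd a (fun z => A z i j) x.

Local Notation smooth_mx A := (forall i j, smooth_on U (fun x => A x i j)).

Lemma smooth_mxM A B : smooth_mx A -> smooth_mx B -> smooth_mx (fun x => (A x *m B x)).
Proof.
move=> sA sB i j; apply: smooth_ext; first by move=> x; rewrite mxE.
by smooth.
Qed.

Lemma dmxE a A x i j : dmx a A x i j = pd a (fun z => A z i j) x.
Proof. by rewrite mxE. Qed.

Lemma smooth_dmx a A : smooth_mx A -> smooth_mx (dmx a A).
Proof.
move=> sA i j; apply: smooth_ext; first by move=> x; rewrite mxE.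
by smooth.
Qed.

Lemma dmxM a A B x : smooth_mx A -> smooth_mx B -> U x ->
  dmx a (fun z => A z *m B z) x = dmx a A x *m B x + A x *m dmx a B x.
Proof.
move=> sA sB Ux; apply/matrixP => i j; rewrite !mxE.
under eq_fun do rewrite mxE.
rewrite (pd_sum oU) //; last by move=> l _; smooth.
rewrite -big_split; apply: eq_bigr => l _.
by rewrite (pdM oU) ?mxE.
Qed.

Lemma dmxD a A B x : smooth_mx A -> smooth_mx B -> U x ->
  dmx a (fun z => A z + B z) x = dmx a A x + dmx a B x.
Proof.
move=> sA sB Ux; apply/matrixP => i j; rewrite !mxE.
under eq_fun do rewrite mxE.
by rewrite (pdD oU).
Qed.

Lemma dmxN a A x : smooth_mx A -> U x -> dmx a (fun z => - A z) x = - dmx a A x.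
Proof.
move=> sA Ux; apply/matrixP => i j; rewrite !mxE.
under eq_fun do rewrite mxE.
by rewrite (pdN oU).
Qed.

Lemma dmxT a A x : dmx a (fun z => (A z)^T) x = (dmx a A x)^T.
Proof. apply/matrixP => i j; rewrite !mxE.
by under eq_fun do rewrite mxE.
Qed.

Lemma dmxC a b A x : smooth_mx A -> U x -> dmx a (dmx b A) x = dmx b (dmx a A) x.
Proof.
move=> sA Ux; apply/matrixP => i j.
have E c e : dmx c (dmx e A) x i j = pd c (pd e (fun z => A z i j)) x.
  by rewrite dmxE; congr (pd _ _ _); apply/funext => z; rewrite dmxE.
exact: etrans (E a b) (etrans (pdC oU _ _ (sA i j) Ux) (esym (E b a))).
Qed.

Lemma dmx_eq a A B x : {in U, A =1 B} -> U x -> dmx a A x = dmx a B x.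
Proof.
move=> AB Ux; apply/matrixP => i j; rewrite !mxE.
by apply: (pd_eq oU) => // z zU; rewrite AB.
Qed.

End MatrixDerivative.

Lemma mxDE (R : nmodType) m p (A B : 'M[R]_(m, p)) i j : (A + B) i j = A i j + B i j.
Proof. by rewrite mxE. Qed.
Lemma mxNE (R : zmodType) m p (A : 'M[R]_(m, p)) i j : (- A) i j = - A i j.
Proof. by rewrite mxE. Qed.

(* [Gi] is the inverse metric of a bundle over [U] with connection
   coefficients [om], [om d a b] being the d-component of the derivative of the b-th
   frame field in the direction a. *)
Lemma pderiv_ctr (R : realType) n p (U : set 'rV[R]_n) (G : 'rV[R]_n -> 'M[R]_p)
    (om : 'I_p -> 'I_n -> 'I_p -> R) (t : 'rV[R]_n -> 'I_p -> 'I_p -> R) a x :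
  open U -> U x -> (forall x, U x -> G x \in unitmx) ->
  (forall i j, smooth_on U (fun x => G x i j)) ->
  (forall i j, smooth_on U (fun x => t x i j)) ->
  (forall b c, pd a (fun z => G z b c) x =
     \sum_d om d a b * G x d c + \sum_d om d a c * G x b d) ->
  pd a (fun z => ctr (invmx (G z)) (t z)) x =
  ctr (invmx (G x)) (fun b c => pd a (fun z => t z b c) x
    - \sum_d om d a b * t x d c - \sum_d om d a c * t x b d).
Proof.
move=> oU Ux uG sG st cG.
have sGi : forall i j, smooth_on U (fun z => invmx (G z) i j) by move=> i j; apply: smooth_invmx.
pose O : 'M[R]_p := \matrix_(b, d) om d a b.
have dG : dmx a G x = O *m G x + G x *m O^T.
  apply/matrixP => b c; rewrite !mxE cG; congr (_ + _); apply: eq_bigr => d _.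
    by rewrite mxE.
  by rewrite !mxE mulrC.
(* Obtained by differentiating G^{-1} G = 1 and inserting [dG]; the two products with [O] become the
   connection terms of the two contracted indices. *)
have dGi : dmx a (fun z => invmx (G z)) x = - (invmx (G x) *m O + O^T *m invmx (G x)).
  have E : dmx a (fun z => invmx (G z) *m G z) x = 0.
    rewrite (@dmx_eq _ _ _ U oU _ _ (fun _ => 1%:M)) //.
      by apply/matrixP => i j; rewrite !mxE; apply: pd_cst.
    by move=> z /set_mem Uz; rewrite mulVmx // uG.
  rewrite (dmxM oU) // dG mulmxDr !mulmxA mulVmx ?uG // mul1mx in E.
  have := congr1 (fun M => M *m invmx (G x)) E.
  rewrite !mulmxDl mul0mx -!mulmxA mulmxV ?uG // !mulmx1 => /eqP.
  rewrite addrA -[X in X == _]addrA addrC -addrA => /eqP E'.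
  apply/eqP; rewrite eq_sym eqr_oppLR -addr_eq0; apply/eqP.
  by rewrite -addrA.
rewrite ctr.unlock (pd_sum oU) //; last by move=> i _; smooth.
under eq_bigr => i _.
  rewrite (pd_sum oU) //; last by move=> j _; smooth.
  under eq_bigr => j _.
    rewrite (pdM oU) //.
    have -> : pd a (fun z => invmx (G z) i j) x = - ((invmx (G x) *m O) i j + (O^T *m invmx (G x)) i j).
      by have := congr1 (fun M : 'M[R]_p => M i j) dGi; rewrite !mxE.
    rewrite mulNr mulrDl opprD; over.
  rewrite !big_split /= !sumrN; over.
rewrite !big_split /= !sumrN.
under [RHS]eq_bigr => i _.
  under eq_bigr => j _ do rewrite -addrA !mulrDr !mulrN.
  rewrite !big_split /= !sumrN; over.
rewrite !big_split /= !sumrN addrC; congr (_ + _).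
rewrite addrC; congr (- _ - _).
  under eq_bigr => i _ do under eq_bigr => j _ do rewrite mxE mulr_suml.
  under eq_bigr => i _ do rewrite exchange_big /=.
  rewrite exchange_big; apply: eq_bigr => d _; rewrite exchange_big /=.
  apply: eq_bigr => j _; rewrite mulr_sumr; apply: eq_bigr => i _.
  by rewrite !mxE [om _ _ _ * _]mulrC mulrA.
under eq_bigr => i _ do under eq_bigr => j _ do rewrite mxE mulr_suml.
apply: eq_bigr => i _; rewrite exchange_big; apply: eq_bigr => d _.
by rewrite mulr_sumr; apply: eq_bigr => j _; rewrite mxE mulrA.
Qed.

(** * Curvature and the Bianchi identities *)

(* Locked copies of the operators of the statement, so that [ring] and unification
   treat them as atoms. *)
HB.lock Definition gi (R : realType) n (g : 'rV[R]_n -> 'M[R]_n) x := ginv g x.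
HB.lock Definition Gamma (R : realType) n (g : 'rV[R]_n -> 'M[R]_n) x c a b := christoffel g x c a b.
HB.lock Definition cov1 (R : realType) n (g : 'rV[R]_n -> 'M[R]_n) t x a b := nabla1 g t x a b.
HB.lock Definition cov2 (R : realType) n (g : 'rV[R]_n -> 'M[R]_n) t x a b c := nabla2 g t x a b c.
HB.lock Definition cov3 (R : realType) n (g : 'rV[R]_n -> 'M[R]_n) t x a b c d := nabla3 g t x a b c d.
HB.lock Definition Rup (R : realType) n (g : 'rV[R]_n -> 'M[R]_n) x a b c d := riem_up g x a b c d.
HB.lock Definition Rm (R : realType) n (g : 'rV[R]_n -> 'M[R]_n) x a b c d := riem g x a b c d.
HB.lock Definition Ric (R : realType) n (g : 'rV[R]_n -> 'M[R]_n) x a b := ricci g x a b.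
HB.lock Definition Scal (R : realType) n (g : 'rV[R]_n -> 'M[R]_n) x := scal g x.
HB.lock Definition Jsch (R : realType) n (g : 'rV[R]_n -> 'M[R]_n) x := schoutenJ g x.
HB.lock Definition Psch (R : realType) n (g : 'rV[R]_n -> 'M[R]_n) x a b := schouten g x a b.
HB.lock Definition Weyl (R : realType) n (g : 'rV[R]_n -> 'M[R]_n) x a b c d := weyl g x a b c d.
HB.lock Definition Cot (R : realType) n (g : 'rV[R]_n -> 'M[R]_n) x a b c := cotton g x a b c.
HB.lock Definition cov4 (R : realType) n (g : 'rV[R]_n -> 'M[R]_n)
    (t : 'rV[R]_n -> 'I_n -> 'I_n -> 'I_n -> 'I_n -> R) x a b c d e : R :=
  pd a (fun z => t z b c d e) x
  - \sum_m Gamma g x m a b * t x m c d e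
  - \sum_m Gamma g x m a c * t x b m d e
  - \sum_m Gamma g x m a d * t x b c m e
  - \sum_m Gamma g x m a e * t x b c d m.

Ltac expose := rewrite ?pd.unlock ?gi.unlock ?Gamma.unlock ?cov1.unlock ?cov2.unlock
  ?cov3.unlock ?Rup.unlock ?Rm.unlock ?Ric.unlock ?Scal.unlock ?Jsch.unlock ?Psch.unlock
  ?Weyl.unlock ?Cot.unlock.

Section Unfolding.
Context {R : realType} {n : nat}.
Variable g : 'rV[R]_n -> 'M[R]_n.

Lemma giE x : gi g x = invmx (g x). Proof. by rewrite unlock. Qed.

Lemma GammaE x c a b : Gamma g x c a b =
  2^-1 * \sum_d gi g x c d *
    (pd a (fun z => g z b d) x + pd b (fun z => g z a d) x - pd d (fun z => g z a b) x).
Proof. by expose. Qed.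

Lemma cov1E t x a b : cov1 g t x a b =
  pd a (fun z => t z b) x - \sum_d Gamma g x d a b * t x d.
Proof. by expose. Qed.

Lemma cov2E t x a b c : cov2 g t x a b c =
  pd a (fun z => t z b c) x
  - \sum_d Gamma g x d a b * t x d c
  - \sum_d Gamma g x d a c * t x b d.
Proof. by expose. Qed.

Lemma cov3E t x a b c e : cov3 g t x a b c e =
  pd a (fun z => t z b c e) x
  - \sum_d Gamma g x d a b * t x d c e
  - \sum_d Gamma g x d a c * t x b d e
  - \sum_d Gamma g x d a e * t x b c d.
Proof. by expose. Qed.

Lemma cov4E t x a b c d e : cov4 g t x a b c d e =
  pd a (fun z => t z b c d e) x
  - \sum_m Gamma g x m a b * t x m c d e
  - \sum_m Gamma g x m a c * t x b m d e
  - \sum_m Gamma g x m a d * t x b c m e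
  - \sum_m Gamma g x m a e * t x b c d m.
Proof. by rewrite cov4.unlock. Qed.

Lemma Rup_cov x a b c d : Rup g x a b c d =
  cov2 g (cov1 g (@dcoord R n d)) x a b c - cov2 g (cov1 g (@dcoord R n d)) x b a c.
Proof. by expose. Qed.

Lemma RmE x a b c d : Rm g x a b c d = \sum_e Rup g x a b c e * g x e d.
Proof. by expose. Qed.

Lemma RicE x a b : Ric g x a b = \sum_c Rup g x a c b c.
Proof. by expose. Qed.

Lemma ScalE x : Scal g x = ctr (gi g x) (Ric g x).
Proof. by expose; rewrite ctr.unlock. Qed.

Lemma JschE x : Jsch g x = Scal g x / (2 * (n%:R - 1)).
Proof. by expose. Qed.

Lemma PschE x a b : Psch g x a b = (n%:R - 2)^-1 * (Ric g x a b - Jsch g x * g x a b).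
Proof. by expose. Qed.

Lemma WeylE x a b c d : Weyl g x a b c d =
  Rm g x a b c d
  - Psch g x a c * g x b d - Psch g x b d * g x a c
  + Psch g x a d * g x b c + Psch g x b c * g x a d.
Proof. by expose. Qed.

Lemma CotE x a b c : Cot g x a b c = cov2 g (Psch g) x a b c - cov2 g (Psch g) x b a c.
Proof. by expose. Qed.

End Unfolding.

Section MatrixBianchi.
Context {R : comPzRingType} {p : nat}.

(* [M i] is a connection matrix, [D i j] its derivative in the direction i and [S i j k]
   its second derivatives. *)
Lemma connection_bianchi (I : Type) (M : I -> 'M[R]_p) (D : I -> I -> 'M[R]_p)
    (S : I -> I -> I -> 'M[R]_p) :
  (forall i j l, S i j l = S j i l) ->
  let C a b := - D a b + D b a + M a *m M b - M b *m M a in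
  let K e a b := - S e a b + S e b a + (D e a *m M b + M a *m D e b)
     - (D e b *m M a + M b *m D e a) - M e *m C a b + C a b *m M e in
  forall e a b, K e a b + K a b e + K b e a = 0.
Proof.
move=> sS C K e a b; rewrite /K /C (sS b a) (sS b e) (sS a e).
rewrite !(mulmxDl, mulmxDr, mulmxN, mulNmx, mulmxA).
apply/matrixP => i j; rewrite !(mxDE, mxNE) [in RHS]mxE; ring.
Qed.

End MatrixBianchi.

(** A symmetric nondegenerate matrix field suffices for the tensor calculus, so the same lemmas
    serve [g], its rescaling and the induced metric. Positivity enters only in the passage from
    charts, where it gives the nondegeneracy. *)
Record metric_on (R : realType) (n : nat) (U : set 'rV[R]_n) (g : 'rV[R]_n -> 'M[R]_n) : Prop :=
  MetricOn {
    metric_open : open U;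
    metric_smooth : forall a b, smooth_on U (fun x => g x a b);
    metric_sym : forall x, U x -> forall a b, g x a b = g x b a;
    metric_unit : forall x, U x -> g x \in unitmx
  }.

Section Metric.
Context {R : realType} {n : nat}.
Variables (U : set 'rV[R]_n) (g : 'rV[R]_n -> 'M[R]_n).
Hypothesis Hg : metric_on U g.
Let oU : open U. Proof. by case: Hg. Qed.
Let sg : forall a b, smooth_on U (fun x => g x a b). Proof. by case: Hg. Qed.
Let gsym : forall x, U x -> forall a b, g x a b = g x b a. Proof. by case: Hg. Qed.
Let gunit : forall x, U x -> g x \in unitmx. Proof. by case: Hg. Qed.
Implicit Types (x : 'rV[R]_n) (a b c d e : 'I_n).

Local Notation Gam := (@Gamma R n g).

Lemma gi_sym x : U x -> forall a b, gi g x a b = gi g x b a.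
Proof.
move=> Ux a b; have gT : (g x)^T = g x by apply/matrixP => i j; rewrite mxE gsym.
by rewrite !giE -[in LHS]gT -trmx_inv mxE.
Qed.

Lemma giK x : U x -> gi g x *m g x = 1%:M.
Proof. by move=> Ux; rewrite giE mulVmx // gunit. Qed.

Lemma smooth_gi a b : smooth_on U (fun x => gi g x a b).
Proof. by apply: smooth_ext => [x|]; [rewrite giE|apply: smooth_invmx]. Qed.
Hint Resolve smooth_gi : smoothdb.

Lemma smooth_Gamma a b c : smooth_on U (fun x => Gam x a b c).
Proof. by apply: smooth_ext => [x|]; [exact: GammaE|by smooth]. Qed.
Hint Resolve smooth_Gamma : smoothdb.

Lemma smooth_cov1 (t : 'rV[R]_n -> 'I_n -> R) a b : (forall a, smooth_on U (fun x => t x a)) ->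
  smooth_on U (fun x => cov1 g t x a b).
Proof. by move=> st; apply: smooth_ext => [x|]; [exact: cov1E|by smooth]. Qed.

Lemma smooth_cov2 (t : 'rV[R]_n -> 'I_n -> 'I_n -> R) a b c : (forall a b, smooth_on U (fun x => t x a b)) ->
  smooth_on U (fun x => cov2 g t x a b c).
Proof. by move=> st; apply: smooth_ext => [x|]; [exact: cov2E|by smooth]. Qed.

Lemma pd_gsym x a b c : U x ->
  pd a (fun z => g z b c) x = pd a (fun z => g z c b) x.
Proof. by move=> Ux; apply: (pd_eq oU) => // z /set_mem Uz; apply: gsym. Qed.

Lemma christoffel_sym x c a b : U x -> Gam x c a b = Gam x c b a.
Proof.
move=> Ux; rewrite !GammaE; congr (_ * _); apply: eq_bigr => d _.
by rewrite (pd_gsym d a b) // [pd a _ _ + _]addrC.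
Qed.

Lemma christoffel_low x a b c : U x -> \sum_d Gam x d a b * g x d c =
  2^-1 * (pd a (fun z => g z b c) x + pd b (fun z => g z a c) x
          - pd c (fun z => g z a b) x).
Proof.
move=> Ux; pose K e := 2^-1 * (pd a (fun z => g z b e) x + pd b (fun z => g z a e) x
          - pd e (fun z => g z a b) x).
rewrite -[RHS]/(K c) -[RHS](ctr_met_lC (gi_sym Ux) (giK Ux)).
rewrite -(ctr_sum_up (gi g x) K (fun d c => g x d c)).
by apply: eq_bigr => d _; rewrite GammaE sumMZ.
Qed.

Lemma metric_compat x a b c : U x -> pd a (fun z => g z b c) x =
  \sum_d Gam x d a b * g x d c + \sum_d Gam x d a c * g x b d.
Proof.
move=> Ux; under [X in _ + X]eq_bigr do rewrite gsym //.
rewrite !christoffel_low // (pd_gsym a c b) // (pd_gsym b a c) //.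
by rewrite (pd_gsym b c a) //; field.
Qed.

Lemma cov1_dcoord d : cov1 g (@dcoord R n d) = fun x b c => - Gam x d b c.
Proof.
apply/funext => x; apply/funext => b; apply/funext => c.
transitivity (0 - \sum_d0 Gam x d0 b c * (d0 == d)%:R); last by rewrite sum_deltar sub0r.
by rewrite cov1E; congr (_ - _); exact: pd_cst.
Qed.

Lemma RupE x a b c d : U x -> Rup g x a b c d =
  - pd a (fun z => Gam z d b c) x + pd b (fun z => Gam z d a c) x
  + \sum_e Gam x e a c * Gam x d b e - \sum_e Gam x e b c * Gam x d a e.
Proof.
move=> Ux; rewrite Rup_cov cov1_dcoord !cov2E !(pdN oU) //; try smooth.
have E : \sum_e Gam x e a b * - Gam x d e c = \sum_e Gam x e b a * - Gam x d e c.
  by apply: eq_bigr => e _; rewrite christoffel_sym.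
by rewrite E !sumMN; ring.
Qed.

Lemma riem_up_asym x a b c d : Rup g x a b c d = - Rup g x b a c d.
Proof. by rewrite !Rup_cov opprB. Qed.

Lemma riem_asym12 x a b c d : Rm g x a b c d = - Rm g x b a c d.
Proof.
by rewrite !RmE -sumrN; apply: eq_bigr => e _; rewrite riem_up_asym mulNr.
Qed.

Lemma riem_up_cyclic x a b c d : U x ->
  Rup g x a b c d + Rup g x b c a d + Rup g x c a b d = 0.
Proof.
move=> Ux; have E p q r : pd p (fun z => Gam z d q r) x = pd p (fun z => Gam z d r q) x.
  by apply: (pd_eq oU) => // z /set_mem Uz; apply: christoffel_sym.
have F p q r : \sum_e Gam x e p q * Gam x d r e = \sum_e Gam x e q p * Gam x d r e.
  by apply: eq_bigr => e _; rewrite christoffel_sym.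
rewrite !RupE // (E b a c) (E c b a) (E a c b) (F c a) (F b a) (F c b); ring.
Qed.

Lemma riem_cyclic x a b c d : U x ->
  Rm g x a b c d + Rm g x b c a d + Rm g x c a b d = 0.
Proof.
move=> Ux; rewrite !RmE -!big_split /= big1 // => e _.
by rewrite -!mulrDl riem_up_cyclic // mul0r.
Qed.

Lemma smooth_Rup a b c d : smooth_on U (fun x => Rup g x a b c d).
Proof.
apply: smooth_ext => [x|]; first by rewrite Rup_cov cov1_dcoord.
by apply: smoothB => //; apply: smooth_cov2; smooth.
Qed.
Hint Resolve smooth_Rup : smoothdb.

Lemma smooth_Rm a b c d : smooth_on U (fun x => Rm g x a b c d).
Proof. by apply: smooth_ext => [x|]; [exact: RmE|by smooth]. Qed.
Hint Resolve smooth_Rm : smoothdb.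

(** The curvature is read off from the coordinate covectors; this extends its defining property to
    arbitrary one-forms. The first derivatives of t cancel by symmetry of [Gam] and of second
    derivatives. *)
Lemma ricci_identity (t : 'rV[R]_n -> 'I_n -> R) x a b c : (forall a, smooth_on U (fun x => t x a)) -> U x ->
  cov2 g (cov1 g t) x a b c - cov2 g (cov1 g t) x b a c =
  \sum_d Rup g x a b c d * t x d.
Proof.
move=> st Ux.
have E p q : pd p (fun z => cov1 g t z q c) x =
    pd p (pd q (fun z => t z c)) x - (\sum_d pd p (fun z => Gam z d q c) x * t x d
    + \sum_d Gam x d q c * pd p (fun z => t z d) x).
  under eq_fun do rewrite cov1E.
  rewrite (pdB oU) //; try smooth.
  rewrite (pd_sum oU) //; last by move=> d _; smooth.
  rewrite -big_split /=; congr (_ - _); apply: eq_bigr => d _.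
  by rewrite (pdM oU) //; smooth.
rewrite !cov2E !E (pdC oU a b) //.
have F : \sum_d Gam x d a b * cov1 g t x d c = \sum_d Gam x d b a * cov1 g t x d c.
  by apply: eq_bigr => d _; rewrite christoffel_sym.
rewrite F; set T1 := pd b _ _; set T2 := \sum_d Gam x d b a * _.
have H p q : \sum_d Gam x d p c * cov1 g t x q d = \sum_d Gam x d p c * pd q (fun z => t z d) x
    - \sum_d (\sum_e Gam x e p c * Gam x d q e) * t x d.
  under eq_bigr do rewrite cov1E mulrDr mulrN.
  rewrite big_split sumrN; congr (_ - _).
  under [in RHS]eq_bigr do rewrite mulr_suml.
  rewrite exchange_big /=; apply: eq_bigr => d _; rewrite mulr_sumr; apply: eq_bigr => e _.
  by rewrite mulrA.
have K : \sum_d Rup g x a b c d * t x d =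
   - (\sum_d pd a (fun z => Gam z d b c) x * t x d) + \sum_d pd b (fun z => Gam z d a c) x * t x d
   + \sum_d (\sum_e Gam x e a c * Gam x d b e) * t x d - \sum_d (\sum_e Gam x e b c * Gam x d a e) * t x d.
  rewrite -!sumrN -!big_split /=; apply: eq_bigr => d _; rewrite RupE //; ring.
rewrite K !H; ring.
Qed.

(** On columns of covector components, the covariant derivative is the partial derivative minus this
    matrix. With this layout the curvature is the noncommutative expression [C] of
    [connection_bianchi]. *)
Definition conmx a x : 'M[R]_n := \matrix_(c, d) Gam x d a c.
Definition curvmx a b x : 'M[R]_n := \matrix_(c, d) Rup g x a b c d.

Lemma smooth_conmx a c d : smooth_on U (fun x => conmx a x c d).
Proof. by apply: smooth_ext => [x|]; [by rewrite mxE|by smooth]. Qed.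

Lemma smooth_curvmx a b c d : smooth_on U (fun x => curvmx a b x c d).
Proof. by apply: smooth_ext => [x|]; [by rewrite mxE|by smooth]. Qed.
Hint Resolve smooth_conmx smooth_curvmx : smoothdb.

Lemma dmx_metric a x : U x -> dmx a g x = conmx a x *m g x + g x *m (conmx a x)^T.
Proof.
move=> Ux; apply/matrixP => b c; rewrite dmxE metric_compat // !mxE; congr (_ + _).
  by apply: eq_bigr => d _; rewrite mxE.
by apply: eq_bigr => d _; rewrite !mxE mulrC.
Qed.

Lemma curvmxE a b x : U x -> curvmx a b x =
  - dmx a (conmx b) x + dmx b (conmx a) x + conmx a x *m conmx b x - conmx b x *m conmx a x.
Proof.
move=> Ux; apply/matrixP => c d; rewrite !(mxDE, mxNE) !dmxE mxE RupE //.
rewrite [(conmx a x *m _) _ _]mxE [(conmx b x *m _) _ _]mxE.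
have E p q : pd p (fun z => Gam z d q c) x = pd p (fun z => conmx q z c d) x.
  by congr (pd _ _ _); apply/funext => z; rewrite mxE.
by rewrite !E; congr (_ + _ - _); apply: eq_bigr => e _; rewrite !mxE.
Qed.

Lemma curvmx_low a b x c d : (curvmx a b x *m g x) c d = Rm g x a b c d.
Proof. by rewrite mxE RmE; apply: eq_bigr => e _; rewrite mxE. Qed.

(** Differentiating the compatibility formula [dmx_metric] once more and antisymmetrizing kills the
    left-hand side, as second derivatives of g commute; what is left on the right is the curvature
    acting on g. *)
Lemma curvmx_skew a b x : U x ->
  curvmx a b x *m g x + (curvmx a b x *m g x)^T = 0.
Proof.
move=> Ux; have gT : (g x)^T = g x by apply/matrixP => i j; rewrite mxE gsym.
have H p q : dmx p (dmx q g) x = dmx p (conmx q) x *m g x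
    + conmx q x *m (conmx p x *m g x + g x *m (conmx p x)^T)
    + ((conmx p x *m g x + g x *m (conmx p x)^T) *m (conmx q x)^T + g x *m (dmx p (conmx q) x)^T).
  rewrite (@dmx_eq _ _ _ U oU _ _ (fun z => conmx q z *m g z + g z *m (conmx q z)^T)) //; last first.
    by move=> z /set_mem Uz; rewrite dmx_metric.
  have sT i j : smooth_on U (fun z => (conmx q z)^T i j).
    by apply: smooth_ext => [z|]; [by rewrite mxE|by smooth].
  rewrite (dmxD oU) //; try by apply: smooth_mxM => //; smooth.
  rewrite !(dmxM oU) //; try smooth.
  by rewrite dmxT dmx_metric.
have E : dmx a (dmx b g) x - dmx b (dmx a g) x = 0 by rewrite (dmxC oU _ _ _ Ux) ?subrr.
rewrite trmx_mul gT curvmxE // -[RHS]oppr0 -[in RHS]E !H.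
have tD (A B : 'M[R]_n) : (A + B)^T = A^T + B^T by rewrite linearD.
have tN (A : 'M[R]_n) : (- A)^T = - A^T by rewrite linearN.
rewrite !(tD, tN) !trmx_mul.
rewrite !(mulmxDl, mulmxDr, mulmxN, mulNmx, mulmxA).
apply/matrixP => i j; rewrite !(mxDE, mxNE); ring.
Qed.

Lemma riem_asym34 x a b c d : U x -> Rm g x a b c d = - Rm g x a b d c.
Proof.
move=> Ux; have := congr1 (fun A : 'M[R]_n => A c d) (curvmx_skew a b Ux).
by rewrite mxDE [(_^T) c d]mxE !curvmx_low [in RHS]mxE => /eqP; rewrite addr_eq0 => /eqP.
Qed.

(** Four instances of the cyclic identity, brought to common representatives by the two
    antisymmetries, are linear equations that imply the exchange of pairs. *)
Lemma riem_pair x a b c d : U x -> Rm g x a b c d = Rm g x c d a b.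
Proof.
move=> Ux.
have C1 := riem_cyclic a b c d Ux; have C2 := riem_cyclic b c d a Ux.
have C3 := riem_cyclic c d a b Ux; have C4 := riem_cyclic d a b c Ux.
rewrite (riem_asym34 b c d a) // (riem_asym34 c d b a) // (riem_asym12 _ d b) in C2.
rewrite (riem_asym12 _ d a) (riem_asym34 a d c b) // (riem_asym12 _ a c) (riem_asym34 c a d b) // in C3.
rewrite (riem_asym12 _ d a) (riem_asym34 a b d c) // (riem_asym34 b d a c) // in C4.
move: C1 C2 C3 C4; lra.
Qed.

(** Since g is parallel, lowering the last index commutes with differentiation: the corrections for
    c and d form the covariant derivative of the curvature matrix, multiplied by g, and those for a
    and b stay explicit. *)
Lemma cov4_riemE x e a b c d : U x -> cov4 g (Rm g) x e a b c d =
  ((dmx e (curvmx a b) x - conmx e x *m curvmx a b x + curvmx a b x *m conmx e x) *m g x) c d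
  - \sum_m Gam x m e a * Rm g x m b c d - \sum_m Gam x m e b * Rm g x a m c d.
Proof.
move=> Ux.
have -> : (dmx e (curvmx a b) x - conmx e x *m curvmx a b x + curvmx a b x *m conmx e x) *m g x
   = dmx e (fun z => curvmx a b z *m g z) x - conmx e x *m (curvmx a b x *m g x)
     - (curvmx a b x *m g x) *m (conmx e x)^T.
  rewrite (dmxM oU) //; try smooth.
  rewrite dmx_metric // !(mulmxDl, mulmxDr, mulmxN, mulNmx, mulmxA).
  by apply/matrixP => i j; rewrite !(mxDE, mxNE); ring.
rewrite !(mxDE, mxNE) dmxE.
have -> : (fun z => (curvmx a b z *m g z) c d) = (fun z => Rm g z a b c d).
  by apply/funext => z; rewrite curvmx_low.
have -> : (conmx e x *m (curvmx a b x *m g x)) c d = \sum_m Gam x m e c * Rm g x a b m d.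
  by rewrite mxE; apply: eq_bigr => m _; rewrite curvmx_low mxE.
have -> : (curvmx a b x *m g x *m (conmx e x)^T) c d = \sum_m Gam x m e d * Rm g x a b c m.
  by rewrite mxE; apply: eq_bigr => m _; rewrite curvmx_low !mxE mulrC.
rewrite cov4E; ring.
Qed.

(** In the cyclic sum the corrections for the first two indices cancel, the Christoffel symbols
    being symmetric and the curvature antisymmetric; the matrix part is the algebraic identity
    [connection_bianchi]. *)
Lemma riem_bianchi x e a b c d : U x ->
  cov4 g (Rm g) x e a b c d + cov4 g (Rm g) x a b e c d + cov4 g (Rm g) x b e a c d = 0.
Proof.
move=> Ux; rewrite !cov4_riemE //.
have S p q r : \sum_m Gam x m p q * Rm g x m r c d = - \sum_m Gam x m q p * Rm g x r m c d.
  by rewrite -sumrN; apply: eq_bigr => m _; rewrite christoffel_sym // riem_asym12 mulrN.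
rewrite (S e a b) (S a b e) (S b e a).
have D p q r : dmx p (curvmx q r) x = - dmx p (dmx q (conmx r)) x + dmx p (dmx r (conmx q)) x
  + (dmx p (conmx q) x *m conmx r x + conmx q x *m dmx p (conmx r) x)
  - (dmx p (conmx r) x *m conmx q x + conmx r x *m dmx p (conmx q) x).
  rewrite (@dmx_eq _ _ _ U oU _ _ _ _ (fun z zU => curvmxE q r (set_mem zU))) //.
  have s1 i j k l : smooth_on U (fun z => dmx k (conmx l) z i j) by apply: smooth_dmx; smooth.
  have s2 i j k l : smooth_on U (fun z => (conmx k z *m conmx l z) i j) by apply: smooth_mxM; smooth.
  have sN (A : 'rV_n -> 'M[R]_n) : (forall i j, smooth_on U (fun z => A z i j)) ->
      forall i j, smooth_on U (fun z => (- A z) i j).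
    by move=> sA i j; apply: smooth_ext => [z|]; [by rewrite mxE|by smooth].
  have sD (A B : 'rV_n -> 'M[R]_n) : (forall i j, smooth_on U (fun z => A z i j)) ->
      (forall i j, smooth_on U (fun z => B z i j)) -> forall i j, smooth_on U (fun z => (A z + B z) i j).
    by move=> sA sB i j; apply: smooth_ext => [z|]; [by rewrite mxE|by smooth].
  rewrite (dmxD oU) //; [|by apply: (sD) => //; apply: (sD) => //; apply: (sN)|by apply: (sN)].
  rewrite (dmxD oU) //; [|by apply: (sD) => //; apply: (sN)].
  rewrite (dmxD oU) //; [|by apply: (sN)].
  by rewrite !(dmxN oU) // !(dmxM oU) //; smooth.
have B : (dmx e (curvmx a b) x - conmx e x *m curvmx a b x + curvmx a b x *m conmx e x) +
   (dmx a (curvmx b e) x - conmx a x *m curvmx b e x + curvmx b e x *m conmx a x) +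
   (dmx b (curvmx e a) x - conmx b x *m curvmx e a x + curvmx e a x *m conmx b x) = 0.
  rewrite !D !curvmxE //.
  exact: (@connection_bianchi _ _ _ (conmx ^~ x) (fun i j => dmx i (conmx j) x)
    (fun i j l => dmx i (dmx j (conmx l)) x) (fun i j l => dmxC oU _ _ (smooth_conmx l) Ux) e a b).
have := congr1 (fun A : 'M[R]_n => (A *m g x) c d) B.
rewrite /= mul0mx [in RHS]mxE 2!mulmxDl 2!mxDE => E; rewrite -[RHS]E; ring.
Qed.

End Metric.

#[export] Hint Resolve smooth_gi smooth_Gamma smooth_Rup smooth_Rm : smoothdb.

(** * Contracted Bianchi identities, Weyl and Cotton tensors *)

Section Contracted.
Context {R : realType} {n : nat}.
Variables (U : set 'rV[R]_n) (g : 'rV[R]_n -> 'M[R]_n).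
Hypothesis Hg : metric_on U g.
Let oU : open U. Proof. by case: Hg. Qed.
Let sg : forall a b, smooth_on U (fun x => g x a b). Proof. by case: Hg. Qed.
Let gsym : forall x, U x -> forall a b, g x a b = g x b a. Proof. by case: Hg. Qed.
Let gunit : forall x, U x -> g x \in unitmx. Proof. by case: Hg. Qed.
Hypothesis n3 : (3 <= n)%N.
Implicit Types (x : 'rV[R]_n) (a b c d e : 'I_n).

Local Notation Gam := (@Gamma R n g).
Let cmet x (Ux : U x) := ctr_met (gsym Ux) (gi_sym Hg Ux) (giK Hg Ux).

Lemma natr_dims : [/\ (n%:R : R) - 1 != 0 & (n%:R : R) - 2 != 0].
Proof.
have h1 : (n%:R : R) - 1 = (n - 1)%N%:R by rewrite natrB // (leq_trans _ n3).
have h2 : (n%:R : R) - 2 = (n - 2)%N%:R by rewrite natrB // (leq_trans _ n3).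
by rewrite h1 h2 !pnatr_eq0 !subn_eq0 -!ltnNge n3 (leq_trans _ n3).
Qed.

Lemma Rup_low x a b c d : U x -> Rup g x a b c d = \sum_e Rm g x a b c e * gi g x e d.
Proof.
move=> Ux; under eq_bigr do rewrite RmE mulr_suml.
rewrite exchange_big /= -[LHS](sum_deltar d); apply: eq_bigr => f _.
have H : g x *m gi g x = 1%:M by rewrite giE mulmxV // gunit.
have := congr1 (fun A : 'M[R]_n => A f d) H; rewrite !mxE => <-.
by rewrite mulr_sumr; apply: eq_bigr => e _; rewrite mulrA.
Qed.

Lemma Ric_tr x b c : U x -> Ric g x b c = ctr (gi g x) (fun d e => Rm g x b d c e).
Proof.
move=> Ux; rewrite RicE ctr.unlock; apply: eq_bigr => d _; rewrite Rup_low //.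
by apply: eq_bigr => e _; rewrite mulrC (gi_sym Hg Ux).
Qed.

Lemma Ric_sym x b c : U x -> Ric g x b c = Ric g x c b.
Proof.
move=> Ux; rewrite !Ric_tr // [RHS](ctr_sym _ (gi_sym Hg Ux)); apply: eq_ctr => d e.
by rewrite (riem_pair Hg).
Qed.

Lemma smooth_Ric a b : smooth_on U (fun x => Ric g x a b).
Proof. by apply: smooth_ext => [x|]; [exact: RicE|by smooth]. Qed.
Hint Resolve smooth_Ric : smoothdb.

Lemma smooth_Scal : smooth_on U (fun x => Scal g x).
Proof. by apply: smooth_ext => [x|]; [exact: ScalE|by smooth]. Qed.
Hint Resolve smooth_Scal : smoothdb.

Lemma smooth_Jsch : smooth_on U (fun x => Jsch g x).
Proof. by apply: smooth_ext => [x|]; [exact: JschE|by smooth]. Qed.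
Hint Resolve smooth_Jsch : smoothdb.

Lemma smooth_Psch a b : smooth_on U (fun x => Psch g x a b).
Proof. by apply: smooth_ext => [x|]; [exact: PschE|by smooth]. Qed.
Hint Resolve smooth_Psch : smoothdb.

Lemma smooth_Weyl a b c d : smooth_on U (fun x => Weyl g x a b c d).
Proof. by apply: smooth_ext => [x|]; [exact: WeylE|by smooth]. Qed.

Lemma smooth_Cot a b c : smooth_on U (fun x => Cot g x a b c).
Proof. by apply: smooth_ext => [x|]; [exact: CotE|by apply: smoothB => //; apply: (smooth_cov2 Hg); smooth]. Qed.

Lemma Psch_sym x b c : U x -> Psch g x b c = Psch g x c b.
Proof. by move=> Ux; rewrite !PschE Ric_sym // gsym. Qed.

Lemma pd_trace (t : 'rV[R]_n -> 'I_n -> 'I_n -> R) a x :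
  (forall b c, smooth_on U (fun x => t x b c)) -> U x ->
  pd a (fun z => ctr (gi g z) (t z)) x = ctr (gi g x) (cov2 g t x a).
Proof.
move=> st Ux; rewrite (_ : (fun z => _) = fun z => ctr (invmx (g z)) (t z)); last first.
  by apply/funext => z; rewrite giE.
rewrite (@pderiv_ctr _ _ _ U g (Gam x) t a x oU Ux gunit sg st (fun b c => metric_compat Hg a b c Ux)).
by rewrite giE; apply: eq_ctr => b c; rewrite cov2E.
Qed.

Lemma cov2_trace (t : 'rV[R]_n -> 'I_n -> 'I_n -> 'I_n -> 'I_n -> R) x a b c :
  (forall b c d e, smooth_on U (fun x => t x b c d e)) -> U x ->
  cov2 g (fun z b c => ctr (gi g z) (fun d e => t z b d c e)) x a b c =
  ctr (gi g x) (fun d e => cov4 g t x a b d c e).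
Proof.
move=> st Ux; rewrite cov2E (pd_trace a (t := fun z d e => t z b d c e)) //.
rewrite (@eq_ctr _ _ _ (fun d e => cov4 g t x a b d c e)
 (fun d e => cov2 g (fun z d e => t z b d c e) x a d e - \sum_m Gam x m a b * t x m d c e
   - \sum_m Gam x m a c * t x b d m e)); last by move=> d e; rewrite cov4E cov2E; ring.
by rewrite !ctrD !ctrN !ctr_sum; congr (_ - _ - _); apply: eq_bigr => m _; rewrite ctrZ.
Qed.

Lemma cov2_eq (t t' : 'rV[R]_n -> 'I_n -> 'I_n -> R) x a b c :
  (forall z, U z -> forall b c, t z b c = t' z b c) -> U x -> cov2 g t x a b c = cov2 g t' x a b c.
Proof.
move=> E Ux; rewrite !cov2E (pd_eq oU (h := fun z => t' z b c)) //; last first.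
  by move=> z /set_mem Uz; exact: E.
by congr (_ - _ - _); apply: eq_bigr => d _; rewrite E.
Qed.

Lemma cov2_sym (t : 'rV[R]_n -> 'I_n -> 'I_n -> R) x a b c :
  (forall z, U z -> forall b c, t z b c = t z c b) -> U x -> cov2 g t x a b c = cov2 g t x a c b.
Proof.
move=> E Ux; rewrite !cov2E (pd_eq oU (h := fun z => t z c b)) //; last first.
  by move=> z /set_mem Uz; exact: E.
rewrite addrAC; congr (_ - _ - _); apply: eq_bigr => d _; by rewrite E.
Qed.

Lemma cov4_asym12 (t : 'rV[R]_n -> 'I_n -> 'I_n -> 'I_n -> 'I_n -> R) x a b c d e :
  (forall b c d e, smooth_on U (fun x => t x b c d e)) ->
  (forall z, U z -> forall b c d e, t z b c d e = - t z c b d e) -> U x ->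
  cov4 g t x a b c d e = - cov4 g t x a c b d e.
Proof.
move=> st E Ux; rewrite !cov4E (pd_eq oU (h := fun z => - t z c b d e)) //; last first.
  by move=> z /set_mem Uz; exact: E.
rewrite (pdN oU) //.
have H (p : 'I_n -> R) q q' : (forall m, q m = - q' m) -> \sum_m p m * q m = - \sum_m p m * q' m :> R.
  by move=> qq; rewrite -sumrN; apply: eq_bigr => m _; rewrite qq mulrN.
rewrite (H (fun m => Gam x m a b) _ (fun m => t x c m d e)) //; last by move=> m; rewrite E.
rewrite (H (fun m => Gam x m a c) _ (fun m => t x m b d e)) //; last by move=> m; rewrite E.
rewrite (H (fun m => Gam x m a d) _ (fun m => t x c b m e)) //; last by move=> m; rewrite E.
rewrite (H (fun m => Gam x m a e) _ (fun m => t x c b d m)) //; last by move=> m; rewrite E.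
ring.
Qed.

Lemma cov4_pair (t : 'rV[R]_n -> 'I_n -> 'I_n -> 'I_n -> 'I_n -> R) x a b c d e :
  (forall z, U z -> forall b c d e, t z b c d e = t z d e b c) -> U x ->
  cov4 g t x a b c d e = cov4 g t x a d e b c.
Proof.
move=> E Ux; rewrite !cov4E (pd_eq oU (h := fun z => t z d e b c)) //; last first.
  by move=> z /set_mem Uz; exact: E.
have H (p : 'I_n -> R) q q' : (forall m, q m = q' m) -> \sum_m p m * q m = \sum_m p m * q' m :> R.
  by move=> qq; apply: eq_bigr => m _; rewrite qq.
rewrite (H (fun m => Gam x m a b) _ (fun m => t x d e m c)) //; last by move=> m; rewrite E.
rewrite (H (fun m => Gam x m a c) _ (fun m => t x d e b m)) //; last by move=> m; rewrite E.
rewrite (H (fun m => Gam x m a d) _ (fun m => t x m e b c)) //; last by move=> m; rewrite E.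
rewrite (H (fun m => Gam x m a e) _ (fun m => t x d m b c)) //; last by move=> m; rewrite E.
ring.
Qed.

Lemma cov4_Rm_trace x a b c : U x ->
  ctr (gi g x) (fun d e => cov4 g (Rm g) x a b d c e) = cov2 g (Ric g) x a b c.
Proof.
move=> Ux; rewrite -cov2_trace //; last by smooth.
by apply: cov2_eq => // z Uz p q; rewrite Ric_tr.
Qed.

Lemma div_Rm x a b c : U x ->
  ctr (gi g x) (fun e d => cov4 g (Rm g) x e a b c d) = cov2 g (Ric g) x b a c - cov2 g (Ric g) x a b c.
Proof.
move=> Ux; rewrite -!cov4_Rm_trace // -ctrN -ctrD; apply: eq_ctr => e d.
have := riem_bianchi Hg e a b c d Ux.
rewrite (cov4_asym12 b e a c d) // => [|? ? ? ?|z Uz ? ? ? ?]; last exact: riem_asym12.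
  by move=> B; apply/eqP; rewrite -subr_eq0 -B; apply/eqP; ring.
by smooth.
Qed.

(** The twice contracted derivative of [Rm] is evaluated in two ways: contracting b, c first gives
    minus the divergence of Ricci, while [div_Rm] gives that divergence minus the gradient of the
    scalar curvature. *)
Lemma div_Ric x a : U x ->
  ctr (gi g x) (fun b c => cov2 g (Ric g) x b a c) = 2^-1 * pd a (Scal g) x.
Proof.
move=> Ux; have S : pd a (Scal g) x = ctr (gi g x) (fun b c => cov2 g (Ric g) x a b c).
  rewrite -pd_trace //; last by smooth.
  by congr (pd _ _ _); apply/funext => z; rewrite ScalE.
have E : ctr (gi g x) (fun b c => ctr (gi g x) (fun e d => cov4 g (Rm g) x e a b c d)) =
    - ctr (gi g x) (fun e d => cov2 g (Ric g) x e a d).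
  rewrite ctr_exch -ctrN; apply: eq_ctr => e d; rewrite -cov4_Rm_trace // -ctrN.
  have st p q r s : smooth_on U (fun z => Rm g z p q r s) by smooth.
  apply: eq_ctr => b c; rewrite (cov4_pair e a b c d) //; last by move=> *; apply: (riem_pair Hg).
  rewrite (cov4_asym12 e c d) //; last by move=> *; apply: riem_asym12.
  by rewrite (cov4_pair e d c a b) //; move=> *; apply: (riem_pair Hg).
rewrite S.
have : ctr (gi g x) (fun b c => ctr (gi g x) (fun e d => cov4 g (Rm g) x e a b c d)) =
   ctr (gi g x) (fun b c => cov2 g (Ric g) x b a c) - ctr (gi g x) (fun b c => cov2 g (Ric g) x a b c).
  by rewrite -ctrN -ctrD; apply: eq_ctr => b c; rewrite div_Rm.
rewrite E; lra.
Qed.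

Lemma tr_Psch x : U x -> ctr (gi g x) (Psch g x) = Jsch g x.
Proof.
move=> Ux; have [h1 h2] := natr_dims.
rewrite (eq_ctr _ (PschE g x)) ctrZ ctrD ctrN ctrZ -ScalE.
rewrite (ctr_dim (gsym Ux) (giK Hg Ux)) JschE; field.
by rewrite h1.
Qed.

Lemma Ric_Psch x b c : Ric g x b c = (n%:R - 2) * Psch g x b c + Jsch g x * g x b c.
Proof. by have [h1 h2] := natr_dims; rewrite PschE mulrA divff // mul1r subrK. Qed.

Lemma cov2_Psch x a b c : U x -> cov2 g (Ric g) x a b c =
  (n%:R - 2) * cov2 g (Psch g) x a b c + pd a (Jsch g) x * g x b c.
Proof.
move=> Ux; rewrite (cov2_eq (t' := fun z b c => (n%:R - 2) * Psch g z b c + Jsch g z * g z b c)) //; last first.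
  by move=> z Uz p q; rewrite Ric_Psch.
rewrite !cov2E (pdD oU) //; try smooth.
rewrite (pdM oU) //; try smooth.
rewrite (pdM oU) //; try smooth.
rewrite !sumlin pd_cst (metric_compat Hg) //; ring.
Qed.

Lemma pd_Jsch x a : U x -> ctr (gi g x) (cov2 g (Psch g) x a) = pd a (Jsch g) x.
Proof.
move=> Ux; rewrite -pd_trace //; last by smooth.
by apply: (pd_eq oU) => // z /set_mem Uz; rewrite tr_Psch.
Qed.

Lemma div_Psch x a : U x ->
  ctr (gi g x) (fun b c => cov2 g (Psch g) x b a c) = pd a (Jsch g) x.
Proof.
move=> Ux; have [h1 h2] := natr_dims; have := div_Ric a Ux.
rewrite (eq_ctr _ (fun b c => cov2_Psch b a c Ux)) ctrD ctrZ.
rewrite (cmet Ux).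
have -> : pd a (Scal g) x = (2 * (n%:R - 1)) * pd a (Jsch g) x.
  rewrite -(pdZ oU) //; try smooth.
  by congr (pd _ _ _); apply/funext => z; rewrite JschE mulrC divfK // mulf_neq0.
move=> E; apply: (mulfI h2); apply: (addIr (pd a (Jsch g) x)); rewrite E; by field.
Qed.

Lemma Cot_asym x a b c : Cot g x a b c = - Cot g x b a c.
Proof. by rewrite !CotE opprB. Qed.

Lemma cov2_Psch_sym x a b c : U x -> cov2 g (Psch g) x a b c = cov2 g (Psch g) x a c b.
Proof. by move=> Ux; apply: cov2_sym => // z Uz p q; rewrite Psch_sym. Qed.

Lemma Cot_cyclic x a b c : U x -> Cot g x a b c + Cot g x b c a + Cot g x c a b = 0.
Proof.
move=> Ux; rewrite !CotE (cov2_Psch_sym a b c) // (cov2_Psch_sym b c a) // (cov2_Psch_sym c a b) //.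
ring.
Qed.

Lemma Cot_tr13 x b : U x -> ctr (gi g x) (fun a c => Cot g x a b c) = 0.
Proof.
move=> Ux; rewrite (eq_ctr _ (fun a c => CotE g x a b c)) ctrD ctrN div_Psch //.
by rewrite pd_Jsch // subrr.
Qed.

Lemma Weyl_asym12 x a b c d : U x -> Weyl g x a b c d = - Weyl g x b a c d.
Proof. by move=> Ux; rewrite !WeylE (riem_asym12 g x a b); ring. Qed.

Lemma Weyl_asym34 x a b c d : U x -> Weyl g x a b c d = - Weyl g x a b d c.
Proof. by move=> Ux; rewrite !WeylE (riem_asym34 Hg a b c d Ux); ring. Qed.

Lemma Weyl_pair x a b c d : U x -> Weyl g x a b c d = Weyl g x c d a b.
Proof.
move=> Ux; rewrite !WeylE (riem_pair Hg a b c d Ux) (gsym Ux d b) (gsym Ux c a).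
rewrite (gsym Ux c b) (gsym Ux d a) (Psch_sym c a Ux) (Psch_sym d b Ux).
by rewrite (Psch_sym c b Ux) (Psch_sym d a Ux); ring.
Qed.

Lemma Weyl_tr24 x a c : U x -> ctr (gi g x) (fun b d => Weyl g x a b c d) = 0.
Proof.
move=> Ux; rewrite (eq_ctr _ (fun b d => WeylE g x a b c d)) !ctrD !ctrN !ctrZ ctrZr.
rewrite !(cmet Ux) (ctr_dim (gsym Ux) (giK Hg Ux)).
by rewrite -Ric_tr // tr_Psch // Ric_Psch; ring.
Qed.

(** Covariant derivative of the Kulkarni-Nomizu product of the Schouten tensor with g, the part of
    [Rm] that is removed in [Weyl]. *)
Definition covK x e a b c d : R :=
  cov2 g (Psch g) x e a c * g x b d + cov2 g (Psch g) x e b d * g x a c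
  - cov2 g (Psch g) x e a d * g x b c - cov2 g (Psch g) x e b c * g x a d.

Lemma cov4_Weyl x e a b c d : U x ->
  cov4 g (Weyl g) x e a b c d = cov4 g (Rm g) x e a b c d - covK x e a b c d.
Proof.
move=> Ux; rewrite /covK !cov4E !cov2E.
have -> : pd e (fun z => Weyl g z a b c d) x = pd e (fun z => Rm g z a b c d) x
  - (pd e (fun z => Psch g z a c) x * g x b d + Psch g x a c * pd e (fun z => g z b d) x)
  - (pd e (fun z => Psch g z b d) x * g x a c + Psch g x b d * pd e (fun z => g z a c) x)
  + (pd e (fun z => Psch g z a d) x * g x b c + Psch g x a d * pd e (fun z => g z b c) x)
  + (pd e (fun z => Psch g z b c) x * g x a d + Psch g x b c * pd e (fun z => g z a d) x).
  rewrite (_ : (fun z => Weyl g z a b c d) = fun z => Rm g z a b c d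
    - Psch g z a c * g z b d - Psch g z b d * g z a c
    + Psch g z a d * g z b c + Psch g z b c * g z a d); last by apply/funext => z; rewrite WeylE.
  rewrite (pdD oU) //; try smooth.
  rewrite (pdD oU) //; try smooth.
  rewrite (pdB oU) //; try smooth.
  rewrite (pdB oU) //; try smooth.
  by rewrite !(pdM oU) //; smooth.
have -> : Weyl g x = fun a b c d => Rm g x a b c d
    - Psch g x a c * g x b d - Psch g x b d * g x a c
    + Psch g x a d * g x b c + Psch g x b c * g x a d.
  by do 4!apply/funext=> ?; rewrite WeylE.
rewrite !sumlin !(metric_compat Hg) //; ring.
Qed.

(** Only the derivatives of the removed part spoil the Bianchi identity. In the cyclic sum they
    combine in antisymmetric pairs, that is, to Cotton tensors, which is how [covWF_bianchi] reads
    the right-hand side. *)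
Lemma Weyl_bianchi x e a b c d : U x ->
  cov4 g (Weyl g) x e a b c d + cov4 g (Weyl g) x a b e c d + cov4 g (Weyl g) x b e a c d =
  - (covK x e a b c d + covK x a b e c d + covK x b e a c d).
Proof.
move=> Ux; rewrite !cov4_Weyl //; have := riem_bianchi Hg e a b c d Ux => E.
by apply/eqP; rewrite -subr_eq0 -E; apply/eqP; ring.
Qed.

(** Of the factor n-3, the share n-2 comes from expressing Ricci through Schouten and -1 from the
    trace of [covK]; the gradients of J cancel. *)
Lemma div_Weyl x a b c : U x ->
  ctr (gi g x) (fun e d => cov4 g (Weyl g) x e a b c d) = - (n%:R - 3) * Cot g x a b c.
Proof.
move=> Ux; rewrite (eq_ctr _ (fun e d => cov4_Weyl e a b c d Ux)) ctrD ctrN div_Rm //.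
rewrite /covK !ctrD !ctrN !ctrZr !(cmet Ux) !cov2_Psch //.
have -> : ctr (gi g x) (fun i j => cov2 g (Psch g) x i b j) = pd b (Jsch g) x.
  by rewrite -div_Psch //; apply: eq_ctr => i j; rewrite cov2_Psch_sym.
have -> : ctr (gi g x) (fun i j => cov2 g (Psch g) x i a j) = pd a (Jsch g) x.
  by rewrite -div_Psch //; apply: eq_ctr => i j; rewrite cov2_Psch_sym.
rewrite CotE (cov2_Psch_sym b a c) // ?(cov2_Psch_sym a b c) //; ring.
Qed.

End Contracted.

HB.lock Definition Bach (R : realType) n (g : 'rV[R]_n -> 'M[R]_n) x a b := bach g x a b.

#[export] Hint Resolve smooth_Ric smooth_Scal smooth_Jsch smooth_Psch smooth_Weyl smooth_Cot
  smooth_cov1 : smoothdb.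

(** It serves with the inverse metric on covectors and with the metric itself on ambient vectors
    along the submanifold. *)
HB.lock Definition inn (R : comPzRingType) (m : nat) (M : 'M[R]_m) (v w : 'I_m -> R) : R :=
  ctr M (fun i j => v i * w j).

Section Inner.
Context {R : comPzRingType} {m : nat}.
Variables (G M : 'M[R]_m).
Implicit Types (v w p q : 'I_m -> R).

Lemma innE v w : inn M v w = ctr M (fun i j => v i * w j).
Proof. by rewrite inn.unlock. Qed.

Lemma innDl p q w : inn M (fun i => p i + q i) w = inn M p w + inn M q w.
Proof. by rewrite !innE -ctrD; apply: eq_ctr => i j; rewrite mulrDl. Qed.

Lemma innZl c p w : inn M (fun i => c * p i) w = c * inn M p w.
Proof. by rewrite !innE -ctrZ; apply: eq_ctr => i j; rewrite mulrA. Qed.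

Lemma innZlr c p w : inn M (fun i => p i * c) w = c * inn M p w.
Proof. by rewrite -innZl; congr inn; apply/funext => i; rewrite mulrC. Qed.

Lemma innNl p w : inn M (fun i => - p i) w = - inn M p w.
Proof. by rewrite !innE -ctrN; apply: eq_ctr => i j; rewrite mulNr. Qed.

Lemma innDr p q w : inn M w (fun i => p i + q i) = inn M w p + inn M w q.
Proof. by rewrite !innE -ctrD; apply: eq_ctr => i j; rewrite mulrDr. Qed.

Lemma innZr c p w : inn M w (fun i => c * p i) = c * inn M w p.
Proof. by rewrite !innE -ctrZ; apply: eq_ctr => i j; rewrite mulrCA. Qed.

Lemma innZrr c p w : inn M w (fun i => p i * c) = c * inn M w p.
Proof. by rewrite -innZr; congr inn; apply/funext => i; rewrite mulrC. Qed.

Lemma innNr p w : inn M w (fun i => - p i) = - inn M w p.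
Proof. by rewrite !innE -ctrN; apply: eq_ctr => i j; rewrite mulrN. Qed.

Definition inn_lin := (innDl, innNl, innZl, innZlr, innDr, innNr, innZr, innZrr).

Hypotheses (sG : forall i j, G i j = G j i) (sM : forall i j, M i j = M j i).
Hypothesis MG : M *m G = 1%:M.

Lemma inn_sym v w : inn M v w = inn M w v.
Proof. by rewrite !innE ctr_sym //; apply: eq_ctr => i j; rewrite mulrC. Qed.

Lemma inn_metl c w : inn M (G c) w = w c.
Proof. by rewrite innE (ctr_met_lsC sG sM MG). Qed.

Lemma inn_metr c w : inn M w (G c) = w c.
Proof. by rewrite inn_sym inn_metl. Qed.

Lemma inn_metls c w : inn M (G^~ c) w = w c.
Proof. by rewrite innE (ctr_met_lC sM MG). Qed.

Lemma inn_metrs c w : inn M w (G^~ c) = w c.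
Proof. by rewrite inn_sym inn_metls. Qed.

Definition inn_met := (inn_metl, inn_metr, inn_metls, inn_metrs).

End Inner.

(** * Leibniz rules for the covariant derivative *)

Section Leibniz.
Context {R : realType} {n : nat}.
Variables (U : set 'rV[R]_n) (g : 'rV[R]_n -> 'M[R]_n).
Hypothesis Hg : metric_on U g.
Let oU : open U. Proof. by case: Hg. Qed.
Let sg : forall a b, smooth_on U (fun x => g x a b). Proof. by case: Hg. Qed.
Implicit Types (x : 'rV[R]_n) (a b c d e : 'I_n) (s t : 'rV[R]_n -> 'I_n -> R).
Implicit Types (p q : 'rV[R]_n -> 'I_n -> 'I_n -> R).

Lemma cov2_prod s t x a b c : (forall a, smooth_on U (fun x => s x a)) ->
  (forall a, smooth_on U (fun x => t x a)) -> U x ->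
  cov2 g (fun z b c => s z b * t z c) x a b c = cov1 g s x a b * t x c + s x b * cov1 g t x a c.
Proof. by move=> ss st Ux; rewrite cov2E !cov1E (pdM oU) // !sumlin; ring. Qed.

Lemma cov2_metric (f : 'rV[R]_n -> R) x a b c : smooth_on U f -> U x ->
  cov2 g (fun z b c => f z * g z b c) x a b c = pd a f x * g x b c.
Proof. by move=> sf Ux; rewrite cov2E (pdM oU) // !sumlin (metric_compat Hg) //; ring. Qed.

Lemma cov2D p q x a b c : (forall a b, smooth_on U (fun x => p x a b)) ->
  (forall a b, smooth_on U (fun x => q x a b)) -> U x ->
  cov2 g (fun z b c => p z b c + q z b c) x a b c = cov2 g p x a b c + cov2 g q x a b c.
Proof. by move=> sp sq Ux; rewrite !cov2E (pdD oU) // !sumlin; ring. Qed.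

Lemma cov2N p x a b c : (forall a b, smooth_on U (fun x => p x a b)) -> U x ->
  cov2 g (fun z b c => - p z b c) x a b c = - cov2 g p x a b c.
Proof. by move=> sp Ux; rewrite !cov2E (pdN oU) // !sumlin; ring. Qed.

Lemma pd_inn s t x a : (forall a, smooth_on U (fun x => s x a)) ->
  (forall a, smooth_on U (fun x => t x a)) -> U x ->
  pd a (fun z => inn (gi g z) (s z) (t z)) x =
  inn (gi g x) (cov1 g s x a) (t x) + inn (gi g x) (s x) (cov1 g t x a).
Proof.
move=> ss st Ux.
rewrite (_ : (fun z => _) = fun z => ctr (gi g z) (fun b c => s z b * t z c)); last first.
  by apply/funext => z; rewrite innE.
rewrite (pd_trace Hg) //; last by smooth.
by rewrite !innE -ctrD; apply: eq_ctr => b c; rewrite cov2_prod.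
Qed.

Lemma smooth_inn s t : (forall a, smooth_on U (fun x => s x a)) ->
  (forall a, smooth_on U (fun x => t x a)) -> smooth_on U (fun z => inn (gi g z) (s z) (t z)).
Proof.
move=> ss st; apply: smooth_ext => [x|]; first by rewrite innE.
have si := smooth_gi Hg.
by smooth.
Qed.

Lemma cov1_pd_sym (f : 'rV[R]_n -> R) x a b : smooth_on U f -> U x ->
  cov1 g (fun z c => pd c f z) x a b = cov1 g (fun z c => pd c f z) x b a.
Proof.
move=> sf Ux; rewrite !cov1E (pdC oU a b) //; congr (_ - _); apply: eq_bigr => d _.
by rewrite (christoffel_sym Hg).
Qed.

Lemma cov3_eq (t t' : 'rV[R]_n -> 'I_n -> 'I_n -> 'I_n -> R) x a b c d :
  (forall z, U z -> forall b c d, t z b c d = t' z b c d) -> U x ->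
  cov3 g t x a b c d = cov3 g t' x a b c d.
Proof.
move=> E Ux; rewrite !cov3E (pd_eq oU (h := fun z => t' z b c d)) //; last first.
  by move=> z /set_mem Uz; exact: E.
by congr (_ - _ - _ - _); apply: eq_bigr => e _; rewrite E.
Qed.

Lemma cov3B (t t' : 'rV[R]_n -> 'I_n -> 'I_n -> 'I_n -> R) x a b c d :
  (forall b c d, smooth_on U (fun z => t z b c d)) ->
  (forall b c d, smooth_on U (fun z => t' z b c d)) -> U x ->
  cov3 g (fun z b c d => t z b c d - t' z b c d) x a b c d =
  cov3 g t x a b c d - cov3 g t' x a b c d.
Proof. by move=> st st' Ux; rewrite !cov3E (pdB oU) // !sumlin; ring. Qed.

Lemma cov3_inn (t : 'rV[R]_n -> 'I_n -> 'I_n -> 'I_n -> 'I_n -> R) s x a b c d :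
  (forall b c d e, smooth_on U (fun z => t z b c d e)) ->
  (forall a, smooth_on U (fun z => s z a)) -> U x ->
  cov3 g (fun z b c d => inn (gi g z) (t z b c d) (s z)) x a b c d =
  inn (gi g x) (cov4 g t x a b c d) (s x) + inn (gi g x) (t x b c d) (cov1 g s x a).
Proof.
move=> st ss Ux; rewrite cov3E (pd_inn (s := fun z => t z b c d)) //.
have S (p : 'I_n -> 'I_n -> R) (q : 'I_n -> R) : \sum_m q m * inn (gi g x) (p m) (s x) =
    inn (gi g x) (fun e => \sum_m q m * p m e) (s x).
  rewrite innE (@eq_ctr _ _ _ _ (fun i j => \sum_m (q m * p m i * s x j))); last first.
    by move=> i j; rewrite mulr_suml.
  rewrite ctr_sum; apply: eq_bigr => m _; rewrite innE -ctrZ.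
  by apply: eq_ctr => i j; rewrite mulrA.
rewrite !S (_ : cov4 g t x a b c d = fun e => cov1 g (fun z => t z b c d) x a e
   + - (\sum_m Gamma g x m a b * t x m c d e) + - (\sum_m Gamma g x m a c * t x b m d e)
   + - (\sum_m Gamma g x m a d * t x b c m e)); last first.
  by apply/funext => e; rewrite cov4E cov1E; ring.
by rewrite !inn_lin; ring.
Qed.

Lemma BachE x a b : Bach g x a b = ctr (gi g x) (fun c d => cov3 g (Cot g) x d c a b)
  + ctr (gi g x) (fun c e => ctr (gi g x) (fun d m => Weyl g x a c b d * Psch g x e m)).
Proof.
transitivity (\sum_c \sum_d gi g x c d * cov3 g (Cot g) x d c a b
  + \sum_c \sum_d Weyl g x a c b d *
      \sum_e \sum_m gi g x c e * gi g x d m * Psch g x e m).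
  by rewrite Bach.unlock; expose.
rewrite ctrE; congr (_ + _); rewrite ctrE; apply: eq_bigr => c _.
under eq_bigr do rewrite mulr_sumr.
rewrite exchange_big; apply: eq_bigr => e _; rewrite ctrE mulr_sumr; apply: eq_bigr => d _.
rewrite !mulr_sumr; apply: eq_bigr => m _; ring.
Qed.

End Leibniz.

(** * Conformal change of the ambient curvature *)

Section Conformal.
Context {R : realType} {n : nat}.
Variables (U : set 'rV[R]_n) (g : 'rV[R]_n -> 'M[R]_n) (u : 'rV[R]_n -> R).
Hypotheses (Hg : metric_on U g) (su : smooth_on U u) (n3 : (3 <= n)%N).
Let oU : open U. Proof. by case: Hg. Qed.
Let sg : forall a b, smooth_on U (fun x => g x a b). Proof. by case: Hg. Qed.
Let gsym : forall x, U x -> forall a b, g x a b = g x b a. Proof. by case: Hg. Qed.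
Let gunit : forall x, U x -> g x \in unitmx. Proof. by case: Hg. Qed.
Implicit Types (x : 'rV[R]_n) (a b c d e : 'I_n).

Definition rescale x : 'M[R]_n := expR (2 * u x) *: g x.
Local Notation gh := rescale.
Local Notation E x := (expR (2 * u x)).
Local Notation Ups := (fun x a => pd a u x).
Local Notation "<< v , w >>_ x" := (inn (gi g x) v w) (at level 10, x at level 8).

Lemma E_neq0 x : E x != 0.
Proof. by rewrite gt_eqF // expR_gt0. Qed.

Lemma smooth_E : smooth_on U (fun x => E x).
Proof. by apply: smooth_expR => //; smooth. Qed.
Hint Resolve smooth_E : smoothdb.

Lemma pd_E a x : U x -> pd a (fun z => E z) x = 2 * pd a u x * E x.
Proof.
move=> Ux; rewrite (pd_expR _ _ Ux) //; last by smooth.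
by rewrite (pdZ oU) // mulrC.
Qed.

Lemma rescale_metric : metric_on U gh.
Proof.
split=> // [a b|x Ux a b|x Ux].
- by apply: smooth_ext => [x|]; [by rewrite mxE|by smooth].
- by rewrite !mxE gsym.
- by rewrite /gh unitmxZ ?gunit // unitfE E_neq0.
Qed.

Lemma gi_rescale x : U x -> gi gh x = (E x)^-1 *: gi g x.
Proof.
by move=> Ux; rewrite !giE invmxZ //; have := metric_unit rescale_metric Ux.
Qed.

Lemma ctr_rescale x t : U x -> ctr (gi gh x) t = (E x)^-1 * ctr (gi g x) t.
Proof. by move=> Ux; rewrite gi_rescale // ctr_scale. Qed.

Lemma Gamma_rescale x c a b : U x -> Gamma gh x c a b = Gamma g x c a b
  + (c == a)%:R * pd b u x + (c == b)%:R * pd a u x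
  - g x a b * \sum_d gi g x c d * pd d u x.
Proof.
move=> Ux; rewrite !GammaE gi_rescale //.
have P p q r : pd p (fun z => gh z q r) x = E x * (2 * pd p u x * g x q r + pd p (fun z => g z q r) x).
  rewrite (_ : (fun z => gh z q r) = fun z => E z * g z q r); last by apply/funext => z; rewrite mxE.
  by rewrite (pdM oU) ?pd_E //; [ring|smooth].
have -> : \sum_d ((E x)^-1 *: gi g x) c d *
   (pd a (fun z => gh z b d) x + pd b (fun z => gh z a d) x - pd d (fun z => gh z a b) x) =
  \sum_d gi g x c d * ((pd a (fun z => g z b d) x + pd b (fun z => g z a d) x - pd d (fun z => g z a b) x)
    + ((2 * pd a u x) * g x d b + (2 * pd b u x) * g x d a + (- (2 * g x a b)) * pd d u x)).
  apply: eq_bigr => d _; rewrite !P mxE (gsym Ux d b) (gsym Ux d a).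
  by field; exact: E_neq0.
rewrite sumMD mulrDr -!addrA; congr (_ + _).
rewrite !sumMD !sumMZ !(sum_inv (giK Hg Ux)); by field.
Qed.

Lemma sum_Gamma_rescale x a b (v : 'I_n -> R) : U x ->
  \sum_c Gamma gh x c a b * v c = \sum_c Gamma g x c a b * v c
  + v a * pd b u x + v b * pd a u x - g x a b * << v, Ups x >>_x.
Proof.
move=> Ux; transitivity (\sum_c (Gamma g x c a b * v c + (c == a)%:R * (v c * pd b u x)
   + (c == b)%:R * (v c * pd a u x) + (- g x a b) * ((\sum_d gi g x c d * pd d u x) * v c))).
  by apply: eq_bigr => c _; rewrite Gamma_rescale //; ring.
rewrite !big_split /= !sum_delta -mulr_sumr.
rewrite (ctr_sum_up (gi g x) (Ups x) (fun d _ => v d) a) -innE.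
by ring.
Qed.

Lemma cov1_rescale t x a b : U x -> cov1 gh t x a b =
  cov1 g t x a b - t x a * pd b u x - t x b * pd a u x + g x a b * << t x, Ups x >>_x.
Proof. by move=> Ux; rewrite !cov1E sum_Gamma_rescale //; ring. Qed.

Lemma cov2_rescale t x a b c : U x -> cov2 gh t x a b c =
  cov2 g t x a b c - t x a c * pd b u x - t x b c * pd a u x + g x a b * << t x ^~ c, Ups x >>_x
   - t x b a * pd c u x - t x b c * pd a u x + g x a c * << t x b, Ups x >>_x.
Proof.
by move=> Ux; rewrite !cov2E !sum_Gamma_rescale //; ring.
Qed.

Lemma cov3_rescale t x a b c d : U x -> cov3 gh t x a b c d =
  cov3 g t x a b c d
   - t x a c d * pd b u x - t x b c d * pd a u x + g x a b * << fun e => t x e c d, Ups x >>_x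
   - t x b a d * pd c u x - t x b c d * pd a u x + g x a c * << fun e => t x b e d, Ups x >>_x
   - t x b c a * pd d u x - t x b c d * pd a u x + g x a d * << fun e => t x b c e, Ups x >>_x.
Proof.
by move=> Ux; rewrite !cov3E !sum_Gamma_rescale //; ring.
Qed.

Definition Hess := cov1 g Ups.

(* The change of the Schouten tensor. *)
Definition dP x a b : R :=
  - Hess x a b + pd a u x * pd b u x - 2^-1 * << Ups x, Ups x >>_x * g x a b.

Let sU a : smooth_on U (fun x => pd a u x). Proof. by smooth. Qed.

Lemma Hess_sym x a b : U x -> Hess x a b = Hess x b a.
Proof. by move=> Ux; apply: (cov1_pd_sym Hg). Qed.

(** Stated for an arbitrary one-form so that [Rm_rescale] can substitute a column of g for it. The
    extra first derivatives of t cancel in the commutator, and the terms in u assemble into [dP]. *)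
Lemma commutator_rescale t x a b c : (forall a, smooth_on U (fun x => t x a)) -> U x ->
  cov2 gh (cov1 gh t) x a b c - cov2 gh (cov1 gh t) x b a c =
  \sum_d Rup g x a b c d * t x d
  + dP x a c * t x b - dP x b c * t x a
  + g x a c * << dP x b, t x >>_x - g x b c * << dP x a, t x >>_x.
Proof.
move=> st Ux; rewrite -(ricci_identity Hg) //.
have iS v w : << v, w >>_x = << w, v >>_x by apply: inn_sym; exact: gi_sym Hg _ Ux.
have iM := inn_met (gsym Ux) (gi_sym Hg Ux) (giK Hg Ux).
have sI : smooth_on U (fun z => << t z, Ups z >>_z) by apply: (smooth_inn Hg).
have st1 p q : smooth_on U (fun z => cov1 g t z p q) by apply: (smooth_cov1 Hg).
have D p q r : cov2 g (cov1 gh t) x p q r = cov2 g (cov1 g t) x p q r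
   - (cov1 g t x p q * pd r u x + t x q * Hess x p r)
   - (cov1 g t x p r * pd q u x + t x r * Hess x p q)
   + (<< cov1 g t x p, Ups x >>_x + << t x, Hess x p >>_x) * g x q r.
  rewrite (cov2_eq Hg (t' := fun z q r => cov1 g t z q r + - (t z q * pd r u z) + - (pd q u z * t z r)
     + << t z, Ups z >>_z * g z q r)) //; last first.
    by move=> z Uz b0 c0; rewrite cov1_rescale //; ring.
  rewrite (cov2D Hg) //; try smooth.
  rewrite (cov2D Hg) //; try smooth.
  rewrite (cov2D Hg) //; try smooth.
  rewrite !(cov2N Hg) //; try smooth.
  rewrite (cov2_metric Hg) // !(cov2_prod Hg) //.
  by rewrite (pd_inn Hg) // /Hess; ring.
rewrite !cov2_rescale // !D.
have F p q : cov1 gh t x p q = cov1 g t x p q + (- (t x p)) * pd q u x + - (t x q * pd p u x)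
   + << t x, Ups x >>_x * g x p q by rewrite cov1_rescale //; ring.
have F1 p : << cov1 gh t x p, Ups x >>_x = << cov1 g t x p, Ups x >>_x
    - t x p * << Ups x, Ups x >>_x - pd p u x * << t x, Ups x >>_x + << t x, Ups x >>_x * pd p u x.
  rewrite (_ : cov1 gh t x p = fun q => cov1 g t x p q + (- (t x p)) * pd q u x + - (t x q * pd p u x)
   + << t x, Ups x >>_x * g x p q); last by apply/funext => q; rewrite F.
  by rewrite !inn_lin !iM; ring.
have G p : << dP x p, t x >>_x = - << t x, Hess x p >>_x + pd p u x * << t x, Ups x >>_x
   - 2^-1 * << Ups x, Ups x >>_x * t x p.
  rewrite /dP !inn_lin !iM [<< Hess x p, _ >>_x]iS [<< Ups x, t x >>_x]iS; ring.
rewrite !F1 !G /dP !F (Hess_sym b a) // (gsym Ux b a).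
rewrite (gsym Ux a b); by field.
Qed.

Lemma Rm_rescale x a b c d : U x -> Rm gh x a b c d = E x * (Rm g x a b c d
  + dP x a c * g x b d + dP x b d * g x a c - dP x a d * g x b c - dP x b c * g x a d).
Proof.
move=> Ux; rewrite RmE.
have -> : \sum_e Rup gh x a b c e * gh x e d = E x * \sum_e Rup gh x a b c e * g x e d.
  by rewrite mulr_sumr; apply: eq_bigr => e _; rewrite mxE mulrCA.
(* The d-th column of g is a one-form in e: the sum that lowers the index is its commutator for
   [gh], to which [commutator_rescale] applies. *)
rewrite -(ricci_identity rescale_metric (t := fun z e => g z e d)) // commutator_rescale //.
by rewrite -RmE !(inn_met (gsym Ux) (gi_sym Hg Ux) (giK Hg Ux)); ring.
Qed.

Definition trdP x := ctr (gi g x) (dP x).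

Let cmet x (Ux : U x) := ctr_met (gsym Ux) (gi_sym Hg Ux) (giK Hg Ux).

Lemma Ric_rescale x b c : U x -> Ric gh x b c = Ric g x b c + (n%:R - 2) * dP x b c + trdP x * g x b c.
Proof.
move=> Ux; rewrite (Ric_tr rescale_metric) // ctr_rescale //.
rewrite (eq_ctr _ (fun d e => Rm_rescale b d c e Ux)) ctrZ mulKf ?E_neq0 //.
rewrite !ctrD !ctrN !ctrZ !ctrZr !(cmet Ux) (ctr_dim (gsym Ux) (giK Hg Ux)) -(Ric_tr Hg) // /trdP.
by ring.
Qed.

Lemma Scal_rescale x : U x -> Scal gh x = (E x)^-1 * (Scal g x + 2 * (n%:R - 1) * trdP x).
Proof.
move=> Ux; rewrite ScalE ctr_rescale // (eq_ctr _ (fun d e => Ric_rescale d e Ux)).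
rewrite !ctrD !ctrZ (ctr_dim (gsym Ux) (giK Hg Ux)) -ScalE -/(trdP x); ring.
Qed.

Lemma Psch_rescale x b c : U x -> Psch gh x b c = Psch g x b c + dP x b c.
Proof.
move=> Ux; have [h1 h2] := natr_dims (R := R) n3.
rewrite !PschE !JschE Ric_rescale // Scal_rescale // mxE; field.
by rewrite h1 h2 E_neq0.
Qed.

Lemma Weyl_rescale x a b c d : U x -> Weyl gh x a b c d = E x * Weyl g x a b c d.
Proof. by move=> Ux; rewrite !WeylE !Psch_rescale // Rm_rescale // !mxE; ring. Qed.

Lemma Rm_inn x a b c (v : 'I_n -> R) : U x -> << Rm g x a b c, v >>_x = << Weyl g x a b c, v >>_x
  + Psch g x a c * v b + g x a c * << Psch g x b, v >>_x
  - g x b c * << Psch g x a, v >>_x - Psch g x b c * v a.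
Proof.
move=> Ux; have iM := inn_met (gsym Ux) (gi_sym Hg Ux) (giK Hg Ux).
rewrite (_ : Rm g x a b c = fun d => Weyl g x a b c d + Psch g x a c * g x b d
    + Psch g x b d * g x a c + - (Psch g x a d * g x b c) + - (Psch g x b c * g x a d)).
  by rewrite !inn_lin !iM; ring.
by apply/funext => d; rewrite WeylE; ring.
Qed.

(** The third derivatives of u occur antisymmetrized and turn into curvature by the Ricci identity
    ([C]). Splitting [Rm] into Weyl and Schouten parts, the latter cancel against the terms caused
    by the new connection acting on the Schouten tensor. *)
Lemma Cot_rescale x a b c : U x -> Cot gh x a b c = Cot g x a b c - << Weyl g x a b c, Ups x >>_x.
Proof.
move=> Ux; have iM := inn_met (gsym Ux) (gi_sym Hg Ux) (giK Hg Ux).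
have iS v w : << v, w >>_x = << w, v >>_x by apply: inn_sym; exact: gi_sym Hg _ Ux.
have sI : smooth_on U (fun z => << Ups z, Ups z >>_z) by apply: (smooth_inn Hg).
have sH p q : smooth_on U (fun z => Hess z p q) by apply: (smooth_cov1 Hg).
have sP p q : smooth_on U (fun z => Psch g z p q) by apply: (smooth_Psch Hg).
have sdP p q : smooth_on U (fun z => dP z p q) by rewrite /dP; smooth.
have D p q r : cov2 g (Psch gh) x p q r = cov2 g (Psch g) x p q r
   - cov2 g (cov1 g Ups) x p q r + (Hess x p q * pd r u x + pd q u x * Hess x p r)
   - << Ups x, Hess x p >>_x * g x q r.
  rewrite (cov2_eq Hg (t' := fun z q r => Psch g z q r + (- Hess z q r + (pd q u z * pd r u z)
     + (- 2^-1 * << Ups z, Ups z >>_z) * g z q r))) //; last first.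
    by move=> z Uz b0 c0; rewrite Psch_rescale // /dP; ring.
  rewrite (cov2D Hg) //; try smooth.
  rewrite (cov2D Hg) //; try smooth.
  rewrite (cov2D Hg) //; try smooth.
  rewrite !(cov2N Hg) //; try smooth.
  rewrite (cov2_metric Hg) //; try smooth.
  rewrite !(cov2_prod Hg) // (pdZ oU) //.
  by rewrite (pd_inn Hg) // (iS (cov1 _ _ _ _)) /Hess; field.
have F p q : Psch gh x p q = Psch g x p q + - Hess x p q + pd p u x * pd q u x
    + - (2^-1 * << Ups x, Ups x >>_x * g x p q) by rewrite Psch_rescale // /dP; ring.
have F1 p : << Psch gh x p, Ups x >>_x = << Psch g x p, Ups x >>_x - << Ups x, Hess x p >>_x
   + 2^-1 * << Ups x, Ups x >>_x * pd p u x.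
  rewrite (_ : Psch gh x p = fun q => Psch g x p q + - Hess x p q + pd p u x * pd q u x
    + - (2^-1 * << Ups x, Ups x >>_x * g x p q)); last by apply/funext => q; rewrite F.
  by rewrite !inn_lin !iM (iS (Hess x p)); by field.
have F2 p : << Psch gh x ^~ p, Ups x >>_x = << Psch gh x p, Ups x >>_x.
  congr inn; apply/funext => q; exact: (Psch_sym rescale_metric).
have C : cov2 g (cov1 g Ups) x a b c = cov2 g (cov1 g Ups) x b a c + << Rm g x a b c, Ups x >>_x.
  have := ricci_identity Hg a b c sU Ux => /eqP; rewrite subr_eq addrC => /eqP ->; congr (_ + _).
  rewrite innE ctrE exchange_big; apply: eq_bigr => d _; rewrite (Rup_low Hg) // mulr_suml.
  by apply: eq_bigr => e _; rewrite -mulrA mulrCA.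
rewrite !CotE !cov2_rescale // !D !F2 !F1 C Rm_inn //.
rewrite !F (Hess_sym b a) // (gsym Ux b a) (Psch_sym Hg b a Ux); by field.
Qed.

(** Only the symmetries of a Cotton tensor matter. In [Bach_rescale] it is applied to the Cotton
    tensor of [gh], differentiated with the connections of both metrics. *)
Lemma div3_rescale t x a b : U x -> (forall a b c, t x a b c = - t x b a c) ->
  (forall a b c, t x a b c + t x b c a + t x c a b = 0) ->
  (forall b, ctr (gi g x) (fun a c => t x a b c) = 0) ->
  ctr (gi g x) (fun d c => cov3 gh t x d c a b) = ctr (gi g x) (fun d c => cov3 g t x d c a b)
  + (n%:R - 4) * << fun e => t x e a b, Ups x >>_x - << fun e => t x e b a, Ups x >>_x.
Proof.
move=> Ux ta tc tt; have gs := gi_sym Hg Ux.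
rewrite (eq_ctr _ (fun d c => cov3_rescale t d c a b Ux)) !(ctrD, ctrN) !ctrZr.
have -> : ctr (gi g x) (fun i j => t x i a b * pd j u x) = << fun e => t x e a b, Ups x >>_x.
  by rewrite innE.
have -> : ctr (gi g x) (fun i j => t x j a b * pd i u x) = << fun e => t x e a b, Ups x >>_x.
  by rewrite ctr_sym // innE.
have -> : ctr (gi g x) (fun i j => t x j i b) = 0.
  have : ctr (gi g x) (fun i j => t x j i b) = - ctr (gi g x) (fun i j => t x j i b).
    by rewrite {1}ctr_sym // -ctrN; apply: eq_ctr => i j; rewrite ta.
  lra.
have -> : ctr (gi g x) (fun i j => t x j a i) = 0 by rewrite ctr_sym.
rewrite !(cmet Ux) (ctr_dim (gsym Ux) (giK Hg Ux)).
rewrite (_ : t x a ^~ b = fun e => - t x e a b); last by apply/funext => e; rewrite ta.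
rewrite (_ : t x b a = fun e => t x e a b + - t x e b a); last first.
  by apply/funext => e; have := tc b a e; rewrite (ta a e b); lra.
rewrite !inn_lin; ring.
Qed.

(** The factor n-4 has a different origin in each term. For one Cotton term it stands in
    [div3_rescale]; for the other it is -1 from there plus n-3 from [div_Weyl]; for the quadratic
    term it is n-4 and -1 from [div3_rescale] plus 1 from the change of the Schouten factor ([B2]).
    The Hessian terms of the two summands cancel. *)
Lemma Bach_rescale x a b : U x -> E x * Bach gh x a b = Bach g x a b
  + (n%:R - 4) * (<< fun e => Cot g x e a b, Ups x >>_x + << fun e => Cot g x e b a, Ups x >>_x)
  + (n%:R - 4) * << fun e => << Weyl g x a e b, Ups x >>_x, Ups x >>_x.
Proof.
move=> Ux; have gs := gi_sym Hg Ux; have gsh := gi_sym rescale_metric Ux.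
have iS v w : << v, w >>_x = << w, v >>_x by apply: inn_sym.
have sW p q r s : smooth_on U (fun z => Weyl g z p q r s) by apply: (smooth_Weyl Hg).
have sC p q r : smooth_on U (fun z => Cot g z p q r) by apply: (smooth_Cot Hg).
have sWU p q r : smooth_on U (fun z => << Weyl g z p q r, Ups z >>_z) by apply: (smooth_inn Hg).
have W12 p q r s : Weyl g x p q r s = - Weyl g x q p r s by exact: (Weyl_asym12 g p q r s Ux).
have W34 := fun p q r s => Weyl_asym34 Hg p q r s Ux.
have WP := fun p q r s => Weyl_pair Hg p q r s Ux.
rewrite !BachE [X in E x * (X + _)](ctr_sym _ gsh) [X in _ = X + _ + _ + _](ctr_sym _ gs).
rewrite [X in E x * (X + _)]ctr_rescale // div3_rescale //; first last.
- by move=> c; have := Cot_tr13 rescale_metric n3 c Ux; rewrite ctr_rescale // => /eqP;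
    rewrite mulf_eq0 invr_eq0 (negbTE (E_neq0 x)) => /eqP.
- by move=> *; apply: (Cot_cyclic rescale_metric).
- by move=> *; apply: Cot_asym.
have D d c : cov3 g (Cot gh) x d c a b = cov3 g (Cot g) x d c a b
    - (<< cov4 g (Weyl g) x d c a b, Ups x >>_x + << Weyl g x c a b, Hess x d >>_x).
  rewrite (cov3_eq Hg (t' := fun z p q r => Cot g z p q r - << Weyl g z p q r, Ups z >>_z)) //; last first.
    by move=> z Uz p q r; rewrite Cot_rescale.
  by rewrite (cov3B Hg) // (cov3_inn Hg).
rewrite (eq_ctr _ D) ctrD ctrN ctrD.
have -> : ctr (gi g x) (fun d c => << cov4 g (Weyl g) x d c a b, Ups x >>_x) =
    - (n%:R - 3) * << fun e => Cot g x e b a, Ups x >>_x.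
  rewrite (eq_ctr _ (fun d c => innE _ _ _)) ctr_exch innE -ctrZ; apply: eq_ctr => e f.
  rewrite ctrZr mulrA; congr (_ * _).
  rewrite Cot_asym mulrN -(div_Weyl Hg n3) // -ctrN; apply: eq_ctr => d c.
  rewrite (cov4_asym12 Hg d c a) //; last by move=> *; exact: Weyl_asym12.
  by rewrite (cov4_pair Hg d a c b e) //; move=> *; exact: (Weyl_pair Hg).
have L p q : << fun e => Cot gh x e p q, Ups x >>_x =
    << fun e => Cot g x e p q, Ups x >>_x + << fun e => << Weyl g x p e q, Ups x >>_x, Ups x >>_x.
  rewrite (_ : (fun e => Cot gh x e p q) = fun e => Cot g x e p q + << Weyl g x p e q, Ups x >>_x).
    by rewrite innDl.
  apply/funext => e; rewrite Cot_rescale //; congr (_ + _); rewrite -innNl; congr inn.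
  by apply/funext => f; rewrite (W12 e) opprK.
have WS : << fun e => << Weyl g x b e a, Ups x >>_x, Ups x >>_x =
    << fun e => << Weyl g x a e b, Ups x >>_x, Ups x >>_x.
  rewrite !innE (eq_ctr _ (fun e f => congr1 (fun w => w * _) (innE _ _ _))).
  rewrite [RHS](eq_ctr _ (fun e f => congr1 (fun w => w * _) (innE _ _ _))).
  under eq_ctr => e f do rewrite -ctrZr.
  under [RHS]eq_ctr => e f do rewrite -ctrZr.
  by rewrite ctr_exch; apply: eq_ctr => e f; apply: eq_ctr => c d; rewrite WP; ring.
have B2 : E x * ctr (gi gh x) (fun c e => ctr (gi gh x) (fun d m => Weyl gh x a c b d * Psch gh x e m)) =
    ctr (gi g x) (fun c e => ctr (gi g x) (fun d m => Weyl g x a c b d * Psch g x e m))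
    - ctr (gi g x) (fun c e => << Weyl g x a c b, Hess x e >>_x)
    + << fun e => << Weyl g x a e b, Ups x >>_x, Ups x >>_x.
  have T0 := Weyl_tr24 Hg n3 a b Ux.
  (* The vanishing Weyl trace [T0] is inserted as a zero on the right, to absorb the multiple of g
     contained in [dP]. *)
  rewrite ctr_rescale // mulVKf ?E_neq0 // -[RHS]addr0 -(mulr0 (- 2^-1 * << Ups x, Ups x >>_x)) -T0.
  rewrite [<< _, Ups x >>_x in RHS]innE -ctrZ -ctrN -!ctrD; apply: eq_ctr => c e.
  rewrite ctr_rescale // (@eq_ctr _ _ _ _ (fun d m => E x * (Weyl g x a c b d * Psch g x e m
    + (- (Weyl g x a c b d * Hess x e m)) + pd e u x * (Weyl g x a c b d * pd m u x)
    + (- 2^-1 * << Ups x, Ups x >>_x) * (Weyl g x a c b d * g x e m)))); last first.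
    by move=> d m; rewrite Weyl_rescale // Psch_rescale // /dP; ring.
  by rewrite ctrZ mulKf ?E_neq0 // !ctrD ctrN !ctrZ (cmet Ux) -!innE; ring.
rewrite mulrDr B2 mulVKf ?E_neq0 // !L WS.
have -> : ctr (gi g x) (fun i j => << Weyl g x j a b, Hess x i >>_x) =
   - ctr (gi g x) (fun c e => << Weyl g x a c b, Hess x e >>_x).
  rewrite ctr_sym // -ctrN; apply: eq_ctr => i j; rewrite -innNl; congr inn.
  by apply/funext => f; rewrite W12.
ring.
Qed.

End Conformal.

(** * Submanifolds *)

HB.lock Definition ev (R : comPzRingType) (m : nat) (t v : 'I_m -> R) : R := \sum_a t a * v a.

Section Evaluation.
Context {R : comPzRingType} {m : nat}.
Implicit Types (t v p q : 'I_m -> R).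

Lemma evE t v : ev t v = \sum_a t a * v a.
Proof. by rewrite ev.unlock. Qed.

Lemma evDl p q v : ev (fun i => p i + q i) v = ev p v + ev q v.
Proof. by rewrite !evE -big_split; apply: eq_bigr => i _; rewrite mulrDl. Qed.

Lemma evZl c p v : ev (fun i => c * p i) v = c * ev p v.
Proof. by rewrite !evE mulr_sumr; apply: eq_bigr => i _; rewrite mulrA. Qed.

Lemma evZlr c p v : ev (fun i => p i * c) v = c * ev p v.
Proof. by rewrite -evZl; congr ev; apply/funext => i; rewrite mulrC. Qed.

Lemma evNl p v : ev (fun i => - p i) v = - ev p v.
Proof. by rewrite !evE -sumrN; apply: eq_bigr => i _; rewrite mulNr. Qed.

Lemma evDr p q t : ev t (fun i => p i + q i) = ev t p + ev t q.
Proof. by rewrite !evE -big_split; apply: eq_bigr => i _; rewrite mulrDr. Qed.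

Lemma evZr c p t : ev t (fun i => c * p i) = c * ev t p.
Proof. by rewrite !evE mulr_sumr; apply: eq_bigr => i _; rewrite mulrCA. Qed.

Lemma ev_suml (I : finType) (p : I -> 'I_m -> R) v :
  ev (fun a => \sum_i p i a) v = \sum_i ev (p i) v.
Proof.
rewrite evE; under eq_bigr do rewrite mulr_suml.
by rewrite exchange_big; apply: eq_bigr => i _; rewrite evE.
Qed.

Lemma ev_sumr (I : finType) (p : I -> 'I_m -> R) t :
  ev t (fun a => \sum_i p i a) = \sum_i ev t (p i).
Proof.
rewrite evE; under eq_bigr do rewrite mulr_sumr.
by rewrite exchange_big; apply: eq_bigr => i _; rewrite evE.
Qed.

Lemma ev_ctrl k (M : 'M[R]_k) (p : 'I_k -> 'I_k -> 'I_m -> R) v :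
  ev (fun a => ctr M (fun i j => p i j a)) v = ctr M (fun i j => ev (p i j) v).
Proof.
under [X in ev X]eq_fun do rewrite ctrE.
rewrite ev_suml ctrE; apply: eq_bigr => i _; rewrite ev_suml; apply: eq_bigr => j _.
by rewrite evZl.
Qed.

Lemma ev_ctrr k (M : 'M[R]_k) (p : 'I_k -> 'I_k -> 'I_m -> R) t :
  ev t (fun a => ctr M (fun i j => p i j a)) = ctr M (fun i j => ev t (p i j)).
Proof.
under [X in ev _ X]eq_fun do rewrite ctrE.
rewrite ev_sumr ctrE; apply: eq_bigr => i _; rewrite ev_sumr; apply: eq_bigr => j _.
by rewrite evZr.
Qed.

Lemma ev_exch (t : 'I_m -> 'I_m -> R) u v :
  ev (fun a => ev (t a) u) v = ev (fun b => ev (fun a => t a b) v) u.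
Proof.
rewrite evE [RHS]evE; under eq_bigr do rewrite evE mulr_suml.
under [RHS]eq_bigr do rewrite evE mulr_suml.
by rewrite exchange_big; apply: eq_bigr => i _; apply: eq_bigr => j _; rewrite mulrAC.
Qed.

Lemma inn_ev (M : 'M[R]_m) u v : inn M u v = ev (fun a => ev (M a) v) u.
Proof.
rewrite innE ctrE evE; apply: eq_bigr => i _; rewrite evE mulr_suml; apply: eq_bigr => j _.
by rewrite mulrAC mulrA.
Qed.

Lemma inn_sumr (I : finType) M (p : I -> 'I_m -> R) v :
  inn M v (fun a => \sum_i p i a) = \sum_i inn M v (p i).
Proof.
rewrite innE (@eq_ctr _ _ _ _ (fun a b => \sum_i v a * p i b)); last by move=> a b; rewrite mulr_sumr.
by rewrite ctr_sum; apply: eq_bigr => i _; rewrite innE.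
Qed.

Lemma inn_suml (I : finType) M (p : I -> 'I_m -> R) v :
  inn M (fun a => \sum_i p i a) v = \sum_i inn M (p i) v.
Proof.
rewrite innE (@eq_ctr _ _ _ _ (fun a b => \sum_i p i a * v b)); last by move=> a b; rewrite mulr_suml.
by rewrite ctr_sum; apply: eq_bigr => i _; rewrite innE.
Qed.

Lemma inn_ctrr k (M : 'M[R]_m) (N : 'M[R]_k) (p : 'I_k -> 'I_k -> 'I_m -> R) v :
  inn M v (fun a => ctr N (fun i j => p i j a)) = ctr N (fun i j => inn M v (p i j)).
Proof.
under [X in inn _ _ X]eq_fun do rewrite ctrE.
rewrite inn_sumr ctrE; apply: eq_bigr => i _; rewrite inn_sumr; apply: eq_bigr => j _.
by rewrite innZr.
Qed.

End Evaluation.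

Section Connection.
Context {R : realType} {n : nat}.
Variables (U : set 'rV[R]_n) (g : 'rV[R]_n -> 'M[R]_n).
Hypothesis Hg : metric_on U g.

(* Koszul's formula. *)
Lemma Gamma_unique (om : 'I_n -> 'I_n -> 'I_n -> R) x : U x ->
  (forall c a b, om c a b = om c b a) ->
  (forall a b c, pd a (fun z => g z b c) x =
     \sum_d om d a b * g x d c + \sum_d om d a c * g x b d) ->
  forall c a b, om c a b = Gamma g x c a b.
Proof.
move=> Ux os oc c a b.
have low d e p : \sum_c om c d e * g x c p =
  2^-1 * (pd d (fun z => g z e p) x + pd e (fun z => g z d p) x - pd p (fun z => g z d e) x).
  have S q r : \sum_d0 om d0 q r * g x p d0 = \sum_d0 om d0 q r * g x d0 p.
    by apply: eq_bigr => ? _; rewrite (metric_sym Hg Ux p).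
  have T q r s : \sum_d0 om d0 q r * g x s d0 = \sum_d0 om d0 r q * g x d0 s.
    by apply: eq_bigr => ? _; rewrite (metric_sym Hg Ux s) os.
  rewrite !oc (T d p e) (T e p d) (T p e d).
  have Q q r s : \sum_d0 om d0 q r * g x d0 s = \sum_d0 om d0 r q * g x d0 s.
    by apply: eq_bigr => ? _; rewrite os.
  by rewrite (Q e d p) (Q e p d); field.
have H : g x *m gi g x = 1%:M by rewrite giE mulmxV // (metric_unit Hg).
have E q : q c = \sum_p (\sum_d q d * g x d p) * gi g x p c :> R.
  rewrite -[LHS](sum_deltar c); under [RHS]eq_bigr do rewrite mulr_suml.
  rewrite exchange_big; apply: eq_bigr => d _.
  have := congr1 (fun A : 'M[R]_n => A d c) H; rewrite !mxE => <-.
  by rewrite mulr_sumr; apply: eq_bigr => p _; rewrite mulrA.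
rewrite (E (fun c => om c a b)) [RHS](E (fun c => Gamma g x c a b)); apply: eq_bigr => p _.
by rewrite low (christoffel_low Hg).
Qed.

End Connection.

HB.lock Definition Frm (R : realType) k n (f : 'rV[R]_k -> 'rV[R]_n) y al a : R := frame f y al a.
HB.lock Definition Ind (R : realType) k n (g : 'rV[R]_n -> 'M[R]_n) (f : 'rV[R]_k -> 'rV[R]_n) y :=
  ind_metric g f y.
HB.lock Definition Tg (R : realType) k n (g : 'rV[R]_n -> 'M[R]_n) (f : 'rV[R]_k -> 'rV[R]_n) y v ga : R :=
  tangential g f y v ga.
HB.lock Definition Nor (R : realType) k n (g : 'rV[R]_n -> 'M[R]_n) (f : 'rV[R]_k -> 'rV[R]_n) y v a : R :=
  normal g f y v a.
HB.lock Definition Dal (R : realType) k n (g : 'rV[R]_n -> 'M[R]_n) (f : 'rV[R]_k -> 'rV[R]_n) s y al a : R :=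
  nabla_along g f s y al a.
HB.lock Definition Sff (R : realType) k n (g : 'rV[R]_n -> 'M[R]_n) (f : 'rV[R]_k -> 'rV[R]_n) y al be a : R :=
  sff g f y al be a.
HB.lock Definition Hm (R : realType) k n (g : 'rV[R]_n -> 'M[R]_n) (f : 'rV[R]_k -> 'rV[R]_n) y a : R :=
  meanH g f y a.
HB.lock Definition Sff0 (R : realType) k n (g : 'rV[R]_n -> 'M[R]_n) (f : 'rV[R]_k -> 'rV[R]_n) y al be a : R :=
  sff0 g f y al be a.

Ltac sexpose := rewrite ?Frm.unlock ?Ind.unlock ?Tg.unlock ?Nor.unlock ?Dal.unlock ?Sff.unlock
  ?Hm.unlock ?Sff0.unlock; expose.

Section SubUnfolding.
Context {R : realType} {k n : nat}.
Variables (g : 'rV[R]_n -> 'M[R]_n) (f : 'rV[R]_k -> 'rV[R]_n).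

Lemma dotE y u v : dot g f y u v = inn (g (f y)) u v.
Proof.
rewrite innE ctrE; apply: eq_bigr => a _; apply: eq_bigr => b _; by rewrite mulrA.
Qed.

Lemma FrmE y al a : Frm f y al a = pd al (fun z => f z 0 a) y.
Proof. by sexpose. Qed.

Lemma IndE y al be : Ind g f y al be = inn (g (f y)) (Frm f y al) (Frm f y be).
Proof. by rewrite -dotE; sexpose; rewrite mxE. Qed.

Lemma TgE y v ga : Tg g f y v ga = \sum_de gi (Ind g f) y ga de * inn (g (f y)) (Frm f y de) v.
Proof. by under eq_bigr do rewrite -dotE; sexpose. Qed.

Lemma NorE y v a : Nor g f y v a = v a - \sum_ga Tg g f y v ga * Frm f y ga a.
Proof. by sexpose. Qed.

Lemma DalE s y al a : Dal g f s y al a = pd al (fun z => s z a) y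
  + \sum_b \sum_c Gamma g (f y) a b c * Frm f y al b * s y c.
Proof. by sexpose. Qed.

Lemma SffE y al be : Sff g f y al be = Nor g f y (Dal g f (fun z => Frm f z be) y al).
Proof. by sexpose. Qed.

Lemma HmE y a : Hm g f y a = k%:R^-1 * ctr (gi (Ind g f) y) (fun al be => Sff g f y al be a).
Proof. by rewrite ctrE; sexpose. Qed.

Lemma Sff0E y al be a : Sff0 g f y al be a = Sff g f y al be a - Hm g f y a * Ind g f y al be.
Proof. by sexpose. Qed.

End SubUnfolding.

(** Injectivity of the differential enters as invertibility of the induced metric, to which it leads
    because g is positive definite. This form makes the induced metric a [metric_on] and is
    preserved by rescaling. *)
Record immersed_in (R : realType) (k n : nat) (V : set 'rV[R]_k) (U : set 'rV[R]_n)
    (g : 'rV[R]_n -> 'M[R]_n) (f : 'rV[R]_k -> 'rV[R]_n) : Prop := ImmersedIn {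
  imm_metric : metric_on U g;
  imm_open : open V;
  imm_smooth : smooth_on V f;
  imm_maps : forall y, V y -> U (f y);
  imm_unit : forall y, V y -> Ind g f y \in unitmx
}.

Section Immersed.
Context {R : realType} {k n : nat}.
Variables (V : set 'rV[R]_k) (U : set 'rV[R]_n) (g : 'rV[R]_n -> 'M[R]_n) (f : 'rV[R]_k -> 'rV[R]_n).
Hypothesis Hf : immersed_in V U g f.
Let Hg : metric_on U g. Proof. by case: Hf. Qed.
Let oV : open V. Proof. by case: Hf. Qed.
Let sf : smooth_on V f. Proof. by case: Hf. Qed.
Let fVU : forall y, V y -> U (f y). Proof. by case: Hf. Qed.
Let gsym : forall x, U x -> forall a b, g x a b = g x b a. Proof. by case: Hg. Qed.
Implicit Types (y : 'rV[R]_k) (al be ga de : 'I_k) (a b c d : 'I_n).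
Implicit Types (s t : 'rV[R]_k -> 'I_n -> R) (u v w : 'I_n -> R).

Local Notation F := (Frm f).
Local Notation h := (Ind g f).
Local Notation "<< v , w >>_ y" := (inn (g (f y)) v w) (at level 10, y at level 8).
Local Notation D := (Dal g f).

Lemma smooth_on_sub (p : 'rV[R]_n -> R) : smooth_on U p -> smooth_on V (fun y => p (f y)).
Proof. exact: smooth_comp. Qed.

Lemma pd_sub (p : 'rV[R]_n -> R) al y : smooth_on U p -> V y ->
  pd al (fun z => p (f z)) y = \sum_a pd a p (f y) * F y al a.
Proof.
move=> sp Vy; rewrite (pd_comp al sf fVU sp Vy); apply: eq_bigr => a _; by rewrite FrmE.
Qed.

Lemma dt_sym y v w : V y -> << v, w >>_y = << w, v >>_y.
Proof. by move=> Vy; apply: inn_sym; apply: gsym; exact: fVU. Qed.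

Lemma smooth_Frm al a : smooth_on V (fun y => F y al a).
Proof.
apply: smooth_ext => [y|]; first exact: FrmE.
by apply: smooth_pd; apply: smooth_coord.
Qed.
Hint Resolve smooth_Frm : smoothdb.

Lemma smooth_gsub a b : smooth_on V (fun y => g (f y) a b).
Proof. by apply: (smooth_on_sub (p := fun x => g x a b)); exact: (metric_smooth Hg). Qed.
Hint Resolve smooth_gsub : smoothdb.

Lemma smooth_Gsub a b c : smooth_on V (fun y => Gamma g (f y) a b c).
Proof. by apply: (smooth_on_sub (p := fun x => Gamma g x a b c)); exact: (smooth_Gamma Hg). Qed.
Hint Resolve smooth_Gsub : smoothdb.

Lemma smooth_dt s t : (forall a, smooth_on V (fun y => s y a)) ->
  (forall a, smooth_on V (fun y => t y a)) -> smooth_on V (fun y => << s y, t y >>_y).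
Proof.
move=> ss st; apply: smooth_ext => [y|]; first by rewrite innE.
by smooth.
Qed.

Lemma smooth_Ind al be : smooth_on V (fun y => h y al be).
Proof.
apply: smooth_ext => [y|]; first by rewrite IndE.
by apply: smooth_dt => a; smooth.
Qed.

Lemma Ind_metric : metric_on V h.
Proof.
split=> //; [exact: smooth_Ind | by move=> y Vy al be; rewrite !IndE dt_sym | by case: Hf].
Qed.

Lemma smooth_giInd al be : smooth_on V (fun y => gi h y al be).
Proof. exact: (smooth_gi Ind_metric). Qed.
Hint Resolve smooth_giInd smooth_Ind : smoothdb.

Lemma smooth_Dal s al a : (forall a, smooth_on V (fun y => s y a)) -> smooth_on V (fun y => D s y al a).
Proof. by move=> ss; apply: smooth_ext => [y|]; [exact: DalE|by smooth]. Qed.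

Lemma smooth_Tg s ga : (forall a, smooth_on V (fun y => s y a)) -> smooth_on V (fun y => Tg g f y (s y) ga).
Proof.
move=> ss; apply: smooth_ext => [y|]; first exact: TgE.
apply: smooth_sum => // de _; apply: smoothM => //; first by smooth.
by apply: smooth_dt => a; smooth.
Qed.

Lemma smooth_Nor s a : (forall a, smooth_on V (fun y => s y a)) -> smooth_on V (fun y => Nor g f y (s y) a).
Proof.
move=> ss; apply: smooth_ext => [y|]; first exact: NorE.
have sT ga := smooth_Tg ga ss.
by smooth.
Qed.

Lemma smooth_Sff al be a : smooth_on V (fun y => Sff g f y al be a).
Proof.
apply: smooth_ext => [y|]; first by rewrite SffE.
by apply: (smooth_Nor (s := fun y => D (fun z => F z be) y al)) => b; apply: smooth_Dal => c; smooth.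
Qed.
Hint Resolve smooth_Sff : smoothdb.

Lemma smooth_Hm a : smooth_on V (fun y => Hm g f y a).
Proof. by apply: smooth_ext => [y|]; [exact: HmE|by smooth]. Qed.
Hint Resolve smooth_Hm : smoothdb.

Lemma smooth_Sff0 al be a : smooth_on V (fun y => Sff0 g f y al be a).
Proof. by apply: smooth_ext => [y|]; [exact: Sff0E|by smooth]. Qed.

(** The chain rule and [metric_compat] express the derivative of g along f by Christoffel symbols;
    these are the connection parts [S] that complete the derivatives of s and t to [D]. *)
Lemma pd_dt s t al y : (forall a, smooth_on V (fun y => s y a)) ->
  (forall a, smooth_on V (fun y => t y a)) -> V y ->
  pd al (fun z => << s z, t z >>_z) y = << D s y al, t y >>_y + << s y, D t y al >>_y.
Proof.
move=> ss st Vy; have Uy := fVU Vy.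
have P : pd al (fun z => << s z, t z >>_z) y = ctr (g (f y)) (fun a b => pd al (fun z => s z a) y * t y b
      + s y a * pd al (fun z => t z b) y)
    + \sum_a \sum_b pd al (fun z => g (f z) a b) y * (s y a * t y b).
  rewrite (_ : (fun z => _) = fun z => \sum_a \sum_b g (f z) a b * (s z a * t z b)); last first.
    by apply/funext => z; rewrite innE ctrE.
  rewrite (pd_sum oV) //; last by move=> a _; smooth.
  rewrite ctrE -big_split; apply: eq_bigr => a _.
  rewrite (pd_sum oV) //; last by move=> b _; smooth.
  rewrite -big_split; apply: eq_bigr => b _.
  rewrite (pdM oV) //; try smooth.
  by rewrite (pdM oV) //= addrC.
pose S (v : 'I_n -> R) m := \sum_b \sum_c Gamma g (f y) m b c * F y al b * v c.
have G : \sum_a \sum_b pd al (fun z => g (f z) a b) y * (s y a * t y b) =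
    << S (s y), t y >>_y + << s y, S (t y) >>_y.
  have E a b : pd al (fun z => g (f z) a b) y = \sum_e F y al e * (\sum_m Gamma g (f y) m e a * g (f y) m b)
     + \sum_e F y al e * (\sum_m Gamma g (f y) m e b * g (f y) a m).
    rewrite (pd_sub (p := fun x => g x a b)) //; last exact: (metric_smooth Hg).
    rewrite -big_split; apply: eq_bigr => e _; rewrite (metric_compat Hg) // mulrC mulrDr //.
  have Q (v w : 'I_n -> R) : << S v, w >>_y = \sum_a \sum_b (\sum_e F y al e * (\sum_m Gamma g (f y) m e a * g (f y) m b)) * (v a * w b).
    rewrite /S inn_suml; under eq_bigr do rewrite inn_suml.
    rewrite exchange_big; apply: eq_bigr => a _.
    under [RHS]eq_bigr do rewrite mulr_suml.
    rewrite [RHS]exchange_big; apply: eq_bigr => e _.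
    rewrite innE ctrE exchange_big; apply: eq_bigr => b _.
    rewrite mulr_sumr mulr_suml; apply: eq_bigr => m _; ring.
  rewrite (dt_sym (s y)) // !Q [X in _ + X]exchange_big -big_split; apply: eq_bigr => a _.
  rewrite -big_split; apply: eq_bigr => b _; rewrite E mulrDl /=; congr (_ + _).
  rewrite [t y b * _]mulrC; congr (_ * _); apply: eq_bigr => e _; congr (_ * _).
  by apply: eq_bigr => m _; rewrite gsym.
have DE (p : 'rV[R]_k -> 'I_n -> R) : D p y al = fun a => pd al (fun z => p z a) y + S (p y) a.
  by apply/funext => a; rewrite DalE.
rewrite P G !DE innDl innDr ctrD -!innE; ring.
Qed.

Let Hh : metric_on V h. Proof. exact: Ind_metric. Qed.
Let hsym y (Vy : V y) := metric_sym Hh Vy.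
Let hcmet y (Vy : V y) := ctr_met (hsym Vy) (gi_sym Hh Vy) (giK Hh Vy).

Lemma Frm_sym_pd y al be a : V y -> pd al (fun z => F z be a) y = pd be (fun z => F z al a) y.
Proof.
move=> Vy; have E p q : pd p (fun z => F z q a) y = pd p (pd q (fun z => f z 0 a)) y.
  by congr (pd _ _ _); apply/funext => z; rewrite FrmE.
by rewrite !E; apply: (pdC oV) => //; apply: smooth_coord.
Qed.

Lemma Dal_Frm_sym y al be a : V y -> D (fun z => F z be) y al a = D (fun z => F z al) y be a.
Proof.
move=> Vy; rewrite !DalE Frm_sym_pd //; congr (_ + _).
rewrite exchange_big; apply: eq_bigr => b _; apply: eq_bigr => c _.
by rewrite (christoffel_sym Hg _ _ _ (fVU Vy)) mulrAC.
Qed.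

Lemma Tg_low y v al : V y -> \sum_ga Tg g f y v ga * h y ga al = << F y al, v >>_y.
Proof.
move=> Vy; under eq_bigr do rewrite TgE.
rewrite (ctr_sum_up (gi h y) (fun de => << F y de, v >>_y) (fun ga al => h y ga al)).
by rewrite (hcmet Vy).
Qed.

(** The tangential coefficients are symmetric and compatible with the induced metric, so
    [Gamma_unique] applies. From here on the intrinsic calculus for [Ind g f] is available on the
    submanifold. *)
Lemma Tg_conn y al be ga : V y -> Tg g f y (D (fun z => F z be) y al) ga = Gamma h y ga al be.
Proof.
move=> Vy; apply: (Gamma_unique Hh (om := fun ga al be => Tg g f y (D (fun z => F z be) y al) ga)) => //.
  by move=> c p q; congr Tg; apply/funext => a; apply: Dal_Frm_sym.
move=> p q r; rewrite (_ : (fun z => h z q r) = fun z => << F z q, F z r >>_z); last first.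
  by apply/funext => z; rewrite IndE.
rewrite pd_dt //; try smooth.
rewrite Tg_low // [<< F y q, _ >>_y]dt_sym // [<< D _ _ _, F y r >>_y]dt_sym //; congr (_ + _).
by under eq_bigr do rewrite (hsym Vy); rewrite Tg_low // dt_sym.
Qed.

(** The Gauss formula, with the induced Christoffel symbols supplied by [Tg_conn]. *)
Lemma Dal_Frm y al be a : V y ->
  D (fun z => F z be) y al a = \sum_ga Gamma h y ga al be * F y ga a + Sff g f y al be a.
Proof.
move=> Vy; rewrite SffE NorE addrC -addrA (_ : - _ + _ = 0) ?addr0 //.
by apply/eqP; rewrite addrC subr_eq0; apply/eqP; apply: eq_bigr => ga _; rewrite Tg_conn.
Qed.

Lemma dt_Frm_Nor y v al : V y -> << F y al, Nor g f y v >>_y = 0.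
Proof.
move=> Vy; rewrite (_ : Nor g f y v = fun a => v a + - \sum_ga Tg g f y v ga * F y ga a); last first.
  by apply/funext => a; rewrite NorE.
rewrite innDr innNr inn_sumr -[X in X - _]Tg_low // -sumrB big1 // => ga _.
by rewrite innZr -IndE (hsym Vy) subrr.
Qed.

Lemma dt_Nor y v w : V y -> (forall al, << F y al, w >>_y = 0) -> << Nor g f y v, w >>_y = << v, w >>_y.
Proof.
move=> Vy H; rewrite (_ : Nor g f y v = fun a => v a + - \sum_ga Tg g f y v ga * F y ga a); last first.
  by apply/funext => a; rewrite NorE.
by rewrite innDl innNl inn_suml big1 ?subr0 // => ga _; rewrite innZl H mulr0.
Qed.

Lemma Nor_lin y (e : R) v w : Nor g f y (fun a => e * v a + w a) = fun a => e * Nor g f y v a + Nor g f y w a.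
Proof.
apply/funext => a; rewrite !NorE.
have T ga : Tg g f y (fun a => e * v a + w a) ga = e * Tg g f y v ga + Tg g f y w ga.
  by rewrite !TgE -sumMZ -big_split; apply: eq_bigr => de _; rewrite innDr innZr mulrDr.
rewrite (eq_bigr (fun ga => e * (Tg g f y v ga * F y ga a) + Tg g f y w ga * F y ga a)); last first.
  by move=> ga _; rewrite T; ring.
by rewrite big_split -mulr_sumr /=; ring.
Qed.

Lemma Nor_Frm y al a : V y -> Nor g f y (F y al) a = 0.
Proof.
move=> Vy; rewrite NorE (eq_bigr (fun ga => (ga == al)%:R * F y ga a)) ?sum_delta ?subrr // => ga _.
congr (_ * _); rewrite TgE -(sum_inv (giK Hh Vy)); apply: eq_bigr => de _.
by rewrite -IndE.
Qed.

Lemma dt_Frm_Sff y al be ga : V y -> << F y ga, Sff g f y al be >>_y = 0.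
Proof. by move=> Vy; rewrite SffE dt_Frm_Nor. Qed.

Lemma Sff_sym y al be : V y -> Sff g f y al be = Sff g f y be al.
Proof.
move=> Vy; rewrite !SffE; congr Nor; apply/funext => a; exact: Dal_Frm_sym.
Qed.

Lemma dt_Frm_Hm y ga : V y -> << F y ga, Hm g f y >>_y = 0.
Proof.
move=> Vy; rewrite (_ : Hm g f y = fun a => k%:R^-1 * ctr (gi h y) (fun al be => Sff g f y al be a)).
  rewrite innZr inn_ctrr (eq_ctr _ (fun al be => dt_Frm_Sff al be ga Vy)).
  by rewrite ctrE big1 ?mulr0 // => i _; rewrite big1 // => j _; rewrite mulr0.
by apply/funext => a; rewrite HmE.
Qed.

Lemma Sff0_fun y al be : Sff0 g f y al be = fun a => Sff g f y al be a + - (Hm g f y a * h y al be).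
Proof. by apply/funext => a; rewrite Sff0E. Qed.

Lemma Sff_fun y al be : Sff g f y al be = fun a => Sff0 g f y al be a + h y al be * Hm g f y a.
Proof. by apply/funext => a; rewrite Sff0E; ring. Qed.

Lemma dt_Frm_Sff0 y al be ga : V y -> << F y ga, Sff0 g f y al be >>_y = 0.
Proof. by move=> Vy; rewrite Sff0_fun !inn_lin dt_Frm_Sff // dt_Frm_Hm //; ring. Qed.

Lemma Sff0_sym y al be : V y -> Sff0 g f y al be = Sff0 g f y be al.
Proof. by move=> Vy; rewrite !Sff0_fun Sff_sym // (hsym Vy al be). Qed.

Hypothesis k0 : (0 < k)%N.

Lemma tr_Sff y a : ctr (gi h y) (fun al be => Sff g f y al be a) = k%:R * Hm g f y a.
Proof. by rewrite HmE mulVKf // pnatr_eq0 -lt0n. Qed.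

Lemma tr_Sff0 y a : V y -> ctr (gi h y) (fun al be => Sff0 g f y al be a) = 0.
Proof.
move=> Vy; rewrite (eq_ctr _ (fun al be => Sff0E g f y al be a)) ctrD ctrN ctrZ tr_Sff.
by rewrite (ctr_dim (hsym Vy) (giK Hh Vy)); ring.
Qed.

End Immersed.

#[export] Hint Resolve smooth_Frm smooth_gsub smooth_Gsub smooth_Ind smooth_Sff smooth_Hm smooth_Sff0 : smoothdb.

(** * Multilinear contractions *)

HB.lock Definition con2 (R : comPzRingType) (n : nat) (t : 'I_n -> 'I_n -> R) (u v : 'I_n -> R) : R :=
  ev (fun a => ev (t a) v) u.
HB.lock Definition con3 (R : comPzRingType) (n : nat) (t : 'I_n -> 'I_n -> 'I_n -> R)
    (u v w : 'I_n -> R) : R := ev (fun a => con2 (t a) v w) u.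
HB.lock Definition con4 (R : comPzRingType) (n : nat) (t : 'I_n -> 'I_n -> 'I_n -> 'I_n -> R)
    (u v w z : 'I_n -> R) : R := ev (fun a => con3 (t a) v w z) u.

Section MultilinearContraction.
Context {R : comPzRingType} {n : nat}.
Implicit Types (u v w z p q : 'I_n -> R).

Lemma eq_con3 t t' u v w : (forall a b c, t a b c = t' a b c) -> con3 t u v w = con3 t' u v w.
Proof. by move=> E; congr con3; do 3!apply/funext=> ?; exact: E. Qed.

Lemma eq_con4 t t' u v w z : (forall a b c d, t a b c d = t' a b c d) -> con4 t u v w z = con4 t' u v w z.
Proof. by move=> E; congr con4; do 4!apply/funext=> ?; exact: E. Qed.

Section Linearity.
Variables (I : finType) (c : I -> R) (p : I -> 'I_n -> R) (q : 'I_n -> R).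
Local Notation lc := (fun a => \sum_i c i * p i a + q a).

(** The vector [lc] has the shape of the Gauss formula, a combination of frame vectors plus a
    remainder, so that a differentiated frame vector in any slot expands by one rewriting. *)
Lemma ev_lc (t : 'I_n -> R) : ev t lc = \sum_i c i * ev t (p i) + ev t q.
Proof. by rewrite evDr ev_sumr; congr (_ + _); apply: eq_bigr => i _; rewrite evZr. Qed.

Lemma ev_lcl (X : I -> 'I_n -> R) (Y v : 'I_n -> R) :
  ev (fun a => \sum_i c i * X i a + Y a) v = \sum_i c i * ev (X i) v + ev Y v.
Proof. by rewrite evDl ev_suml; congr (_ + _); apply: eq_bigr => i _; rewrite evZl. Qed.

Lemma con2_lc1 t v : con2 t lc v = \sum_i c i * con2 t (p i) v + con2 t q v.
Proof. by rewrite con2.unlock; exact: ev_lc. Qed.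

Lemma con2_lc2 t v : con2 t v lc = \sum_i c i * con2 t v (p i) + con2 t v q.
Proof. by rewrite con2.unlock; under eq_fun do rewrite ev_lc; rewrite ev_lcl. Qed.

Lemma con3_lc1 t v w : con3 t lc v w = \sum_i c i * con3 t (p i) v w + con3 t q v w.
Proof. by rewrite con3.unlock; exact: ev_lc. Qed.

Lemma con3_lc2 t v w : con3 t v lc w = \sum_i c i * con3 t v (p i) w + con3 t v q w.
Proof. by rewrite con3.unlock; under eq_fun do rewrite con2_lc1; rewrite ev_lcl. Qed.

Lemma con3_lc3 t v w : con3 t v w lc = \sum_i c i * con3 t v w (p i) + con3 t v w q.
Proof. by rewrite con3.unlock; under eq_fun do rewrite con2_lc2; rewrite ev_lcl. Qed.

Lemma con4_lc1 t v w z : con4 t lc v w z = \sum_i c i * con4 t (p i) v w z + con4 t q v w z.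
Proof. by rewrite con4.unlock; exact: ev_lc. Qed.

Lemma con4_lc2 t v w z : con4 t v lc w z = \sum_i c i * con4 t v (p i) w z + con4 t v q w z.
Proof. by rewrite con4.unlock; under eq_fun do rewrite con3_lc1; rewrite ev_lcl. Qed.

Lemma con4_lc3 t v w z : con4 t v w lc z = \sum_i c i * con4 t v w (p i) z + con4 t v w q z.
Proof. by rewrite con4.unlock; under eq_fun do rewrite con3_lc2; rewrite ev_lcl. Qed.

Lemma con4_lc4 t v w z : con4 t v w z lc = \sum_i c i * con4 t v w z (p i) + con4 t v w z q.
Proof. by rewrite con4.unlock; under eq_fun do rewrite con3_lc3; rewrite ev_lcl. Qed.

End Linearity.

Lemma con4_add1 t p q v w z : con4 t (fun a => p a + q a) v w z = con4 t p v w z + con4 t q v w z.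
Proof. by rewrite con4.unlock evDr. Qed.

Lemma con4_add2 t u p q w z : con4 t u (fun a => p a + q a) w z = con4 t u p w z + con4 t u q w z.
Proof. by rewrite con4.unlock con3.unlock -evDl; congr ev; apply/funext => a; rewrite evDr. Qed.

Lemma con4_add3 t u v p q z : con4 t u v (fun a => p a + q a) z = con4 t u v p z + con4 t u v q z.
Proof.
rewrite con4.unlock con3.unlock con2.unlock -evDl; congr ev; apply/funext => a.
by rewrite -evDl; congr ev; apply/funext => b; rewrite evDr.
Qed.

Lemma con4_add4 t u v w p q : con4 t u v w (fun a => p a + q a) = con4 t u v w p + con4 t u v w q.
Proof.
rewrite con4.unlock con3.unlock con2.unlock -evDl; congr ev; apply/funext => a.
rewrite -evDl; congr ev; apply/funext => b.
by rewrite -evDl; congr ev; apply/funext => c; rewrite evDr.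
Qed.

Section Transpose.
Variable A : 'I_n -> 'I_n -> R.
Local Notation act := (fun v m => \sum_a A m a * v a).

(** This family moves a matrix from an index of the tensor to the argument in the same slot;
    Christoffel terms of the tensor thereby become connection terms of the arguments. *)
Lemma ev_act t v : ev (fun a => \sum_m A m a * t m) v = ev t (act v).
Proof.
rewrite evE [RHS]evE; under eq_bigr do rewrite mulr_suml.
rewrite exchange_big; apply: eq_bigr => m _; rewrite mulr_sumr; apply: eq_bigr => a _; ring.
Qed.

Lemma ev_act_in (X : 'I_n -> 'I_n -> R) v (B : 'I_n -> R) :
  ev (fun a => \sum_m B m * X m a) v = \sum_m B m * ev (X m) v.
Proof. by rewrite ev_suml; apply: eq_bigr => m _; rewrite evZl. Qed.

Lemma con2_act1 t u v : con2 (fun a b => \sum_m A m a * t m b) u v = con2 t (act u) v.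
Proof. by rewrite con2.unlock; under eq_fun do rewrite ev_act_in; rewrite ev_act. Qed.

Lemma con2_act2 t u v : con2 (fun a b => \sum_m A m b * t a m) u v = con2 t u (act v).
Proof. by rewrite con2.unlock; under eq_fun do rewrite ev_act. Qed.

Lemma con2_act_in (X : 'I_n -> 'I_n -> 'I_n -> R) u v (B : 'I_n -> R) :
  con2 (fun a b => \sum_m B m * X m a b) u v = \sum_m B m * con2 (X m) u v.
Proof. by rewrite con2.unlock; under eq_fun do rewrite ev_act_in; rewrite ev_act_in. Qed.

Lemma con3_act1 t u v w : con3 (fun a b c => \sum_m A m a * t m b c) u v w = con3 t (act u) v w.
Proof. by rewrite con3.unlock; under eq_fun do rewrite con2_act_in; rewrite ev_act. Qed.

Lemma con3_act2 t u v w : con3 (fun a b c => \sum_m A m b * t a m c) u v w = con3 t u (act v) w.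
Proof. by rewrite con3.unlock; under eq_fun do rewrite con2_act1. Qed.

Lemma con3_act3 t u v w : con3 (fun a b c => \sum_m A m c * t a b m) u v w = con3 t u v (act w).
Proof. by rewrite con3.unlock; under eq_fun do rewrite con2_act2. Qed.

Lemma con3_act_in (X : 'I_n -> 'I_n -> 'I_n -> 'I_n -> R) u v w (B : 'I_n -> R) :
  con3 (fun a b c => \sum_m B m * X m a b c) u v w = \sum_m B m * con3 (X m) u v w.
Proof. by rewrite con3.unlock; under eq_fun do rewrite con2_act_in; rewrite ev_act_in. Qed.

Lemma con4_act1 t u v w z :
  con4 (fun a b c d => \sum_m A m a * t m b c d) u v w z = con4 t (act u) v w z.
Proof. by rewrite con4.unlock; under eq_fun do rewrite con3_act_in; rewrite ev_act. Qed.

Lemma con4_act2 t u v w z :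
  con4 (fun a b c d => \sum_m A m b * t a m c d) u v w z = con4 t u (act v) w z.
Proof. by rewrite con4.unlock; under eq_fun do rewrite con3_act1. Qed.

Lemma con4_act3 t u v w z :
  con4 (fun a b c d => \sum_m A m c * t a b m d) u v w z = con4 t u v (act w) z.
Proof. by rewrite con4.unlock; under eq_fun do rewrite con3_act2. Qed.

Lemma con4_act4 t u v w z :
  con4 (fun a b c d => \sum_m A m d * t a b c m) u v w z = con4 t u v w (act z).
Proof. by rewrite con4.unlock; under eq_fun do rewrite con3_act3. Qed.

Lemma con4_act_in (X : 'I_n -> 'I_n -> 'I_n -> 'I_n -> 'I_n -> R) u v w z (B : 'I_n -> R) :
  con4 (fun a b c d => \sum_m B m * X m a b c d) u v w z = \sum_m B m * con4 (X m) u v w z.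
Proof. by rewrite con4.unlock; under eq_fun do rewrite con3_act_in; rewrite ev_act_in. Qed.

End Transpose.

Lemma con2D t t' u v : con2 (fun a b => t a b + t' a b) u v = con2 t u v + con2 t' u v.
Proof. by rewrite con2.unlock; under eq_fun do rewrite evDl; rewrite evDl. Qed.

Lemma con2Z e t u v : con2 (fun a b => e * t a b) u v = e * con2 t u v.
Proof. by rewrite con2.unlock; under eq_fun do rewrite evZl; rewrite evZl. Qed.

Lemma con3D t t' u v w : con3 (fun a b c => t a b c + t' a b c) u v w = con3 t u v w + con3 t' u v w.
Proof. by rewrite con3.unlock; under eq_fun do rewrite con2D; rewrite evDl. Qed.

Lemma con3Z e t u v w : con3 (fun a b c => e * t a b c) u v w = e * con3 t u v w.
Proof. by rewrite con3.unlock; under eq_fun do rewrite con2Z; rewrite evZl. Qed.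

Lemma con4D t t' u v w z :
  con4 (fun a b c d => t a b c d + t' a b c d) u v w z = con4 t u v w z + con4 t' u v w z.
Proof. by rewrite con4.unlock; under eq_fun do rewrite con3D; rewrite evDl. Qed.

Lemma con4Z e t u v w z : con4 (fun a b c d => e * t a b c d) u v w z = e * con4 t u v w z.
Proof. by rewrite con4.unlock; under eq_fun do rewrite con3Z; rewrite evZl. Qed.

Lemma con2N t u v : con2 (fun a b => - t a b) u v = - con2 t u v.
Proof. by rewrite con2.unlock; under eq_fun do rewrite evNl; rewrite evNl. Qed.

Lemma con3N t u v w : con3 (fun a b c => - t a b c) u v w = - con3 t u v w.
Proof. by rewrite con3.unlock; under eq_fun do rewrite con2N; rewrite evNl. Qed.

Lemma con4N t u v w z : con4 (fun a b c d => - t a b c d) u v w z = - con4 t u v w z.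
Proof. by rewrite con4.unlock; under eq_fun do rewrite con3N; rewrite evNl. Qed.

Lemma con3_s12 t u v w : con3 t u v w = con3 (fun a b c => t b a c) v u w.
Proof. by rewrite con3.unlock con2.unlock; exact: ev_exch. Qed.

Lemma con2_s12 t u v : con2 t u v = con2 (fun a b => t b a) v u.
Proof. by rewrite con2.unlock; exact: ev_exch. Qed.

Lemma con3_s23 t u v w : con3 t u v w = con3 (fun a b c => t a c b) u w v.
Proof. by rewrite con3.unlock; under eq_fun do rewrite con2_s12. Qed.

Lemma con4_s12 t u v w z : con4 t u v w z = con4 (fun a b c d => t b a c d) v u w z.
Proof. by rewrite con4.unlock con3.unlock; exact: ev_exch. Qed.

Lemma con4_s23 t u v w z : con4 t u v w z = con4 (fun a b c d => t a c b d) u w v z.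
Proof. by rewrite con4.unlock; under eq_fun do rewrite con3_s12. Qed.

Lemma con4_s34 t u v w z : con4 t u v w z = con4 (fun a b c d => t a b d c) u v z w.
Proof. by rewrite con4.unlock; under eq_fun do rewrite con3_s23. Qed.

Lemma con4_pair t u v w z : con4 t u v w z = con4 (fun a b c d => t c d a b) w z u v.
Proof. by rewrite con4_s23 con4_s12 con4_s34 con4_s23. Qed.

Lemma con2_prod (p q u v : 'I_n -> R) : con2 (fun a b => p a * q b) u v = ev p u * ev q v.
Proof. by rewrite con2.unlock; under eq_fun do rewrite evZl; rewrite evZlr mulrC. Qed.

Lemma con4_prod1 (s t : 'I_n -> 'I_n -> R) u v w z :
  con4 (fun a b c d => s a c * t b d) u v w z = con2 s u w * con2 t v z.
Proof.
rewrite con4_s23 con4.unlock con3.unlock.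
transitivity (ev (fun a => ev (fun c => s a c * con2 t v z) w) u).
  by congr ev; apply/funext => a; congr ev; apply/funext => c; exact: con2Z.
under eq_fun do rewrite evZlr.
by rewrite evZl mulrC con2.unlock.
Qed.

Lemma con4_prod2 (s t : 'I_n -> 'I_n -> R) u v w z :
  con4 (fun a b c d => s a d * t b c) u v w z = con2 s u z * con2 t v w.
Proof. by rewrite con4_s34 con4_prod1. Qed.

Lemma con2E t u v : con2 t u v = \sum_a \sum_b t a b * u a * v b.
Proof.
rewrite con2.unlock evE; apply: eq_bigr => a _; rewrite evE mulr_suml; apply: eq_bigr => b _.
by rewrite mulrAC.
Qed.

Lemma con3E t u v w : con3 t u v w = \sum_a \sum_b \sum_c t a b c * u a * v b * w c.
Proof.
rewrite con3.unlock evE; apply: eq_bigr => a _; rewrite con2E mulr_suml; apply: eq_bigr => b _.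
by rewrite mulr_suml; apply: eq_bigr => c _; ring.
Qed.

Lemma con4E t u v w z :
  con4 t u v w z = \sum_a \sum_b \sum_c \sum_d t a b c d * u a * v b * w c * z d.
Proof.
rewrite con4.unlock evE; apply: eq_bigr => a _; rewrite con3E mulr_suml; apply: eq_bigr => b _.
rewrite mulr_suml; apply: eq_bigr => c _; rewrite mulr_suml; apply: eq_bigr => d _; ring.
Qed.

End MultilinearContraction.

(** * Leibniz rules along the immersion *)

Section Along.
Context {R : realType} {k n : nat}.
Variables (V : set 'rV[R]_k) (U : set 'rV[R]_n) (g : 'rV[R]_n -> 'M[R]_n) (f : 'rV[R]_k -> 'rV[R]_n).
Hypothesis Hf : immersed_in V U g f.
Let oV : open V. Proof. by case: Hf. Qed.
Let fVU : forall y, V y -> U (f y). Proof. by case: Hf. Qed.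
Implicit Types (y : 'rV[R]_k) (al be ga de : 'I_k) (a b c d : 'I_n).
Implicit Types (s t : 'rV[R]_k -> 'I_n -> R) (u v w : 'I_n -> R).

Local Notation F := (Frm f).
Local Notation "<< v , w >>_ y" := (inn (g (f y)) v w) (at level 10, y at level 8).
Local Notation D := (Dal g f).
Local Notation vec s := (forall a, smooth_on V (fun z => s z a)).

Lemma pd_ev s t al y : vec s -> vec t -> V y -> pd al (fun z => ev (t z) (s z)) y =
  ev (fun a => pd al (fun z => t z a) y) (s y) + ev (t y) (fun a => pd al (fun z => s z a) y).
Proof.
move=> ss st Vy; rewrite (_ : (fun z => _) = fun z => \sum_a t z a * s z a); last first.
  by apply/funext => z; rewrite evE.
rewrite (pd_sum oV) //; last by move=> a _; smooth.
by rewrite !evE -big_split; apply: eq_bigr => a _; rewrite (pdM oV).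
Qed.

Lemma smooth_ev s t : vec s -> vec t -> smooth_on V (fun z => ev (t z) (s z)).
Proof. by move=> ss st; apply: smooth_ext => [z|]; [exact: evE|by smooth]. Qed.

Definition conn_act y al (v : 'I_n -> R) m : R :=
  \sum_c (\sum_b F y al b * Gamma g (f y) m b c) * v c.

Lemma Dal_act s y al : D s y al = fun a => pd al (fun z => s z a) y + conn_act y al (s y) a.
Proof.
apply/funext => a; rewrite DalE /conn_act; congr (_ + _); rewrite exchange_big.
by apply: eq_bigr => c _; rewrite mulr_suml; apply: eq_bigr => b _; ring.
Qed.

Lemma pd_con1 (t : 'rV[R]_n -> 'I_n -> R) s al y :
  (forall a, smooth_on U (fun x => t x a)) -> vec s -> V y ->
  pd al (fun z => ev (t (f z)) (s z)) y = con2 (cov1 g t (f y)) (F y al) (s y) + ev (t (f y)) (D s y al).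
Proof.
move=> st ss Vy.
have st' a : smooth_on V (fun z => t (f z) a) by apply: (smooth_on_sub Hf (p := fun x => t x a)).
rewrite (pd_ev (t := fun z => t (f z))) // Dal_act evDr addrCA addrC; congr (_ + _).
rewrite (_ : (fun a => pd al (fun z => t (f z) a) y) = fun a => \sum_e F y al e * cov1 g t (f y) e a
   + \sum_m (\sum_b F y al b * Gamma g (f y) m b a) * t (f y) m).
  rewrite evDl -ev_act; congr (_ + _).
  by rewrite con2_s12 con2.unlock; congr ev; apply/funext => a; rewrite evE; apply: eq_bigr => e _; rewrite mulrC.
apply/funext => a; rewrite (pd_sub Hf (p := fun x => t x a)) //.
under [X in _ + X]eq_bigr do rewrite mulr_suml.
rewrite exchange_big -big_split; apply: eq_bigr => e _; rewrite cov1E.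
by rewrite mulrC mulrBr mulr_sumr; under [X in _ - X]eq_bigr do rewrite mulrA; rewrite /= subrK.
Qed.

Lemma smooth_con2 (t : 'rV[R]_k -> 'I_n -> 'I_n -> R) s r : (forall a b, smooth_on V (fun z => t z a b)) ->
  vec s -> vec r -> smooth_on V (fun z => con2 (t z) (s z) (r z)).
Proof.
move=> st ss sr; rewrite con2.unlock; apply: (smooth_ev (t := fun z a => ev (t z a) (r z))) => // a.
exact: smooth_ev.
Qed.

Lemma smooth_con3 (t : 'rV[R]_k -> 'I_n -> 'I_n -> 'I_n -> R) s1 s2 s3 :
  (forall a b c, smooth_on V (fun z => t z a b c)) ->
  vec s1 -> vec s2 -> vec s3 -> smooth_on V (fun z => con3 (t z) (s1 z) (s2 z) (s3 z)).
Proof.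
move=> st ss1 ss2 ss3; rewrite con3.unlock.
apply: (smooth_ev (t := fun z a => con2 (t z a) (s2 z) (s3 z))) => // a.
exact: smooth_con2.
Qed.

Lemma smooth_con4 (t : 'rV[R]_k -> 'I_n -> 'I_n -> 'I_n -> 'I_n -> R) s1 s2 s3 s4 :
  (forall a b c d, smooth_on V (fun z => t z a b c d)) ->
  vec s1 -> vec s2 -> vec s3 -> vec s4 -> smooth_on V (fun z => con4 (t z) (s1 z) (s2 z) (s3 z) (s4 z)).
Proof.
move=> st ss1 ss2 ss3 ss4; rewrite con4.unlock.
apply: (smooth_ev (t := fun z a => con3 (t z a) (s2 z) (s3 z) (s4 z))) => // a.
exact: smooth_con3.
Qed.

Local Notation dal al s y := (fun a => pd al (fun z => s z a) y).

Lemma pd_con2f (t : 'rV[R]_k -> 'I_n -> 'I_n -> R) s r al y :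
  (forall a b, smooth_on V (fun z => t z a b)) -> vec s -> vec r -> V y ->
  pd al (fun z => con2 (t z) (s z) (r z)) y =
  con2 (fun a b => pd al (fun z => t z a b) y) (s y) (r y)
  + con2 (t y) (dal al s y) (r y) + con2 (t y) (s y) (dal al r y).
Proof.
move=> st ss sr Vy; rewrite con2.unlock (pd_ev (t := fun z a => ev (t z a) (r z))) //; last first.
  by move=> a; apply: smooth_ev.
rewrite (_ : (fun a => pd al (fun z => ev (t z a) (r z)) y) = fun a =>
  ev (fun b => pd al (fun z => t z a b) y) (r y) + ev (t y a) (dal al r y)).
  by rewrite evDl; ring.
by apply/funext => a; rewrite (pd_ev (t := fun z => t z a)).
Qed.

Lemma pd_con3f (t : 'rV[R]_k -> 'I_n -> 'I_n -> 'I_n -> R) s1 s2 s3 al y :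
  (forall a b c, smooth_on V (fun z => t z a b c)) -> vec s1 -> vec s2 -> vec s3 -> V y ->
  pd al (fun z => con3 (t z) (s1 z) (s2 z) (s3 z)) y =
  con3 (fun a b c => pd al (fun z => t z a b c) y) (s1 y) (s2 y) (s3 y)
  + con3 (t y) (dal al s1 y) (s2 y) (s3 y) + con3 (t y) (s1 y) (dal al s2 y) (s3 y)
  + con3 (t y) (s1 y) (s2 y) (dal al s3 y).
Proof.
move=> st ss1 ss2 ss3 Vy; rewrite con3.unlock (pd_ev (t := fun z a => con2 (t z a) (s2 z) (s3 z))) //; last first.
  by move=> a; apply: smooth_con2.
rewrite (_ : (fun a => pd al (fun z => con2 (t z a) (s2 z) (s3 z)) y) = fun a =>
  con2 (fun b c => pd al (fun z => t z a b c) y) (s2 y) (s3 y) + con2 (t y a) (dal al s2 y) (s3 y)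
  + con2 (t y a) (s2 y) (dal al s3 y)).
  by rewrite !evDl; ring.
by apply/funext => a; rewrite (pd_con2f (t := fun z => t z a)).
Qed.

Lemma pd_con4f (t : 'rV[R]_k -> 'I_n -> 'I_n -> 'I_n -> 'I_n -> R) s1 s2 s3 s4 al y :
  (forall a b c d, smooth_on V (fun z => t z a b c d)) ->
  vec s1 -> vec s2 -> vec s3 -> vec s4 -> V y ->
  pd al (fun z => con4 (t z) (s1 z) (s2 z) (s3 z) (s4 z)) y =
  con4 (fun a b c d => pd al (fun z => t z a b c d) y) (s1 y) (s2 y) (s3 y) (s4 y)
  + con4 (t y) (dal al s1 y) (s2 y) (s3 y) (s4 y) + con4 (t y) (s1 y) (dal al s2 y) (s3 y) (s4 y)
  + con4 (t y) (s1 y) (s2 y) (dal al s3 y) (s4 y) + con4 (t y) (s1 y) (s2 y) (s3 y) (dal al s4 y).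
Proof.
move=> st ss1 ss2 ss3 ss4 Vy.
rewrite con4.unlock (pd_ev (t := fun z a => con3 (t z a) (s2 z) (s3 z) (s4 z))) //; last first.
  by move=> a; apply: smooth_con3.
rewrite (_ : (fun a => pd al (fun z => con3 (t z a) (s2 z) (s3 z) (s4 z)) y) = fun a =>
  con3 (fun b c d => pd al (fun z => t z a b c d) y) (s2 y) (s3 y) (s4 y)
  + con3 (t y a) (dal al s2 y) (s3 y) (s4 y)
  + con3 (t y a) (s2 y) (dal al s3 y) (s4 y) + con3 (t y a) (s2 y) (s3 y) (dal al s4 y)).
  by rewrite !evDl; ring.
by apply/funext => a; rewrite (pd_con3f (t := fun z => t z a)).
Qed.

(** The same Christoffel terms, with opposite signs, complete the derivative of [t] to [cov4] and
    the derivatives of the arguments to [D]. *)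
Lemma pd_con4 (t : 'rV[R]_n -> 'I_n -> 'I_n -> 'I_n -> 'I_n -> R) s1 s2 s3 s4 al y :
  (forall a b c d, smooth_on U (fun x => t x a b c d)) -> vec s1 -> vec s2 -> vec s3 -> vec s4 -> V y ->
  pd al (fun z => con4 (t (f z)) (s1 z) (s2 z) (s3 z) (s4 z)) y =
  \sum_e F y al e * con4 (cov4 g t (f y) e) (s1 y) (s2 y) (s3 y) (s4 y)
  + con4 (t (f y)) (D s1 y al) (s2 y) (s3 y) (s4 y) + con4 (t (f y)) (s1 y) (D s2 y al) (s3 y) (s4 y)
  + con4 (t (f y)) (s1 y) (s2 y) (D s3 y al) (s4 y) + con4 (t (f y)) (s1 y) (s2 y) (s3 y) (D s4 y al).
Proof.
move=> st ss1 ss2 ss3 ss4 Vy; have Uy := fVU Vy.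
have st' a b c d : smooth_on V (fun z => t (f z) a b c d).
  exact: (smooth_on_sub Hf (p := fun x => t x a b c d)).
pose d' (s : 'rV[R]_k -> 'I_n -> R) := fun a => pd al (fun z => s z a) y.
have P := pd_con4f (t := fun z => t (f z)) al st' ss1 ss2 ss3 ss4 Vy.
rewrite {}P.
pose A m a := \sum_b F y al b * Gamma g (f y) m b a.
have Q : con4 (fun a b c d => pd al (fun z => t (f z) a b c d) y) (s1 y) (s2 y) (s3 y) (s4 y) =
   \sum_e F y al e * con4 (cov4 g t (f y) e) (s1 y) (s2 y) (s3 y) (s4 y)
   + con4 (fun a b c d => \sum_m A m a * t (f y) m b c d) (s1 y) (s2 y) (s3 y) (s4 y)
   + con4 (fun a b c d => \sum_m A m b * t (f y) a m c d) (s1 y) (s2 y) (s3 y) (s4 y)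
   + con4 (fun a b c d => \sum_m A m c * t (f y) a b m d) (s1 y) (s2 y) (s3 y) (s4 y)
   + con4 (fun a b c d => \sum_m A m d * t (f y) a b c m) (s1 y) (s2 y) (s3 y) (s4 y).
  rewrite -con4_act_in -!con4D; apply: eq_con4 => a b c d.
  rewrite (pd_sub Hf (p := fun x => t x a b c d)) //.
  have S c0 (q : 'I_n -> R) : \sum_m A m c0 * q m = \sum_e F y al e * \sum_m Gamma g (f y) m e c0 * q m.
    rewrite /A; under eq_bigr do rewrite mulr_suml.
    by rewrite exchange_big; apply: eq_bigr => e _; rewrite mulr_sumr; apply: eq_bigr => m _; rewrite mulrA.
  rewrite !S -!big_split; apply: eq_bigr => e _; rewrite cov4E /=; ring.
have E s : D s y al = fun m => \sum_a A m a * s y a + d' s m.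
  by rewrite Dal_act; apply/funext => a; rewrite addrC.
rewrite Q con4_act1 con4_act2 con4_act3 con4_act4.
rewrite !E con4_add1 con4_add2 con4_add3 con4_add4; ring.
Qed.

End Along.

HB.lock Definition ctr2 (R : comPzRingType) (m : nat) (M : 'M[R]_m) (t : 'I_m -> 'I_m -> 'I_m -> 'I_m -> R) : R :=
  ctr M (fun i j => ctr M (fun p q => t i j p q)).

Section DoubleContraction.
Context {R : comPzRingType} {m : nat}.
Variable M : 'M[R]_m.
Hypothesis sM : forall i j, M i j = M j i.
Implicit Types (t : 'I_m -> 'I_m -> 'I_m -> 'I_m -> R).

Lemma ctr2E t : ctr2 M t = ctr M (fun i j => ctr M (fun p q => t i j p q)).
Proof. by rewrite unlock. Qed.

Lemma eq_ctr2 t t' : (forall i j p q, t i j p q = t' i j p q) -> ctr2 M t = ctr2 M t'.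
Proof. by move=> E; congr ctr2; do 4!apply/funext=> ?; exact: E. Qed.

Lemma ctr2_swap1 t : ctr2 M t = ctr2 M (fun i j p q => t j i p q).
Proof. by rewrite !ctr2E ctr_sym. Qed.

Lemma ctr2_swap2 t : ctr2 M t = ctr2 M (fun i j p q => t i j q p).
Proof. by rewrite !ctr2E; apply: eq_ctr => i j; rewrite ctr_sym. Qed.

Lemma ctr2_exch t : ctr2 M t = ctr2 M (fun i j p q => t p q i j).
Proof. by rewrite !ctr2E ctr_exch. Qed.

Lemma ctr2D t t' : ctr2 M (fun i j p q => t i j p q + t' i j p q) = ctr2 M t + ctr2 M t'.
Proof. by rewrite !ctr2E -ctrD; apply: eq_ctr => i j; rewrite ctrD. Qed.

Lemma ctr2N t : ctr2 M (fun i j p q => - t i j p q) = - ctr2 M t.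
Proof. by rewrite !ctr2E -ctrN; apply: eq_ctr => i j; rewrite ctrN. Qed.

Lemma ctr2Z c t : ctr2 M (fun i j p q => c * t i j p q) = c * ctr2 M t.
Proof. by rewrite !ctr2E -ctrZ; apply: eq_ctr => i j; rewrite ctrZ. Qed.

Lemma ctr2_prod (s t : 'I_m -> 'I_m -> R) : ctr2 M (fun i j p q => s i j * t p q) = ctr M s * ctr M t.
Proof. by rewrite ctr2E -ctrZr; apply: eq_ctr => i j; rewrite ctrZ. Qed.

End DoubleContraction.

(** * The Codazzi equation *)

Section Codazzi.
Context {R : realType} {k n : nat}.
Variables (V : set 'rV[R]_k) (U : set 'rV[R]_n) (g : 'rV[R]_n -> 'M[R]_n) (f : 'rV[R]_k -> 'rV[R]_n).
Hypotheses (Hf : immersed_in V U g f) (k0 : (0 < k)%N).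
Let Hg : metric_on U g. Proof. by case: Hf. Qed.
Let oV : open V. Proof. by case: Hf. Qed.
Let fVU : forall y, V y -> U (f y). Proof. by case: Hf. Qed.
Let Hh : metric_on V (Ind g f). Proof. exact: Ind_metric Hf. Qed.
Let hsym y (Vy : V y) := metric_sym Hh Vy.
Implicit Types (y : 'rV[R]_k) (al be ga de e : 'I_k) (a b c d : 'I_n).
Implicit Types (s t : 'rV[R]_k -> 'I_n -> R) (u v w xi : 'I_n -> R).

Local Notation F := (Frm f).
Local Notation h := (Ind g f).
Local Notation "<< v , w >>_ y" := (inn (g (f y)) v w) (at level 10, y at level 8).
Local Notation D := (Dal g f).
Local Notation L := (Sff g f).
Local Notation L0 := (Sff0 g f).
Local Notation H := (Hm g f).
Local Notation Gh := (@Gamma R k (Ind g f)).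
Local Notation vec s := (forall a, smooth_on V (fun z => s z a)).

(** Connection matrix, in the direction [al], of the ambient tangent bundle pulled back by f. *)
Definition conmat y al a c := \sum_b F y al b * Gamma g (f y) a b c.

Lemma smooth_conmat al a c : smooth_on V (fun y => conmat y al a c).
Proof.
have sG p q r := smooth_Gsub Hf p q r; have sF p q := smooth_Frm Hf p q.
by rewrite /conmat; smooth.
Qed.

Lemma Dal_conmat s y al a : D s y al a = pd al (fun z => s z a) y + \sum_c conmat y al a c * s y c.
Proof. by rewrite Dal_act /conn_act /conmat. Qed.

(** The curvature of a pulled-back connection is the pulled-back curvature: second derivatives of f
    are symmetric in [al] and [be] and drop out. The minus sign arises because [Rup] is the
    curvature on covectors, whereas [conmat] acts on vectors. *)
Lemma conmat_curv y al be a c : V y ->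
  pd al (fun z => conmat z be a c) y - pd be (fun z => conmat z al a c) y
  + \sum_m conmat y al a m * conmat y be m c - \sum_m conmat y be a m * conmat y al m c
  = - \sum_e \sum_b F y al e * F y be b * Rup g (f y) e b c a.
Proof.
move=> Vy; have Uy := fVU Vy.
have sG p q r := smooth_Gsub Hf p q r; have sF p q := smooth_Frm Hf p q.
have P p q : pd p (fun z => conmat z q a c) y = \sum_b pd p (fun z => F z q b) y * Gamma g (f y) a b c
    + \sum_e \sum_b F y p e * F y q b * pd e (fun x => Gamma g x a b c) (f y).
  rewrite /conmat (pd_sum oV) //; last by move=> b _; smooth.
  rewrite [X in _ + X]exchange_big -big_split; apply: eq_bigr => b _.
  rewrite (pdM oV) // (pd_sub Hf (p := fun x => Gamma g x a b c)) //; last exact: (smooth_Gamma Hg).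
  by rewrite mulr_sumr; congr (_ + _); apply: eq_bigr => e _; ring.
have Q p q : \sum_m conmat y p a m * conmat y q m c =
    \sum_e \sum_b F y p e * F y q b * \sum_m Gamma g (f y) a e m * Gamma g (f y) m b c.
  rewrite /conmat; under eq_bigr do rewrite mulr_suml.
  rewrite exchange_big; apply: eq_bigr => e _.
  under eq_bigr do rewrite mulr_sumr.
  rewrite exchange_big; apply: eq_bigr => b _; rewrite mulr_sumr; apply: eq_bigr => m _; ring.
have S p q : \sum_b pd p (fun z => F z q b) y * Gamma g (f y) a b c =
    \sum_b pd q (fun z => F z p b) y * Gamma g (f y) a b c.
  by apply: eq_bigr => b _; rewrite (Frm_sym_pd Hf).
have X (T : 'I_n -> 'I_n -> R) : \sum_e \sum_b F y be e * F y al b * T e b =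
    \sum_e \sum_b F y al e * F y be b * T b e.
  by rewrite exchange_big; apply: eq_bigr => e _; apply: eq_bigr => b _; rewrite [F y be _ * _]mulrC.
rewrite !P !Q (S be al) !X.
transitivity (\sum_e \sum_b F y al e * F y be b * (pd e (fun x => Gamma g x a b c) (f y)
   - pd b (fun x => Gamma g x a e c) (f y) + \sum_m Gamma g (f y) a e m * Gamma g (f y) m b c
   - \sum_m Gamma g (f y) a b m * Gamma g (f y) m e c)).
  have K (A1 A2 A3 A4 : 'I_n -> 'I_n -> R) Z :
      Z + \sum_e \sum_b F y al e * F y be b * A1 e b - (Z + \sum_e \sum_b F y al e * F y be b * A2 e b)
      + \sum_e \sum_b F y al e * F y be b * A3 e b - \sum_e \sum_b F y al e * F y be b * A4 e b =
      \sum_e \sum_b F y al e * F y be b * (A1 e b - A2 e b + A3 e b - A4 e b).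
    rewrite opprD addrACA subrr add0r -sumrB -big_split -sumrB; apply: eq_bigr => e _.
    rewrite -sumrB -big_split -sumrB; apply: eq_bigr => b _ /=; ring.
  exact: (K (fun (e b : 'I_n) => pd e (fun x => Gamma g x a b c) (f y)) (fun (e b : 'I_n) => pd b (fun x => Gamma g x a e c) (f y))
    (fun (e b : 'I_n) => \sum_m Gamma g (f y) a e m * Gamma g (f y) m b c)
    (fun (e b : 'I_n) => \sum_m Gamma g (f y) a b m * Gamma g (f y) m e c)).
rewrite -sumrN; apply: eq_bigr => e _; rewrite -sumrN; apply: eq_bigr => b _.
rewrite (RupE Hg) //.
have C p q : \sum_e0 Gamma g (f y) e0 p c * Gamma g (f y) a q e0 = \sum_m Gamma g (f y) a q m * Gamma g (f y) m p c.
  by apply: eq_bigr => m _; rewrite mulrC.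
rewrite !C; ring.
Qed.

Lemma curvature_along s y al be w : vec s -> V y ->
  << D (fun z => D s z be) y al, w >>_y - << D (fun z => D s z al) y be, w >>_y =
  - con4 (Rm g (f y)) (F y al) (F y be) (s y) w.
Proof.
move=> ss Vy; have sC p q r := smooth_conmat p q r.
have sD p a : smooth_on V (fun z => D s z p a) by apply: (smooth_Dal Hf).
have E p q a : D (fun z => D s z q) y p a = pd p (pd q (fun z => s z a)) y
   + \sum_c pd p (fun z => conmat z q a c) y * s y c + \sum_c conmat y q a c * pd p (fun z => s z c) y
   + \sum_c conmat y p a c * pd q (fun z => s z c) y
   + \sum_c (\sum_m conmat y p a m * conmat y q m c) * s y c.
  rewrite Dal_conmat.
  have -> : pd p (fun z => D s z q a) y = pd p (pd q (fun z => s z a)) y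
     + \sum_c pd p (fun z => conmat z q a c) y * s y c + \sum_c conmat y q a c * pd p (fun z => s z c) y.
    rewrite (_ : (fun z => D s z q a) = fun z => pd q (fun z => s z a) z + \sum_c conmat z q a c * s z c); last first.
      by apply/funext => z; rewrite Dal_conmat.
    rewrite (pdD oV) //; try smooth.
    rewrite (pd_sum oV) //; last by move=> c _; smooth.
    rewrite -addrA -big_split; congr (_ + _); apply: eq_bigr => c _.
    by rewrite (pdM oV).
  have -> : \sum_c conmat y p a c * D s y q c = \sum_c conmat y p a c * pd q (fun z => s z c) y
    + \sum_c (\sum_m conmat y p a m * conmat y q m c) * s y c.
    under eq_bigr do rewrite Dal_conmat mulrDr.
    rewrite big_split; congr (_ + _); under eq_bigr do rewrite mulr_sumr.
    under [RHS]eq_bigr do rewrite mulr_suml.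
    by rewrite exchange_big; apply: eq_bigr => c _; apply: eq_bigr => m _; rewrite mulrA.
  ring.
have G a : D (fun z => D s z be) y al a - D (fun z => D s z al) y be a =
   - \sum_c (\sum_e \sum_b F y al e * F y be b * Rup g (f y) e b c a) * s y c.
  rewrite !E (pdC oV al be) //.
  transitivity (\sum_c (pd al (fun z => conmat z be a c) y - pd be (fun z => conmat z al a c) y
  + \sum_m conmat y al a m * conmat y be m c - \sum_m conmat y be a m * conmat y al m c) * s y c).
    under [RHS]eq_bigr do rewrite !mulrDl !mulNr.
    rewrite !big_split /= !sumrN; ring.
  by rewrite -sumrN; apply: eq_bigr => c _; rewrite conmat_curv // mulNr.
have -> : << D (fun z => D s z be) y al, w >>_y - << D (fun z => D s z al) y be, w >>_y =
   << fun a => - \sum_c (\sum_e \sum_b F y al e * F y be b * Rup g (f y) e b c a) * s y c, w >>_y.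
  by rewrite -innNl -innDl; congr inn; apply/funext => a; rewrite G.
rewrite innNl; congr (- _); rewrite inn_suml.
under eq_bigr do rewrite innZlr inn_suml mulr_sumr.
under eq_bigr do under eq_bigr do rewrite inn_suml mulr_sumr.
rewrite exchange_big con4E; apply: eq_bigr => e _.
rewrite exchange_big; apply: eq_bigr => b _; apply: eq_bigr => c _.
rewrite innZl innE ctrE exchange_big !mulr_sumr; apply: eq_bigr => d _.
rewrite RmE !mulr_suml !mulr_sumr; apply: eq_bigr => m _; ring.
Qed.

Lemma DalD s t y al : vec s -> vec t -> V y ->
  D (fun z a => s z a + t z a) y al = fun a => D s y al a + D t y al a.
Proof.
move=> ss st Vy; apply/funext => a; rewrite !Dal_conmat (pdD oV) // sumMD; ring.
Qed.

Lemma DalZ (c : 'rV[R]_k -> R) s y al : smooth_on V c -> vec s -> V y ->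
  D (fun z a => c z * s z a) y al = fun a => pd al c y * s y a + c y * D s y al a.
Proof.
move=> sc ss Vy; apply/funext => a; rewrite !Dal_conmat (pdM oV) // sumMZ; ring.
Qed.

Lemma Dal_sum (I : finType) (p : I -> 'rV[R]_k -> 'I_n -> R) y al : (forall i, vec (p i)) -> V y ->
  D (fun z a => \sum_i p i z a) y al = fun a => \sum_i D (p i) y al a.
Proof.
move=> sp Vy; apply/funext => a; rewrite !Dal_conmat (pd_sum oV) //.
under [X in _ + X]eq_bigr do rewrite mulr_sumr.
by rewrite exchange_big -big_split; apply: eq_bigr => i _; rewrite Dal_conmat.
Qed.

(* The covariant derivative of L0 in the direction e, up to its tangential part. *)
Definition nablaSff0 y e al be : 'I_n -> R := fun a => D (fun z => L0 z al be) y e a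
  - \sum_p Gh y p e al * L0 y p be a - \sum_p Gh y p e be * L0 y al p a.

(* For [xi] normal, the pairing of D_al with [xi]. *)
Definition pairD y al xi := con2 (Psch g (f y)) (F y al) xi - << D H y al, xi >>_y.
Definition WeylF y al be ga xi := con4 (Weyl g (f y)) (F y al) (F y be) (F y ga) xi.

Lemma nablaSff0_sym y e al be : V y -> nablaSff0 y e al be = nablaSff0 y e be al.
Proof.
move=> Vy; apply/funext => a; rewrite /nablaSff0.
have -> : D (fun z => L0 z al be) y e a = D (fun z => L0 z be al) y e a.
  rewrite !Dal_conmat (Sff0_sym Hf al be Vy); congr (_ + _); apply: (pd_eq oV) => // z /set_mem Vz.
  by rewrite (Sff0_sym Hf).
rewrite addrAC; congr (_ - _ - _); apply: eq_bigr => p _; congr (_ * _);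
  by rewrite (Sff0_sym Hf).
Qed.

Lemma inn_nablaSff0 y e al be xi : << nablaSff0 y e al be, xi >>_y = << D (fun z => L0 z al be) y e, xi >>_y
  - \sum_p Gh y p e al * << L0 y p be, xi >>_y - \sum_p Gh y p e be * << L0 y al p, xi >>_y.
Proof.
rewrite /nablaSff0 !innDl !innNl !inn_suml; congr (_ - _ - _); by apply: eq_bigr => p _; rewrite innZl.
Qed.

(** For a fixed ambient component a, L0 is an intrinsic 2-tensor, so its covariant derivative is
    trace-free along with it; the remaining [conmat] terms are again traces of L0. *)
Lemma tr_nablaSff0 y e a : V y -> ctr (gi h y) (fun al be => nablaSff0 y e al be a) = 0.
Proof.
move=> Vy; have sL p q b := smooth_Sff0 Hf p q b.
have T0 (b : 'I_n) : ctr (gi h y) (fun al be => L0 y al be b) = 0 by exact: (tr_Sff0 Hf).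
have T1 : ctr (gi h y) (cov2 h (fun z al be => L0 z al be a) y e) = 0.
  rewrite -(pd_trace Hh) // -[RHS](pd_cst 0 e y); apply: (pd_eq oV) => // z /set_mem Vz.
  exact: (tr_Sff0 Hf).
rewrite (@eq_ctr _ _ _ _ (fun al be => cov2 h (fun z al be => L0 z al be a) y e al be
   + \sum_c conmat y e a c * L0 y al be c)); last first.
  by move=> al be; rewrite /nablaSff0 Dal_conmat cov2E; ring.
by rewrite ctrD T1 add0r ctr_sum big1 // => c _; rewrite ctrZ T0 mulr0.
Qed.

Lemma con2_met y u v : con2 (g (f y)) u v = << u, v >>_y.
Proof. by rewrite inn_ev con2.unlock. Qed.

Lemma con4_Rm y al be ga xi : V y -> (forall de, << F y de, xi >>_y = 0) ->
  con4 (Rm g (f y)) (F y al) (F y be) (F y ga) xi = WeylF y al be ga xi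
  + con2 (Psch g (f y)) (F y be) xi * h y al ga - con2 (Psch g (f y)) (F y al) xi * h y be ga.
Proof.
move=> Vy X; rewrite (@eq_con4 _ _ _ (fun a b c d => Weyl g (f y) a b c d
    + Psch g (f y) a c * g (f y) b d + g (f y) a c * Psch g (f y) b d
    + - (Psch g (f y) a d * g (f y) b c) + - (g (f y) a d * Psch g (f y) b c))); last first.
  by move=> a b c d; rewrite WeylE; ring.
rewrite !con4D !con4N !con4_prod1 !con4_prod2 !con2_met !X !IndE /WeylF; ring.
Qed.

(** [curvature_along] is applied to a coordinate field and paired with a normal vector. Splitting L
    into L0 and the part h H, and [Rm] into Weyl and Schouten parts, the Schouten terms and the
    derivatives of H unite in [pairD]. *)
Lemma codazzi y al be ga xi : V y -> (forall de, << F y de, xi >>_y = 0) ->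
  << nablaSff0 y al be ga, xi >>_y - << nablaSff0 y be al ga, xi >>_y =
  - WeylF y al be ga xi + h y be ga * pairD y al xi - h y al ga * pairD y be xi.
Proof.
move=> Vy X.
have sL p q b := smooth_Sff Hf p q b; have sL0 p q b := smooth_Sff0 Hf p q b.
have sH b := smooth_Hm Hf b; have sF p b := smooth_Frm Hf p b.
have sh p q := smooth_Ind Hf p q; have sGh p q r := smooth_Gamma Hh p q r.
have X' v : << v, xi >>_y = << xi, v >>_y by apply: (dt_sym Hf).
have := curvature_along al be xi (sF ga) Vy.
(* The Gauss formula is inserted twice; every term along the frame is lost in the pairing with
   [xi]. *)
have E p q : << D (fun z => D (fun z => F z ga) z q) y p, xi >>_y =
    << D (fun z => L z q ga) y p, xi >>_y + \sum_c Gh y c q ga * << L y p c, xi >>_y.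
  have -> : D (fun z => D (fun z => F z ga) z q) y p =
      D (fun z a => \sum_c Gh z c q ga * F z c a + L z q ga a) y p.
    apply/funext => a; rewrite !Dal_conmat; congr (_ + _).
      by apply: (pd_eq oV) => // z /set_mem Vz; rewrite (Dal_Frm Hf).
    by apply: eq_bigr => c _; rewrite (Dal_Frm Hf).
  rewrite DalD // => [|a]; last by smooth.
  rewrite Dal_sum // => [|c a]; last by smooth.
  rewrite innDl addrC inn_suml; congr (_ + _); apply: eq_bigr => c _.
  rewrite DalZ // innDl !innZl X mulr0 add0r; congr (_ * _).
  rewrite (_ : D (fun z => F z c) y p = fun a => \sum_m Gh y m p c * F y m a + L y p c a); last first.
    by apply/funext => a; rewrite (Dal_Frm Hf).
  by rewrite innDl inn_suml big1 ?add0r // => m _; rewrite innZl X mulr0.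
rewrite !E con4_Rm //.
have G p q : << D (fun z => L z q ga) y p, xi >>_y = << D (fun z => L0 z q ga) y p, xi >>_y
   + pd p (fun z => h z q ga) y * << H y, xi >>_y + h y q ga * << D H y p, xi >>_y.
  have -> : D (fun z => L z q ga) y p = D (fun z a => L0 z q ga a + h z q ga * H z a) y p.
    apply/funext => a; rewrite !Dal_conmat Sff_fun; congr (_ + _).
    by congr (pd _ _ _); apply/funext => z; rewrite Sff_fun.
  rewrite DalD // => [|a]; last by smooth.
  by rewrite DalZ // !innDl !innZl addrA.
have Q (p c : 'I_k) : << L y p c, xi >>_y = << L0 y p c, xi >>_y + h y p c * << H y, xi >>_y.
  by rewrite Sff_fun innDl innZl.
have S p q : \sum_c Gh y c q ga * << L y p c, xi >>_y = \sum_c Gh y c q ga * << L0 y p c, xi >>_y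
   + << H y, xi >>_y * \sum_c Gh y c q ga * h y p c.
  by rewrite mulr_sumr -big_split; apply: eq_bigr => c _; rewrite Q /=; ring.
rewrite !G !S !(metric_compat Hh) // !inn_nablaSff0 /pairD.
have T p q r : \sum_d Gh y d p q * h y d r = \sum_d Gh y d q p * h y d r.
  by apply: eq_bigr => d _; rewrite (christoffel_sym Hh).
have T2 p q : \sum_d Gh y d p q * << L0 y d ga, xi >>_y = \sum_d Gh y d q p * << L0 y d ga, xi >>_y.
  by apply: eq_bigr => d _; rewrite (christoffel_sym Hh).
have T3 p q r : \sum_d Gh y d p q * h y r d = \sum_d Gh y d p q * h y d r.
  by apply: eq_bigr => d _; rewrite (hsym Vy r).
have T4 p q r : \sum_d Gh y d p q * h y r d = \sum_d Gh y d q p * h y r d.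
  by apply: eq_bigr => d _; rewrite (christoffel_sym Hh).
rewrite (T be al ga) (T2 be al) => C.
apply/eqP; rewrite -subr_eq0; apply/eqP; move: C => /eqP; rewrite -subr_eq0 => /eqP C.
apply: (etrans _ C); ring.
Qed.

End Codazzi.

(** * Divergence of the Fialkow tensor *)

HB.lock Definition con5 (R : comPzRingType) (n : nat) (t : 'I_n -> 'I_n -> 'I_n -> 'I_n -> 'I_n -> R)
    (u v w z r : 'I_n -> R) : R := ev (fun a => con4 (t a) v w z r) u.

Section FiveSlots.
Context {R : comPzRingType} {n : nat}.
Implicit Types (u v w z r : 'I_n -> R) (t : 'I_n -> 'I_n -> 'I_n -> 'I_n -> 'I_n -> R).

Lemma eq_con5 t t' u v w z r : (forall e a b c d, t e a b c d = t' e a b c d) ->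
  con5 t u v w z r = con5 t' u v w z r.
Proof. by move=> E; congr con5; do 5!apply/funext=> ?; exact: E. Qed.

Lemma con5D t t' u v w z r : con5 (fun e a b c d => t e a b c d + t' e a b c d) u v w z r =
  con5 t u v w z r + con5 t' u v w z r.
Proof. by rewrite con5.unlock; under eq_fun do rewrite con4D; rewrite evDl. Qed.

Lemma con5N t u v w z r : con5 (fun e a b c d => - t e a b c d) u v w z r = - con5 t u v w z r.
Proof. by rewrite con5.unlock; under eq_fun do rewrite con4N; rewrite evNl. Qed.

Lemma con5_s12 t u v w z r : con5 t u v w z r = con5 (fun e a b c d => t a e b c d) v u w z r.
Proof. by rewrite con5.unlock con4.unlock; exact: ev_exch. Qed.

Lemma con5_s23 t u v w z r : con5 t u v w z r = con5 (fun e a b c d => t e b a c d) u w v z r.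
Proof. by rewrite con5.unlock; under eq_fun do rewrite con4_s12. Qed.

Lemma con5_s34 t u v w z r : con5 t u v w z r = con5 (fun e a b c d => t e a c b d) u v z w r.
Proof. by rewrite con5.unlock; under eq_fun do rewrite con4_s23. Qed.

Lemma con5_s45 t u v w z r : con5 t u v w z r = con5 (fun e a b c d => t e a b d c) u v w r z.
Proof. by rewrite con5.unlock; under eq_fun do rewrite con4_s34. Qed.

Variables (s : 'I_n -> 'I_n -> 'I_n -> R) (q : 'I_n -> 'I_n -> R).

Lemma con5_prod_ac u v w z r :
  con5 (fun e a b c d => s e a c * q b d) u v w z r = con3 s u v z * con2 q w r.
Proof.
rewrite con5.unlock; under eq_fun do rewrite con4_prod1.
by rewrite evZlr mulrC con3.unlock.
Qed.

Lemma con5_prod_ad u v w z r :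
  con5 (fun e a b c d => s e a d * q b c) u v w z r = con3 s u v r * con2 q w z.
Proof. by rewrite con5_s45 con5_prod_ac. Qed.

Lemma con5_prod_bd u v w z r :
  con5 (fun e a b c d => s e b d * q a c) u v w z r = con3 s u w r * con2 q v z.
Proof. by rewrite con5_s23 con5_prod_ad. Qed.

Lemma con5_prod_bc u v w z r :
  con5 (fun e a b c d => s e b c * q a d) u v w z r = con3 s u w z * con2 q v r.
Proof. by rewrite con5_s23 con5_prod_ac. Qed.

End FiveSlots.

Section SlotLinearity.
Context {R : comPzRingType} {n : nat}.
Implicit Types (u v w z p q : 'I_n -> R) (r : R).

Lemma con4_scale4 t u v w r z : con4 t u v w (fun a => r * z a) = r * con4 t u v w z.
Proof.
rewrite con4.unlock con3.unlock con2.unlock.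
rewrite -evZl; congr ev; apply/funext => a; rewrite -evZl; congr ev; apply/funext => b.
by rewrite -evZl; congr ev; apply/funext => c; rewrite evZr.
Qed.

Lemma con4_ctr4 m (M : 'M[R]_m) t u v w (z : 'I_m -> 'I_m -> 'I_n -> R) :
  con4 t u v w (fun a => ctr M (fun i j => z i j a)) = ctr M (fun i j => con4 t u v w (z i j)).
Proof.
rewrite con4.unlock con3.unlock con2.unlock.
rewrite -ev_ctrl; congr ev; apply/funext => a; rewrite -ev_ctrl; congr ev; apply/funext => b.
by rewrite -ev_ctrl; congr ev; apply/funext => c; rewrite ev_ctrr.
Qed.

Lemma con3_add1 t p q v w : con3 t (fun a => p a + q a) v w = con3 t p v w + con3 t q v w.
Proof. by rewrite con3.unlock evDr. Qed.

Lemma con3_scale1 t r p v w : con3 t (fun a => r * p a) v w = r * con3 t p v w.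
Proof. by rewrite con3.unlock evZr. Qed.

Lemma con3_ctr1 m (M : 'M[R]_m) t (p : 'I_m -> 'I_m -> 'I_n -> R) v w :
  con3 t (fun a => ctr M (fun i j => p i j a)) v w = ctr M (fun i j => con3 t (p i j) v w).
Proof. by rewrite con3.unlock ev_ctrr. Qed.

Lemma con3_ev t u v w z : con3 (fun a b c => ev (t a b c) z) u v w = con4 t u v w z.
Proof. by rewrite con4.unlock con3.unlock con2.unlock. Qed.

Lemma con2_ev1 t z u v : con2 (fun a b => ev (fun e => t e a b) z) u v = con3 t z u v.
Proof. by rewrite con3_s12 con3_s23 con3.unlock con2.unlock. Qed.

Lemma con2_ev24 t z u v : con2 (fun a b => ev (fun e => ev (t a e b) z) z) u v = con4 t u z v z.
Proof. by rewrite con4_s23 con4.unlock con3.unlock con2.unlock. Qed.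

End SlotLinearity.

Section Divergence.
Context {R : realType} {k n : nat}.
Variables (V : set 'rV[R]_k) (U : set 'rV[R]_n) (g : 'rV[R]_n -> 'M[R]_n) (f : 'rV[R]_k -> 'rV[R]_n).
Hypotheses (Hf : immersed_in V U g f) (k0 : (0 < k)%N).
Let Hg : metric_on U g. Proof. by case: Hf. Qed.
Let oV : open V. Proof. by case: Hf. Qed.
Let fVU : forall y, V y -> U (f y). Proof. by case: Hf. Qed.
Let gsym : forall x, U x -> forall a b, g x a b = g x b a. Proof. by case: Hg. Qed.
Let Hh : metric_on V (Ind g f). Proof. exact: Ind_metric Hf. Qed.
Let hsym y (Vy : V y) := metric_sym Hh Vy.
Let hcmet y (Vy : V y) := ctr_met (hsym Vy) (gi_sym Hh Vy) (giK Hh Vy).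
Let hdim y (Vy : V y) := ctr_dim (hsym Vy) (giK Hh Vy).
Implicit Types (y : 'rV[R]_k) (al be ga de e : 'I_k) (a b c d : 'I_n).
Implicit Types (s t : 'rV[R]_k -> 'I_n -> R) (u v w xi : 'I_n -> R).

Local Notation F := (Frm f).
Local Notation h := (Ind g f).
Local Notation "<< v , w >>_ y" := (inn (g (f y)) v w) (at level 10, y at level 8).
Local Notation D := (Dal g f).
Local Notation L := (Sff g f).
Local Notation L0 := (Sff0 g f).
Local Notation H := (Hm g f).
Local Notation Gh := (@Gamma R k (Ind g f)).
Local Notation vec s := (forall a, smooth_on V (fun z => s z a)).
Local Notation QL := (nablaSff0 g f).
Local Notation DD := (pairD g f).
Local Notation WX := (WeylF g f).

Definition CotF y al be ga := con3 (Cot g (f y)) (F y al) (F y be) (F y ga).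
Definition sff0sq y al ga := ctr (gi h y) (fun be de => << L0 y be al, L0 y de ga >>_y).
Definition weyltr y al ga := ctr (gi h y) (fun be de => WX y al be ga (F y de)).
(* Its trace is 2(k-1)G. *)
Definition fialkow y al ga := sff0sq y al ga - weyltr y al ga.
Definition cotT y ga := ctr (gi h y) (fun be de => CotF y be ga de).
Definition weylH y ga := ctr (gi h y) (fun be de => WX y be ga de (H y)).
Definition pairDL y ga := ctr (gi h y) (fun be de => DD y be (L0 y de ga)).
Definition calIform y ga := cotT y ga - weylH y ga - pairDL y ga.

Lemma WeylF_asym12 y al be ga xi : V y -> WX y al be ga xi = - WX y be al ga xi.
Proof.
move=> Vy; rewrite /WeylF con4_s12 -con4N; apply: eq_con4 => a b c d.
by rewrite (Weyl_asym12 (U := U)) //; exact: fVU.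
Qed.

(** By the symmetries of the Weyl tensor a vector in any slot can be moved to the last one, so
    [WeylF] covers all cases with three tangential arguments. *)
Lemma WeylF_slot3 y al be de v : V y ->
  con4 (Weyl g (f y)) (F y al) (F y be) v (F y de) = - WX y al be de v.
Proof.
move=> Vy; rewrite /WeylF con4_s34 -con4N; apply: eq_con4 => a b c d.
by rewrite (Weyl_asym34 Hg) //; exact: fVU.
Qed.

Lemma WeylF_slot2 y al ga de v : V y ->
  con4 (Weyl g (f y)) (F y al) v (F y ga) (F y de) = WX y ga de al v.
Proof.
move=> Vy; rewrite /WeylF con4_pair; apply: eq_con4 => a b c d.
by rewrite (Weyl_pair Hg) //; exact: fVU.
Qed.

Lemma WeylF_slot1 y be ga de v : V y ->
  con4 (Weyl g (f y)) v (F y be) (F y ga) (F y de) = WX y de ga be v.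
Proof.
move=> Vy; rewrite con4_s12 (@eq_con4 _ _ _ (fun a b c d => - Weyl g (f y) a b c d)); last first.
  by move=> a b c d; rewrite (Weyl_asym12 (U := U)) //; exact: fVU.
by rewrite con4N WeylF_slot2 // WeylF_asym12 // opprK.
Qed.

Lemma WeylF_addr y al be ga v w : WX y al be ga (fun a => v a + w a) = WX y al be ga v + WX y al be ga w.
Proof. exact: con4_add4. Qed.

Lemma WeylF_scaler y al be ga (r : R) v : WX y al be ga (fun a => r * v a) = r * WX y al be ga v.
Proof. exact: con4_scale4. Qed.

Lemma WeylF_ctr y al be ga (v : 'I_k -> 'I_k -> 'I_n -> R) :
  WX y al be ga (fun a => ctr (gi h y) (fun p q => v p q a)) = ctr (gi h y) (fun p q => WX y al be ga (v p q)).
Proof. exact: con4_ctr4. Qed.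

Lemma pairD_ctr y al (v : 'I_k -> 'I_k -> 'I_n -> R) :
  DD y al (fun a => ctr (gi h y) (fun p q => v p q a)) = ctr (gi h y) (fun p q => DD y al (v p q)).
Proof.
rewrite /pairD inn_ctrr con2.unlock.
rewrite (_ : ev _ _ = ctr (gi h y) (fun p q => ev (fun a => ev (Psch g (f y) a) (v p q)) (F y al))).
  by rewrite -ctrN -ctrD.
by rewrite -ev_ctrl; congr ev; apply/funext => a; rewrite ev_ctrr.
Qed.

Lemma pairD_scale y al (r : R) v : DD y al (fun a => r * v a) = r * DD y al v.
Proof.
rewrite /pairD innZr con2.unlock (_ : ev _ _ = ev (fun a => r * ev (Psch g (f y) a) v) (F y al)).
  by rewrite evZl; ring.
by congr ev; apply/funext => a; rewrite evZr.
Qed.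

(** The ambient derivative of the Weyl tensor, restricted to tangential arguments; the derivative of
    the restricted tensor by the induced connection is compared with it in [cov4_WeylF]. *)
Definition covWF y e al be ga de :=
  con5 (cov4 g (Weyl g) (f y)) (F y e) (F y al) (F y be) (F y ga) (F y de).

Let sW a b c d : smooth_on U (fun x => Weyl g x a b c d).
Proof. by apply: (smooth_Weyl Hg). Qed.

Lemma covWF_asym12 y e al be ga de : V y -> covWF y e al be ga de = - covWF y e be al ga de.
Proof.
move=> Vy; rewrite /covWF con5_s23 -con5N; apply: eq_con5 => ? ? ? ? ?.
by rewrite (cov4_asym12 Hg _ _ _ _ _ sW) //; [move=> *; apply: (Weyl_asym12 (U := U))|exact: fVU].
Qed.

Lemma covWF_pair y e al be ga de : V y -> covWF y e al be ga de = covWF y e ga de al be.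
Proof.
move=> Vy; rewrite /covWF con5_s34 con5_s23 con5_s45 con5_s34; apply: eq_con5 => ? ? ? ? ?.
by rewrite (cov4_pair Hg) //; [move=> *; apply: (Weyl_pair Hg)|exact: fVU].
Qed.

Lemma covWF_asym34 y e al be ga de : V y -> covWF y e al be ga de = - covWF y e al be de ga.
Proof. by move=> Vy; rewrite covWF_pair // covWF_asym12 // covWF_pair. Qed.

Lemma CotF_asym y al be ga : CotF y al be ga = - CotF y be al ga.
Proof. by rewrite /CotF con3_s12 -con3N; apply: eq_con3 => a b c; rewrite Cot_asym. Qed.

Lemma covWF_bianchi y e al be ga de : V y ->
  covWF y e al be ga de + covWF y al be e ga de + covWF y be e al ga de =
  - (CotF y e al ga * h y be de + CotF y e be de * h y al ga - CotF y e al de * h y be ga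
     - CotF y e be ga * h y al de + CotF y al be ga * h y e de - CotF y al be de * h y e ga).
Proof.
move=> Vy; have Uy := fVU Vy.
have -> : covWF y al be e ga de =
    con5 (fun (e : 'I_n) a b c d => cov4 g (Weyl g) (f y) a b e c d) (F y e) (F y al) (F y be) (F y ga) (F y de).
  by rewrite /covWF con5_s23 con5_s12.
have -> : covWF y be e al ga de =
    con5 (fun (e : 'I_n) a b c d => cov4 g (Weyl g) (f y) b e a c d) (F y e) (F y al) (F y be) (F y ga) (F y de).
  by rewrite /covWF con5_s12 con5_s23.
rewrite /covWF -!con5D.
rewrite (@eq_con5 _ _ _ (fun (e a b c d : 'I_n) => - (Cot g (f y) e a c * g (f y) b d + Cot g (f y) e b d * g (f y) a c
   + - (Cot g (f y) e a d * g (f y) b c) + - (Cot g (f y) e b c * g (f y) a d)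
   + Cot g (f y) a b c * g (f y) e d + - (Cot g (f y) a b d * g (f y) e c)))); last first.
  by move=> p a b c d; rewrite (Weyl_bianchi Hg) // !CotE /covK; ring.
rewrite con5N !con5D !con5N con5_prod_ac con5_prod_bd con5_prod_ad con5_prod_bc.
rewrite [X in _ + X - _](con5_s12 _ (F y e)) (con5_prod_bc (Cot g (f y))).
rewrite (con5_s12 _ (F y e)) (con5_prod_bd (Cot g (f y))) !(con2_met g f) -!IndE /CotF; ring.
Qed.

(** Two tangential contractions of the Bianchi identity: two of its three terms become the same
    divergence, the third minus the gradient of the trace. The trace of [h] is k, whence the factor
    k-2. *)
Lemma tr_covWF y ga : V y ->
  2 * ctr2 (gi h y) (fun e al be de => covWF y e al be ga de)
  - ctr2 (gi h y) (fun al e be de => covWF y ga al be e de) = - (2 * (k%:R - 2)) * cotT y ga.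
Proof.
move=> Vy; have sM := gi_sym Hh Vy; have met := hcmet Vy; have dim := hdim Vy.
set A := ctr2 _ _; set B := ctr2 _ _.
have E1 : ctr2 (gi h y) (fun e al be de => covWF y e ga de al be) = A.
  by apply: eq_ctr2 => i j p q; rewrite covWF_pair.
have E2 : ctr2 (gi h y) (fun e al be de => covWF y ga de e al be) = - B.
  rewrite /B ctr2_swap1 // -ctr2N; apply: eq_ctr2 => i j p q.
  by rewrite covWF_pair // covWF_asym34.
have E3 : ctr2 (gi h y) (fun e al be de => covWF y de e ga al be) = A.
  rewrite /A ctr2_exch ctr2_swap1 // ctr2_swap2 //; apply: eq_ctr2 => i j p q.
  by rewrite covWF_pair // covWF_asym12 // covWF_asym34 // opprK.
have c1 : ctr (gi h y) (fun p q => CotF y p ga q) = cotT y ga by [].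
have c2 : ctr (gi h y) (fun p q => CotF y ga p q) = - cotT y ga.
  by rewrite /cotT -ctrN; apply: eq_ctr => p q; rewrite CotF_asym.
have c3 : ctr (gi h y) (fun p q => CotF y ga q p) = - cotT y ga by rewrite -c2 [RHS]ctr_sym.
transitivity (ctr2 (gi h y) (fun e al be de => covWF y e ga de al be + covWF y ga de e al be + covWF y de e ga al be)).
  by rewrite !ctr2D E1 E2 E3; ring.
rewrite (eq_ctr2 _ (fun i j p q => covWF_bianchi i ga q j p Vy)) ctr2N !ctr2D !ctr2N !ctr2_prod.
have d2 : ctr2 (gi h y) (fun i j p q => CotF y i q p * h y ga j) = - cotT y ga.
  by rewrite ctr2_exch ctr2E -c3; apply: eq_ctr => i j; rewrite met.
have d3 : ctr2 (gi h y) (fun i j p q => CotF y i ga p * h y q j) = cotT y ga.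
  by rewrite ctr2E -c1; apply: eq_ctr => i j; rewrite met.
have d4 : ctr2 (gi h y) (fun i j p q => CotF y i q j * h y ga p) = cotT y ga.
  by rewrite ctr2E -c1; apply: eq_ctr => i j; rewrite met.
have d5 : ctr2 (gi h y) (fun i j p q => CotF y ga q j * h y i p) = - cotT y ga.
  by rewrite ctr2E -c2; apply: eq_ctr => i j; rewrite met.
have d6 : ctr2 (gi h y) (fun i j p q => CotF y ga q p * h y i j) = - cotT y ga * k%:R.
  by rewrite ctr2_exch ctr2_prod c3 dim.
rewrite d2 d3 d4 d5 d6 c1 [X in _ * X]ctr_sym // dim; ring.
Qed.

Lemma inn_nablaSff0r y e al be xi : << xi, QL y e al be >>_y = << xi, D (fun z => L0 z al be) y e >>_y
  - \sum_p Gh y p e al * << xi, L0 y p be >>_y - \sum_p Gh y p e be * << xi, L0 y al p >>_y.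
Proof.
rewrite /nablaSff0 !innDr !innNr !inn_sumr; congr (_ - _ - _); by apply: eq_bigr => p _; rewrite innZr.
Qed.

Let sF p a : smooth_on V (fun y => F y p a). Proof. exact: (smooth_Frm Hf). Qed.
Let sL0 p q a : smooth_on V (fun y => L0 y p q a). Proof. exact: (smooth_Sff0 Hf). Qed.

Lemma cov4_inn_Sff0 y e al be ga de : V y ->
  cov4 h (fun z al be ga de => << L0 z be al, L0 z de ga >>_z) y e al be ga de =
  << QL y e be al, L0 y de ga >>_y + << L0 y be al, QL y e de ga >>_y.
Proof.
move=> Vy; rewrite cov4E (pd_dt Hf) // inn_nablaSff0 inn_nablaSff0r; ring.
Qed.

(** The Gauss formula in each of the four slots: the frame parts are the induced Christoffel terms
    of [cov4], and each slot leaves one term with L, moved to the last slot by the symmetries. *)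
Lemma cov4_WeylF y e al be ga de : V y ->
  cov4 h (fun z al be ga de => WX z al be ga (F z de)) y e al be ga de =
  covWF y e al be ga de + WX y de ga be (L y e al) + WX y ga de al (L y e be)
  - WX y al be de (L y e ga) + WX y al be ga (L y e de).
Proof.
move=> Vy; rewrite cov4E (pd_con4 Hf (t := Weyl g)) //.
have DF p q : D (fun z => F z q) y p = fun a => \sum_m Gh y m p q * F y m a + L y p q a.
  by apply/funext => a; rewrite (Dal_Frm Hf).
rewrite !DF con4_lc1 con4_lc2 con4_lc3 con4_lc4 WeylF_slot1 // WeylF_slot2 // WeylF_slot3 //.
have -> : \sum_m F y e m * con4 (cov4 g (Weyl g) (f y) m) (F y al) (F y be) (F y ga) (F y de) = covWF y e al be ga de.
  by rewrite /covWF con5.unlock evE; apply: eq_bigr => m _; rewrite mulrC.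
rewrite /WeylF; ring.
Qed.

Definition weylL y ga := ctr2 (gi h y) (fun i j p q => WX y i p j (L0 y ga q)).
Definition weylL' y ga := ctr2 (gi h y) (fun i j p q => WX y ga q j (L0 y i p)).

Lemma WeylF_Sff y al be ga p q : WX y al be ga (L y p q) = WX y al be ga (L0 y p q) + h y p q * WX y al be ga (H y).
Proof. by rewrite Sff_fun WeylF_addr WeylF_scaler. Qed.

Lemma tr_WeylH y ga : V y -> ctr (gi h y) (fun p q => WX y ga p q (H y)) = - weylH y ga.
Proof. by move=> Vy; rewrite /weylH -ctrN; apply: eq_ctr => p q; rewrite WeylF_asym12. Qed.

Lemma tr_weylL y ga : V y ->
  ctr2 (gi h y) (fun i j p q => WX y i p j (L y ga q)) = weylL y ga + weylH y ga.
Proof.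
move=> Vy; rewrite (eq_ctr2 _ (fun i j p q => WeylF_Sff y i p j ga q)) ctr2D; congr (_ + _).
by rewrite ctr2E /weylH; apply: eq_ctr => i j; rewrite (hcmet Vy).
Qed.

Lemma tr_weylL' y ga : V y ->
  ctr2 (gi h y) (fun i j p q => WX y ga q j (L y i p)) = weylL' y ga - weylH y ga.
Proof.
move=> Vy; rewrite (eq_ctr2 _ (fun i j p q => WeylF_Sff y ga q j i p)) ctr2D; congr (_ + _).
by rewrite ctr2E -tr_WeylH //; apply: eq_ctr => i j; rewrite (hcmet Vy).
Qed.

(** The mean curvature enters through the trace part of L. It contributes k [weylH] to the
    divergence, where the other two occurrences cancel, and 4 [weylH] to the gradient of the trace,
    of which half is subtracted: this gives the same factor k-2 as [tr_covWF] has for [cotT]. *)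
Lemma div_weyltr y ga : V y ->
  ctr (gi h y) (fun e al => cov2 h weyltr y e al ga) - 2^-1 * ctr (gi h y) (cov2 h weyltr y ga)
  = (k%:R - 2) * (weylH y ga - cotT y ga) + weylL' y ga - weylL y ga.
Proof.
move=> Vy; have sM := gi_sym Hh Vy; have met := hcmet Vy.
have sWF (p q r s : 'I_k) : smooth_on V (fun z => WX z p q r (F z s)).
  by apply: (smooth_con4 Hf (t := fun z => Weyl g (f z))) => // *; apply: (smooth_on_sub Hf (p := fun x => Weyl g x _ _ _ _)).
have E e al ga' : cov2 h weyltr y e al ga' = ctr (gi h y) (fun be de =>
   covWF y e al be ga' de + WX y de ga' be (L y e al) + WX y ga' de al (L y e be)
  + - WX y al be de (L y e ga') + WX y al be ga' (L y e de)).
  rewrite (cov2_trace Hh (t := fun z al be ga de => WX z al be ga (F z de))) //.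
  by apply: eq_ctr => be de; rewrite cov4_WeylF.
have A : ctr (gi h y) (fun e al => cov2 h weyltr y e al ga) =
    ctr2 (gi h y) (fun e al be de => covWF y e al be ga de) + k%:R * weylH y ga + weylL' y ga + weylL y ga.
  rewrite (eq_ctr _ (fun e al => E e al ga)) -ctr2E !ctr2D.
  have a1 : ctr2 (gi h y) (fun i j p q => WX y q ga p (L y i j)) = k%:R * weylH y ga.
    rewrite ctr2_exch ctr2E /weylH -ctrZ [RHS]ctr_sym //; apply: eq_ctr => i j.
    rewrite -WeylF_ctr -WeylF_scaler; congr (WeylF _ _ _ _ _ _ _); apply/funext => a.
    exact: (tr_Sff g f k0).
  have a2 : ctr2 (gi h y) (fun i j p q => - WX y j p q (L y i ga)) = weylL y ga + weylH y ga.
    rewrite -tr_weylL // ctr2_exch ctr2_swap2 //; apply: eq_ctr2 => i j p q.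
    by rewrite WeylF_asym12 // opprK (Sff_sym Hf).
  (* An antisymmetric pair of Weyl indices is contracted with the symmetric L, so the expression
     equals its own negative. *)
  have a3 : ctr2 (gi h y) (fun i j p q => WX y j p ga (L y i q)) = 0.
    have : ctr2 (gi h y) (fun i j p q => WX y j p ga (L y i q)) = - ctr2 (gi h y) (fun i j p q => WX y j p ga (L y i q)).
      rewrite {1}ctr2_exch ctr2_swap1 // ctr2_swap2 // -ctr2N; apply: eq_ctr2 => i j p q.
      by rewrite WeylF_asym12 // (Sff_sym Hf).
    by move/eqP; rewrite -addr_eq0 -mulr2n mulrn_eq0 /= => /eqP.
  rewrite a1 a2 a3 tr_weylL' //; ring.
have B : ctr (gi h y) (cov2 h weyltr y ga) =
    ctr2 (gi h y) (fun al e be de => covWF y ga al be e de) + 4 * (weylL y ga + weylH y ga).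
  rewrite (eq_ctr _ (fun al ep => E ga al ep)) -ctr2E !ctr2D.
  have b1 : ctr2 (gi h y) (fun i j p q => WX y q j p (L y ga i)) = weylL y ga + weylH y ga.
    by rewrite -tr_weylL // ctr2_exch ctr2_swap1 // ctr2_swap2.
  have b2 : ctr2 (gi h y) (fun i j p q => WX y j q i (L y ga p)) = weylL y ga + weylH y ga.
    by rewrite -tr_weylL // ctr2_swap1 // ctr2_swap2.
  have b3 : ctr2 (gi h y) (fun i j p q => - WX y i p q (L y ga j)) = weylL y ga + weylH y ga.
    rewrite -tr_weylL // ctr2_exch; apply: eq_ctr2 => i j p q.
    by rewrite WeylF_asym12 // opprK.
  rewrite b1 b2 b3 tr_weylL //; ring.
rewrite A B.
have := tr_covWF ga Vy => C.
have -> : ctr2 (gi h y) (fun e al be de => covWF y e al be ga de) =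
   2^-1 * ctr2 (gi h y) (fun al e be de => covWF y ga al be e de) - (k%:R - 2) * cotT y ga.
  apply: (mulfI (x := 2)); first by rewrite pnatr_eq0.
  apply/eqP; rewrite -subr_eq0; apply/eqP.
  rewrite -[RHS](subrr (- (2 * (k%:R - 2)) * cotT y ga)) -{1}C; by field.
by field.
Qed.

(** Codazzi is used for both factors: in [A] for the one hit by the divergence, in [B] to compare
    the derivative of the other with the gradient of the trace. The shares -(k-1) and 1 make up the
    coefficient of [pairDL]. *)
Lemma div_sff0sq y ga : V y ->
  ctr (gi h y) (fun e al => cov2 h sff0sq y e al ga) - 2^-1 * ctr (gi h y) (cov2 h sff0sq y ga)
  = - (k%:R - 2) * pairDL y ga + weylL' y ga - weylL y ga.
Proof.
move=> Vy; have sM := gi_sym Hh Vy; have met := hcmet Vy; have dim := hdim Vy.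
have sS (p q r s : 'I_k) : smooth_on V (fun z => << L0 z p q, L0 z r s >>_z) by apply: (smooth_dt Hf).
have E e al ga' : cov2 h sff0sq y e al ga' = ctr (gi h y) (fun be de =>
   << QL y e be al, L0 y de ga' >>_y + << L0 y be al, QL y e de ga' >>_y).
  rewrite (cov2_trace Hh (t := fun z al be ga de => << L0 z be al, L0 z de ga >>_z)) //.
  by apply: eq_ctr => be de; rewrite cov4_inn_Sff0.
have X0 p q de : << F y de, L0 y p q >>_y = 0 by exact: (dt_Frm_Sff0 Hf).
(* Exchanging the contracted derivative index with a slot of L0 leaves a derivative of the trace of
   L0, which vanishes ([a1]); k-1 is the trace of [h] minus the single contraction [a3]. *)
have A : ctr2 (gi h y) (fun i j p q => << QL y i p j, L0 y q ga >>_y) = - weylL y ga - (k%:R - 1) * pairDL y ga.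
  rewrite (@eq_ctr2 _ _ _ _ (fun i j p q => << QL y p i j, L0 y q ga >>_y + - WX y i p j (L0 y q ga)
     + h y p j * DD y i (L0 y q ga) + - (h y i j * DD y p (L0 y q ga)))); last first.
    by move=> i j p q; have := codazzi Hf i p j Vy (X0 q ga) => /eqP; rewrite subr_eq => /eqP ->; ring.
  have a1 : ctr2 (gi h y) (fun i j p q => << QL y p i j, L0 y q ga >>_y) = 0.
    rewrite ctr2_exch ctr2E -[RHS](ctr0 (gi h y)); apply: eq_ctr => i j.
    rewrite (eq_ctr _ (fun p q => dt_sym Hf _ _ Vy)) -inn_ctrr.
    rewrite (_ : (fun a => _) = fun a => 0 * H y a) ?innZr ?mul0r //.
    by apply/funext => a; rewrite mul0r; apply: (tr_nablaSff0 Hf).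
  have a2 : ctr2 (gi h y) (fun i j p q => WX y i p j (L0 y q ga)) = weylL y ga.
    by apply: eq_ctr2 => i j p q; rewrite (Sff0_sym Hf).
  have a3 : ctr2 (gi h y) (fun i j p q => h y p j * DD y i (L0 y q ga)) = pairDL y ga.
    by rewrite ctr2E; apply: eq_ctr => i j; rewrite met.
  rewrite !ctr2D !ctr2N ctr2_prod a1 a2 a3 dim -/(pairDL y ga); ring.
(* Here Codazzi exchanges the indices [i] and [ga]; [b3] vanishes because L0 is trace-free. *)
have B : ctr2 (gi h y) (fun i j p q => << L0 y p j, QL y i q ga >>_y)
   - ctr2 (gi h y) (fun i j p q => << QL y ga p i, L0 y q j >>_y) = weylL' y ga + pairDL y ga.
  rewrite [X in _ - X]ctr2_swap2 // -ctr2N -ctr2D.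
  rewrite (@eq_ctr2 _ _ _ _ (fun i j p q => WX y ga i q (L0 y p j) + h y ga q * DD y i (L0 y p j)
     + - (h y i q * DD y ga (L0 y p j)))); last first.
    move=> i j p q; have := codazzi Hf i ga q Vy (X0 p j).
    rewrite (WeylF_asym12 i ga) // opprK (dt_sym Hf _ _ Vy) => <-.
    by rewrite !(nablaSff0_sym Hf _ q).
  have b1 : ctr2 (gi h y) (fun i j p q => WX y ga i q (L0 y p j)) = weylL' y ga.
    by rewrite /weylL' [RHS]ctr2_exch [RHS]ctr2_swap1.
  have b2 : ctr2 (gi h y) (fun i j p q => h y ga q * DD y i (L0 y p j)) = pairDL y ga.
    by rewrite ctr2E; apply: eq_ctr => i j; rewrite met (Sff0_sym Hf).
  have b3 : ctr2 (gi h y) (fun i j p q => h y i q * DD y ga (L0 y p j)) = 0.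
    rewrite ctr2E (@eq_ctr _ _ _ _ (fun i j => DD y ga (L0 y i j))); last by move=> i j; rewrite met.
    rewrite -pairD_ctr (_ : (fun a => _) = fun a => 0 * H y a) ?pairD_scale ?mul0r //.
    by apply/funext => a; rewrite mul0r; apply: (tr_Sff0 Hf).
  by rewrite !ctr2D ctr2N b1 b2 b3 subr0.
have C : ctr2 (gi h y) (fun i j p q => << L0 y p i, QL y ga q j >>_y) =
   ctr2 (gi h y) (fun i j p q => << QL y ga p i, L0 y q j >>_y).
  rewrite ctr2_swap1 // ctr2_swap2 //; apply: eq_ctr2 => i j p q; exact: (dt_sym Hf).
rewrite (eq_ctr _ (fun e al => E e al ga)) (eq_ctr _ (fun al ep => E ga al ep)) -!ctr2E !ctr2D A C.
have -> : ctr2 (gi h y) (fun i j p q => << L0 y p j, QL y i q ga >>_y) = weylL' y ga + pairDL y ga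
  + ctr2 (gi h y) (fun i j p q => << QL y ga p i, L0 y q j >>_y) by rewrite -B subrK.
by field.
Qed.

Lemma smooth_sff0sq p q : smooth_on V (fun z => sff0sq z p q).
Proof.
apply: smooth_ext => [z|]; first exact: ctrE.
have sS (r s : 'I_k) : smooth_on V (fun z => << L0 z r p, L0 z s q >>_z) by apply: (smooth_dt Hf).
by smooth.
Qed.

Lemma smooth_WeylF p q r (s : 'rV[R]_k -> 'I_n -> R) : vec s -> smooth_on V (fun z => WX z p q r (s z)).
Proof.
by move=> ss; apply: (smooth_con4 Hf (t := fun z => Weyl g (f z))) => // *; apply: (smooth_on_sub Hf (p := fun x => Weyl g x _ _ _ _)).
Qed.

Lemma smooth_weyltr p q : smooth_on V (fun z => weyltr z p q).
Proof.
apply: smooth_ext => [z|]; first exact: ctrE.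
have sS (r s : 'I_k) : smooth_on V (fun z => WX z p r q (F z s)) by apply: smooth_WeylF.
by smooth.
Qed.

Lemma smooth_fialkow p q : smooth_on V (fun z => fialkow z p q).
Proof. by apply: smoothB => //; [exact: smooth_sff0sq|exact: smooth_weyltr]. Qed.

(* Codazzi computes the divergence of [sff0sq] and the second Bianchi identity that of
   [weyltr], up to the same terms [weylL] and [weylL'], which cancel in the difference. *)
Lemma div_fialkow y ga : V y ->
  ctr (gi h y) (fun e al => cov2 h fialkow y e al ga) - 2^-1 * pd ga (fun z => ctr (gi h z) (fialkow z)) y
  = (k%:R - 2) * calIform y ga.
Proof.
move=> Vy; rewrite (pd_trace Hh) //; last exact: smooth_fialkow.
have E e al be : cov2 h fialkow y e al be = cov2 h sff0sq y e al be + - cov2 h weyltr y e al be.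
  rewrite -(cov2N Hh) //; last exact: smooth_weyltr.
  rewrite -(cov2D Hh) //; [exact: smooth_sff0sq|move=> *; apply: smoothN => //; exact: smooth_weyltr].
rewrite (eq_ctr _ (fun e al => E e al ga)) (eq_ctr _ (fun al ep => E ga al ep)) !ctrD !ctrN.
have := div_sff0sq ga Vy => A; have := div_weyltr ga Vy => B.
transitivity ((ctr (gi h y) (fun e al => cov2 h sff0sq y e al ga) - 2^-1 * ctr (gi h y) (cov2 h sff0sq y ga))
  - (ctr (gi h y) (fun e al => cov2 h weyltr y e al ga) - 2^-1 * ctr (gi h y) (cov2 h weyltr y ga))).
  by ring.
rewrite A B /calIform; ring.
Qed.

Lemma tr_WeylF13 y ga p : V y -> ctr (gi h y) (fun be de => WX y be ga de (F y p)) = weyltr y p ga.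
Proof.
move=> Vy; rewrite [RHS]ctr_sym //; last exact: (gi_sym Hh Vy).
apply: eq_ctr => be de.
have -> : WX y be ga de (F y p) = WX y de p be (F y ga) by rewrite -(WeylF_slot2 be de p) //.
rewrite WeylF_asym12 //; apply/eqP; rewrite eqr_oppLR; apply/eqP; exact: WeylF_slot3.
Qed.

Lemma weyltr_sym y al be : V y -> weyltr y al be = weyltr y be al.
Proof.
move=> Vy; rewrite /weyltr ctr_sym; last exact: (gi_sym Hh Vy).
apply: eq_ctr => p q; rewrite /WeylF con4_pair; apply: eq_con4 => a b c d.
by rewrite (Weyl_pair Hg) //; exact: fVU.
Qed.

Lemma sff0sq_sym y al be : V y -> sff0sq y al be = sff0sq y be al.
Proof.
move=> Vy; rewrite /sff0sq ctr_sym; last exact: (gi_sym Hh Vy).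
by apply: eq_ctr => p q; rewrite (dt_sym Hf).
Qed.

Lemma fialkow_sym y al be : V y -> fialkow y al be = fialkow y be al.
Proof. by move=> Vy; rewrite /fialkow sff0sq_sym // weyltr_sym. Qed.

Definition scrD y al a := Nor g f y (fun a => \sum_b gi g (f y) a b * \sum_c Psch g (f y) c b * F y al c) a
  - Nor g f y (D H y al) a.
Definition scrP y al be := con2 (Psch g (f y)) (F y al) (F y be) + << H y, L0 y al be >>_y
  + 2^-1 * << H y, H y >>_y * h y al be.
(** The vector is left free here and in [weylVV], so that H and the normal and tangential parts of
    the gradient can be inserted and separated by linearity. *)
Definition cotV y v := ctr (gi h y) (fun al be => con3 (Cot g (f y)) v (F y al) (F y be)).
Definition weylVV y v v' := ctr (gi h y) (fun al be => con4 (Weyl g (f y)) (F y al) v (F y be) v').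
Definition trscrB y := ctr (gi h y) (fun al be => con2 (Bach g (f y)) (F y al) (F y be))
  + (n%:R - 4) * (2 * cotV y (H y) + weylVV y (H y) (H y)).

Lemma scrDE y al : scrD y al = fun a =>
  Nor g f y (fun a => \sum_b gi g (f y) a b * \sum_c Psch g (f y) c b * F y al c) a + - Nor g f y (D H y al) a.
Proof. by []. Qed.

Lemma dt_Frm_scrD y al be : V y -> << F y be, scrD y al >>_y = 0.
Proof. by move=> Vy; rewrite scrDE innDr innNr !(dt_Frm_Nor Hf) // subr0. Qed.

Lemma inn_scrD y al xi : V y -> (forall be, << F y be, xi >>_y = 0) -> << scrD y al, xi >>_y = DD y al xi.
Proof.
move=> Vy X; have Uy := fVU Vy; rewrite scrDE innDl innNl !(dt_Nor _ Vy X) /pairD; congr (_ - _).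
rewrite con2_s12 con2.unlock evE innE ctrE exchange_big; apply: eq_bigr => b _.
pose p d := ev (fun c => Psch g (f y) c d) (F y al).
transitivity ((\sum_a (\sum_d gi g (f y) a d * p d) * g (f y) a b) * xi b).
  rewrite mulr_suml; apply: eq_bigr => a _.
  rewrite (eq_bigr (fun d => gi g (f y) a d * p d)); last by move=> d _; rewrite /p evE.
  ring.
congr (_ * _); rewrite (ctr_sum_up (gi g (f y)) p (fun a b => g (f y) a b)).
by rewrite (ctr_met (gsym Uy) (gi_sym Hg Uy) (giK Hg Uy)).
Qed.

Lemma cotV_add y v v' : cotV y (fun a => v a + v' a) = cotV y v + cotV y v'.
Proof. by rewrite /cotV -ctrD; apply: eq_ctr => p q; rewrite con3_add1. Qed.

Lemma cotV_scale y r v : cotV y (fun a => r * v a) = r * cotV y v.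
Proof. by rewrite /cotV -ctrZ; apply: eq_ctr => p q; rewrite con3_scale1. Qed.

Lemma cotV_ctr y (v : 'I_k -> 'I_k -> 'I_n -> R) :
  cotV y (fun a => ctr (gi h y) (fun p q => v p q a)) = ctr (gi h y) (fun p q => cotV y (v p q)).
Proof. by rewrite /cotV [RHS]ctr_exch; apply: eq_ctr => p q; rewrite con3_ctr1. Qed.

Lemma cotV_Frm y p : cotV y (F y p) = - cotT y p.
Proof. by rewrite /cotV /cotT -ctrN; apply: eq_ctr => al be; rewrite -CotF_asym. Qed.

Lemma weylVV_sym y v v' : V y -> weylVV y v v' = weylVV y v' v.
Proof.
move=> Vy; rewrite /weylVV ctr_sym; last exact: (gi_sym Hh Vy).
apply: eq_ctr => p q; rewrite con4_pair; apply: eq_con4 => a b c d.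
by rewrite (Weyl_pair Hg) //; exact: fVU.
Qed.

Lemma weylVV_addr y v p q : weylVV y v (fun a => p a + q a) = weylVV y v p + weylVV y v q.
Proof. by rewrite /weylVV -ctrD; apply: eq_ctr => al be; rewrite con4_add4. Qed.

Lemma weylVV_scaler y r v p : weylVV y v (fun a => r * p a) = r * weylVV y v p.
Proof. by rewrite /weylVV -ctrZ; apply: eq_ctr => al be; rewrite con4_scale4. Qed.

Lemma weylVV_ctrr y v (z : 'I_k -> 'I_k -> 'I_n -> R) :
  weylVV y v (fun a => ctr (gi h y) (fun p q => z p q a)) = ctr (gi h y) (fun p q => weylVV y v (z p q)).
Proof. by rewrite /weylVV [RHS]ctr_exch; apply: eq_ctr => al be; rewrite con4_ctr4. Qed.

Lemma weylVV_Frm y p q : V y -> weylVV y (F y p) (F y q) = weyltr y p q.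
Proof. by move=> Vy; rewrite weyltr_sym // -tr_WeylF13. Qed.

End Divergence.

(** * Conformal change along a submanifold *)

HB.lock Definition divg (R : realType) n (g : 'rV[R]_n -> 'M[R]_n) t x : R := ctr (gi g x) (cov1 g t x).

Section ConformalDivergence.
Context {R : realType} {n : nat}.
Variables (U : set 'rV[R]_n) (g : 'rV[R]_n -> 'M[R]_n) (u : 'rV[R]_n -> R).
Hypotheses (Hg : metric_on U g) (su : smooth_on U u).
Let oU : open U. Proof. by case: Hg. Qed.
Let gsym : forall x, U x -> forall a b, g x a b = g x b a. Proof. by case: Hg. Qed.
Let cdim x (Ux : U x) := ctr_dim (gsym Ux) (giK Hg Ux).
Implicit Types (x : 'rV[R]_n) (a b c : 'I_n) (s t : 'rV[R]_n -> 'I_n -> R).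

Local Notation E x := (expR (2 * u x)).
Local Notation "<< v , w >>_ x" := (inn (gi g x) v w) (at level 10, x at level 8).
Local Notation form t := (forall a, smooth_on U (fun z => t z a)).

Lemma divgE (h : 'rV[R]_n -> 'M[R]_n) t x : divg h t x = ctr (gi h x) (cov1 h t x).
Proof. by rewrite unlock. Qed.

Lemma smooth_Einv : smooth_on U (fun z => (E z)^-1).
Proof.
apply: smooth_ext => [z|]; first by rewrite -expRN.
by apply: (smooth_expR oU (f := fun z => - (2 * u z))); smooth.
Qed.

Lemma pd_Einv a x : U x -> pd a (fun z => (E z)^-1) x = - 2 * pd a u x * (E x)^-1.
Proof.
move=> Ux; rewrite (_ : (fun z => (E z)^-1) = fun z => expR (- (2 * u z))); last first.
  by apply/funext => z; rewrite expRN.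
have s2 : smooth_on U (fun z => 2 * u z) by smooth.
rewrite (pd_expR (U := U)) //; last by smooth.
rewrite (pdN oU) // (pdZ oU) // expRN; ring.
Qed.

Lemma divg_eq s t x : (forall z, U z -> s z = t z) -> U x -> divg g s x = divg g t x.
Proof.
move=> st Ux; rewrite !divgE; apply: eq_ctr => a b; rewrite !cov1E st //; congr (_ - _).
by apply: (pd_eq oU) => // z /set_mem Uz; rewrite st.
Qed.

Lemma divgD s t x : form s -> form t -> U x ->
  divg g (fun z a => s z a + t z a) x = divg g s x + divg g t x.
Proof.
move=> ss st Ux; rewrite !divgE -ctrD; apply: eq_ctr => a b.
by rewrite !cov1E (pdD oU) // !sumlin; ring.
Qed.

Lemma divgZ (p : 'rV[R]_n -> R) t x : smooth_on U p -> form t -> U x ->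
  divg g (fun z a => p z * t z a) x = p x * divg g t x + << fun a => pd a p x, t x >>_x.
Proof.
move=> sp st Ux; rewrite !divgE innE -ctrZ -ctrD; apply: eq_ctr => a b.
by rewrite !cov1E (pdM oU) // !sumlin; ring.
Qed.

(** The factor n-4 is n-2 from the change of the connection minus 2 from differentiating the weight
    of the one-form. *)
Lemma divg_rescale t x : form t -> U x -> divg (rescale g u) (fun z a => (E z)^-1 * t z a) x
  = (E x)^-2 * (divg g t x + (n%:R - 4) * << t x, fun a => pd a u x >>_x).
Proof.
move=> st Ux; have e0 := E_neq0 u x; have sE := smooth_Einv.
have is_sym v w : << v, w >>_x = << w, v >>_x by apply: inn_sym; exact: (gi_sym Hg Ux).
have X : divg g (fun z a => (E z)^-1 * t z a) x = (E x)^-1 * (divg g t x - 2 * << t x, fun a => pd a u x >>_x).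
  rewrite divgZ // (_ : (fun a => pd a _ x) = fun a => (- 2 * (E x)^-1) * pd a u x); last first.
    by apply/funext => a; rewrite pd_Einv //; ring.
  by rewrite innZl (is_sym (t x)); ring.
rewrite divgE (ctr_rescale Hg) //.
rewrite (eq_ctr _ (fun a b => cov1_rescale Hg su (fun z a => (E z)^-1 * t z a) a b Ux)).
rewrite !ctrD !ctrN ctrZr cdim // -divgE X innZl.
rewrite (@eq_ctr _ _ _ (fun a b => (E x)^-1 * t x a * pd b u x) (fun a b => (E x)^-1 * (t x a * pd b u x))); last first.
  by move=> a b; rewrite mulrA.
rewrite (@eq_ctr _ _ _ (fun a b => (E x)^-1 * t x b * pd a u x) (fun a b => (E x)^-1 * (pd a u x * t x b))); last first.
  by move=> a b; rewrite -mulrA [pd _ _ _ * _]mulrC.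
by rewrite !ctrZ -!innE (is_sym (fun a => pd a u x)); field.
Qed.

Variable T : 'rV[R]_n -> 'I_n -> 'I_n -> R.
Hypotheses (sT : forall a b, smooth_on U (fun z => T z a b)) (T_sym : forall x, U x -> forall a b, T x a b = T x b a).

(** With [fialkow] for [T] and dw for [t], it splits the divergence of the new term in X into a
    pairing with the Hessian and the divergence of F. *)
Lemma divg_con t x : form t -> U x ->
  divg g (fun z b => ctr (gi g z) (fun p q => t z q * T z p b)) x =
  ctr2 (gi g x) (fun i j p q => T x i p * cov1 g t x j q)
  + ctr (gi g x) (fun p q => t x q * ctr (gi g x) (fun e a => cov2 g T x e a p)).
Proof.
move=> st Ux; have gs := gi_sym Hg Ux.
have K a b : cov1 g (fun z b => ctr (gi g z) (fun p q => t z q * T z p b)) x a b =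
   ctr (gi g x) (fun p q => cov1 g t x a q * T x p b + t x q * cov2 g T x a p b).
  rewrite cov1E (pd_trace Hg (t := fun z p q => t z q * T z p b)) //; last by move=> p q; smooth.
  have -> : \sum_d Gamma g x d a b * ctr (gi g x) (fun p q => t x q * T x p d) =
      ctr (gi g x) (fun p q => \sum_d Gamma g x d a b * (t x q * T x p d)).
    by rewrite ctr_sum; apply: eq_bigr => d _; rewrite ctrZ.
  rewrite -ctrN -ctrD; apply: eq_ctr => p q.
  by rewrite !cov2E cov1E (pdM oU) // !sumlin; ring.
rewrite divgE (eq_ctr _ K) -ctr2E ctr2D; congr (_ + _).
  rewrite ctr2_swap1 //; apply: eq_ctr2 => i j p q; by rewrite mulrC (T_sym Ux).
rewrite ctr2_exch ctr2E; apply: eq_ctr => p q; rewrite -ctrZ; apply: eq_ctr => i j.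
by rewrite (cov2_sym Hg).
Qed.

End ConformalDivergence.

Section ConformalSubmanifold.
Context {R : realType} {k n : nat}.
Variables (V : set 'rV[R]_k) (U : set 'rV[R]_n) (g : 'rV[R]_n -> 'M[R]_n) (f : 'rV[R]_k -> 'rV[R]_n).
Variable (u : 'rV[R]_n -> R).
Hypotheses (Hf : immersed_in V U g f) (su : smooth_on U u) (k0 : (0 < k)%N) (n3 : (3 <= n)%N).
Let Hg : metric_on U g. Proof. by case: Hf. Qed.
Let oV : open V. Proof. by case: Hf. Qed.
Let sf : smooth_on V f. Proof. by case: Hf. Qed.
Let fVU : forall y, V y -> U (f y). Proof. by case: Hf. Qed.
Let gsym : forall x, U x -> forall a b, g x a b = g x b a. Proof. by case: Hg. Qed.
Let Hh : metric_on V (Ind g f). Proof. exact: Ind_metric Hf. Qed.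
Let hsym y (Vy : V y) := metric_sym Hh Vy.
Let hcmet y (Vy : V y) := ctr_met (hsym Vy) (gi_sym Hh Vy) (giK Hh Vy).
Let hdim y (Vy : V y) := ctr_dim (hsym Vy) (giK Hh Vy).
Implicit Types (y : 'rV[R]_k) (al be ga de : 'I_k) (a b c d : 'I_n).
Implicit Types (s t : 'rV[R]_k -> 'I_n -> R) (v xi : 'I_n -> R).

Local Notation F := (Frm f).
Local Notation gt := (rescale g u).
Local Notation E y := (expR (2 * u (f y))).
Local Notation h := (Ind g f).
Local Notation ht := (Ind gt f).
Local Notation "<< v , w >>_ y" := (inn (g (f y)) v w) (at level 10, y at level 8).
Local Notation D := (Dal g f).
Local Notation L := (Sff g f).
Local Notation L0 := (Sff0 g f).
Local Notation H := (Hm g f).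
Local Notation Gh := (@Gamma R k (Ind g f)).
Local Notation w := (fun z => u (f z)).
Local Notation du y := (fun a => pd a u (f y)).
Local Notation dw y := (fun al => pd al w y).
Local Notation DD := (pairD g f).
Local Notation WX := (WeylF g f).

Let sU a : smooth_on U (fun x => pd a u x). Proof. by smooth. Qed.
Let sdu a : smooth_on V (fun y => pd a u (f y)).
Proof. exact: (smooth_on_sub Hf (p := fun x => pd a u x)). Qed.
Let sF p a : smooth_on V (fun y => F y p a). Proof. exact: (smooth_Frm Hf). Qed.
Let sH a : smooth_on V (fun y => H y a). Proof. exact: (smooth_Hm Hf). Qed.
Let sgig a b : smooth_on V (fun y => gi g (f y) a b).
Proof. by apply: (smooth_on_sub Hf (p := fun x => gi g x a b)); exact: (smooth_gi Hg). Qed.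

Lemma smooth_u_sub : smooth_on V w.
Proof. exact: (smooth_on_sub Hf). Qed.
Let sw := smooth_u_sub.

Definition grad y a := \sum_d gi g (f y) a d * pd d u (f y).
Definition gradN y := Nor g f y (grad y).
Definition gradT y a := ctr (gi h y) (fun p q => pd q w y * F y p a).

Lemma smooth_grad a : smooth_on V (fun y => grad y a).
Proof. by rewrite /grad; smooth. Qed.
Let sgrad := smooth_grad.

Lemma smooth_gradN a : smooth_on V (fun y => gradN y a).
Proof. exact: (smooth_Nor Hf). Qed.
Let sgradN := smooth_gradN.

Lemma inn_grad y v : inn (gi g (f y)) v (du y) = ev v (grad y).
Proof.
rewrite innE ctrE evE; apply: eq_bigr => a _; rewrite /grad mulr_sumr; apply: eq_bigr => b _.
by rewrite mulrCA.
Qed.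

Lemma grad_low y v : V y -> << grad y, v >>_y = ev (du y) v.
Proof.
move=> Vy; have Uy := fVU Vy; rewrite innE ctrE exchange_big evE; apply: eq_bigr => b _.
transitivity ((\sum_a grad y a * g (f y) a b) * v b).
  by rewrite mulr_suml; apply: eq_bigr => a _; ring.
congr (_ * _); rewrite (ctr_sum_up (gi g (f y)) (du y) (fun a b => g (f y) a b)).
by rewrite (ctr_met (gsym Uy) (gi_sym Hg Uy) (giK Hg Uy)).
Qed.

Lemma dw_ev y al : V y -> pd al w y = ev (du y) (F y al).
Proof. by move=> Vy; rewrite (pd_sub Hf) // evE. Qed.

Lemma gradTN y a : V y -> grad y a = gradN y a + gradT y a.
Proof.
move=> Vy; rewrite /gradN NorE /gradT; apply/eqP; rewrite -addrA -subr_eq0 opprD addrA subrr sub0r oppr_eq0.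
rewrite addrC subr_eq0; apply/eqP; rewrite ctrE; apply: eq_bigr => p _.
rewrite TgE mulr_suml; apply: eq_bigr => q _.
by rewrite dw_ev // -grad_low // (dt_sym Hf) // mulrA.
Qed.

Lemma Ind_rescale : ht = rescale h w.
Proof.
apply/funext => y; apply/matrixP => p q; rewrite mxE !IndE !innE /rescale.
by rewrite ctr_scale.
Qed.

Lemma rescale_immersed : immersed_in V U gt f.
Proof.
split=> //; first exact: (rescale_metric Hg).
by move=> y Vy; rewrite Ind_rescale; exact: (metric_unit (rescale_metric Hh sw) Vy).
Qed.
Let Hft := rescale_immersed.

Lemma inn_rescale y v v' : inn (gt (f y)) v v' = E y * << v, v' >>_y.
Proof. by rewrite !innE /rescale ctr_scale. Qed.

Lemma ctr_Ind_rescale y (t : 'I_k -> 'I_k -> R) : V y -> ctr (gi ht y) t = (E y)^-1 * ctr (gi h y) t.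
Proof. by move=> Vy; rewrite Ind_rescale (ctr_rescale Hh). Qed.

Lemma Nor_rescale y v : V y -> Nor gt f y v = Nor g f y v.
Proof.
move=> Vy; apply/funext => a; rewrite !NorE; congr (_ - _); apply: eq_bigr => ga _; congr (_ * _).
rewrite !TgE Ind_rescale (gi_rescale Hh) //; apply: eq_bigr => de _.
by rewrite mxE inn_rescale; field; exact: E_neq0.
Qed.

Lemma Dal_rescale s y al : V y -> Dal gt f s y al = fun a => D s y al a + pd al w y * s y a
  + ev (du y) (s y) * F y al a - << F y al, s y >>_y * grad y a.
Proof.
move=> Vy; have Uy := fVU Vy; apply/funext => a; rewrite !DalE dw_ev //.
have X b c : Gamma gt (f y) a b c * F y al b * s y c = Gamma g (f y) a b c * F y al b * s y c
  + ((a == b)%:R * F y al b * (pd c u (f y) * s y c) + (a == c)%:R * s y c * (pd b u (f y) * F y al b)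
     - grad y a * (g (f y) b c * (F y al b * s y c))).
  by rewrite (Gamma_rescale Hg) // /grad; ring.
under eq_bigr do under eq_bigr do rewrite X.
under eq_bigr do rewrite big_split.
rewrite big_split /= -!addrA; congr (_ + (_ + _)).
under eq_bigr do rewrite sumrB big_split.
rewrite sumrB big_split /=.
have S1 : \sum_b \sum_c (a == b)%:R * F y al b * (pd c u (f y) * s y c) = ev (du y) (s y) * F y al a.
  under eq_bigr do rewrite -mulr_sumr -evE.
  rewrite -mulr_suml mulrC; congr (_ * _); rewrite -[RHS](sum_delta a); apply: eq_bigr => b _.
  by rewrite eq_sym.
have S2 : \sum_b \sum_c (a == c)%:R * s y c * (pd b u (f y) * F y al b) = ev (du y) (F y al) * s y a.
  rewrite exchange_big; under eq_bigr do rewrite -mulr_sumr -evE.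
  rewrite -mulr_suml mulrC; congr (_ * _); rewrite -[RHS](sum_delta a); apply: eq_bigr => b _.
  by rewrite eq_sym.
have S3 : \sum_b \sum_c grad y a * (g (f y) b c * (F y al b * s y c)) = << F y al, s y >>_y * grad y a.
  rewrite innE ctrE mulr_suml; apply: eq_bigr => b _; rewrite mulr_suml; apply: eq_bigr => c _.
  by rewrite mulrC.
rewrite S1 S2 S3; ring.
Qed.

Lemma dt_Frm_gradN y al : V y -> << F y al, gradN y >>_y = 0.
Proof. exact: (dt_Frm_Nor Hf). Qed.

Lemma Sff_rescale y al be : V y -> Sff gt f y al be = fun a => L y al be a + - (h y al be * gradN y a).
Proof.
move=> Vy; rewrite !SffE Nor_rescale // Dal_rescale //.
rewrite (_ : (fun a => _) = fun a => pd al w y * F y be a + (ev (du y) (F y be) * F y al a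
   + (- h y al be * grad y a + D (fun z => F z be) y al a))); last first.
  by apply/funext => a; rewrite IndE; ring.
apply/funext => a; rewrite !Nor_lin !(Nor_Frm Hf) // /gradN; ring.
Qed.

Lemma Hm_rescale y : V y -> Hm gt f y = fun a => (E y)^-1 * (H y a + - gradN y a).
Proof.
move=> Vy; have kn : k%:R != 0 :> R by rewrite pnatr_eq0 -lt0n.
apply/funext => a; rewrite !HmE ctr_Ind_rescale // (eq_ctr _ (fun p q => congr1 (fun v => v a) (Sff_rescale p q Vy))).
rewrite ctrD ctrN ctrZr hdim //; field; rewrite kn /=; exact: E_neq0.
Qed.

Lemma Sff0_rescale y al be : V y -> Sff0 gt f y al be = L0 y al be.
Proof.
move=> Vy; apply/funext => a; rewrite !Sff0E Sff_rescale // Hm_rescale // Ind_rescale /rescale mxE.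
by field; exact: E_neq0.
Qed.

Lemma WeylF_rescale y al be ga xi : V y -> WeylF gt f y al be ga xi = E y * WX y al be ga xi.
Proof.
move=> Vy; rewrite /WeylF -con4Z; apply: eq_con4 => a b c d; rewrite (Weyl_rescale Hg) //; exact: fVU.
Qed.

Lemma sff0sq_rescale y al be : V y -> sff0sq gt f y al be = sff0sq g f y al be.
Proof.
move=> Vy; rewrite /sff0sq ctr_Ind_rescale // -ctrZ; apply: eq_ctr => p q.
by rewrite !Sff0_rescale // inn_rescale mulKf // E_neq0.
Qed.

Lemma weyltr_rescale y al be : V y -> weyltr gt f y al be = weyltr g f y al be.
Proof.
move=> Vy; rewrite /weyltr ctr_Ind_rescale // -ctrZ; apply: eq_ctr => p q.
by rewrite WeylF_rescale // mulKf // E_neq0.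
Qed.

Lemma fialkow_rescale y al be : V y -> fialkow gt f y al be = fialkow g f y al be.
Proof. by move=> Vy; rewrite /fialkow sff0sq_rescale // weyltr_rescale. Qed.

Lemma Dal_eq s t y al : (forall z, V z -> s z = t z) -> V y -> D s y al = D t y al.
Proof.
move=> st Vy; apply/funext => a; rewrite !Dal_conmat st //; congr (_ + _).
by apply: (pd_eq oV) => // z /set_mem Vz; rewrite st.
Qed.

(** The identity between the pairing with the gradient and the value of du is differentiated for a
    vector with constant components; the terms in which that vector is differentiated agree on both
    sides and cancel. *)
Lemma Dal_grad y al v : V y -> << D grad y al, v >>_y = con2 (Hess g u (f y)) (F y al) v.
Proof.
move=> Vy; have sv a : smooth_on V (fun _ : 'rV[R]_k => v a) by exact: smooth_cst.
have := pd_dt Hf al sgrad sv Vy.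
rewrite (pd_eq oV (h := fun z => ev (du z) v)) //; last first.
  by move=> z /set_mem Vz; exact: grad_low.
rewrite (pd_con1 Hf (t := fun x a => pd a u x)) // grad_low // => /addIr <-.
by [].
Qed.

(** Derivatives of the coefficients multiply frame vectors, which are orthogonal to [xi]; of the
    differentiated frame the Gauss formula leaves L. *)
Lemma Dal_gradT y al xi : V y -> (forall de, << F y de, xi >>_y = 0) ->
  << D gradT y al, xi >>_y = ctr (gi h y) (fun p q => pd q w y * << L y al p, xi >>_y).
Proof.
move=> Vy X.
have -> : gradT = fun z a => \sum_p (\sum_q gi h z p q * pd q w z) * F z p a.
  apply/funext => z; apply/funext => a; rewrite /gradT ctrE; apply: eq_bigr => p _.
  by rewrite mulr_suml; apply: eq_bigr => q _; rewrite mulrA.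
have sc p : smooth_on V (fun z => \sum_q gi h z p q * pd q w z) by smooth.
rewrite (Dal_sum Hf) // => [|p a]; last by smooth.
rewrite inn_suml ctrE; apply: eq_bigr => p _; rewrite (DalZ Hf) // innDl !innZl X mulr0 add0r.
rewrite (_ : D (fun z => F z p) y al = fun a => \sum_m Gh y m al p * F y m a + L y al p a); last first.
  by apply/funext => a; rewrite (Dal_Frm Hf).
have -> : << fun a => \sum_m Gh y m al p * F y m a + L y al p a, xi >>_y = << L y al p, xi >>_y.
  by rewrite innDl inn_suml big1 ?add0r // => m _; rewrite innZl X mulr0.
by rewrite mulr_suml; apply: eq_bigr => q _; rewrite mulrA.
Qed.

Lemma smooth_gradT a : smooth_on V (fun y => gradT y a).
Proof. by apply: smooth_ext => [y|]; [exact: ctrE|smooth]. Qed.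

Lemma Dal_gradN y al xi : V y -> (forall de, << F y de, xi >>_y = 0) ->
  << D gradN y al, xi >>_y = con2 (Hess g u (f y)) (F y al) xi
    - ctr (gi h y) (fun p q => pd q w y * << L y al p, xi >>_y).
Proof.
move=> Vy X; rewrite -Dal_grad // -Dal_gradT //.
rewrite (Dal_eq (s := grad) (t := fun z a => gradN z a + gradT z a)) //; last first.
  by move=> z Vz; apply/funext => a; exact: gradTN.
rewrite (DalD Hf) // ?innDl ?addrK // => a; exact: smooth_gradT.
Qed.

Lemma inn_gradN y xi : V y -> (forall de, << F y de, xi >>_y = 0) -> << gradN y, xi >>_y = ev (du y) xi.
Proof. by move=> Vy X; rewrite /gradN (dt_Nor _ Vy X) grad_low. Qed.

Lemma con2_dP y p v : V y ->
  con2 (dP g u (f y)) (F y p) v = - con2 (Hess g u (f y)) (F y p) v + pd p w y * ev (du y) v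
  - 2^-1 * ev (du y) (grad y) * << F y p, v >>_y.
Proof.
move=> Vy; have -> : con2 (dP g u (f y)) (F y p) v = con2 (fun a b => - Hess g u (f y) a b + du y a * du y b
    + - (2^-1 * inn (gi g (f y)) (du y) (du y)) * g (f y) a b) (F y p) v.
  by congr con2; apply/funext => a; apply/funext => b; rewrite /dP; ring.
rewrite !con2D con2N con2Z con2_prod (con2_met g f) -dw_ev // inn_grad; ring.
Qed.

(** The Hessian of u in the change of the Schouten tensor cancels the one that the normal gradient
    brings into the change of H. The weight of H and the new connection together supply the trace
    part that turns L into L0. *)
Lemma pairD_rescale y al xi : V y -> (forall de, << F y de, xi >>_y = 0) ->
  pairD gt f y al xi = DD y al xi - ctr (gi h y) (fun p q => pd q w y * << L0 y al p, xi >>_y).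
Proof.
move=> Vy X; rewrite /pairD.
have -> : con2 (Psch gt (f y)) (F y al) xi = con2 (Psch g (f y)) (F y al) xi + con2 (dP g u (f y)) (F y al) xi.
  by rewrite -con2D; congr con2; apply/funext => a; apply/funext => b; rewrite (Psch_rescale Hg) //; exact: fVU.
rewrite con2_dP // X mulr0 subr0 inn_rescale Dal_rescale // !innDl innNl !innZl Hm_rescale // !innZr !innZl !innDr.
rewrite !innNr !X dt_Frm_gradN // (dt_Frm_Hm Hf) //.
rewrite (Dal_eq (s := Hm gt f) (t := fun z a => (E z)^-1 * (H z a + - gradN z a))) //; last first.
  by move=> z Vz; rewrite Hm_rescale.
have sE := smooth_Einv Hh sw.
rewrite (DalZ Hf) //; last by move=> a; smooth.
rewrite (_ : D (fun z a => H z a + - gradN z a) y al = fun a => D H y al a + - D gradN y al a); last first.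
  rewrite (_ : (fun z a => H z a + - gradN z a) = fun z a => H z a + -1 * gradN z a); last first.
    by apply/funext => z; apply/funext => a; rewrite mulN1r.
  rewrite (DalD Hf) //; last by move=> a; smooth.
  rewrite (DalZ Hf (c := fun=> -1)) //; last by exact: smooth_cst.
  by apply/funext => a; rewrite pd_cst; ring.
rewrite innDl !innZl !innDl !innNl Dal_gradN // inn_gradN // (pd_Einv (u := w) Hh) //.
rewrite (@eq_ctr _ _ _ (fun p q => pd q w y * << L0 y al p, xi >>_y) (fun p q => pd q w y * << L y al p, xi >>_y
  + - (<< H y, xi >>_y * (pd q w y * h y al p)))); last first.
  by move=> p q; rewrite Sff0_fun innDl innNl innZlr; ring.
rewrite ctrD ctrN ctrZ hcmet //; field; exact: E_neq0.
Qed.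

Lemma CotF_rescale y al be ga : V y ->
  CotF gt f y al be ga = CotF g f y al be ga - WX y al be ga (grad y).
Proof.
move=> Vy; rewrite /CotF /WeylF -con3_ev -con3N -con3D; apply: eq_con3 => a b c.
by rewrite (Cot_rescale Hg) ?inn_grad //; exact: fVU.
Qed.

Lemma grad_fun y : V y -> grad y = fun a => gradN y a + gradT y a.
Proof. by move=> Vy; apply/funext => a; exact: gradTN. Qed.

(** The Cotton term changes by Weyl applied to grad u. Its normal part is cancelled by the change of
    H in the Weyl term ([B]), its tangential part is the Weyl half of F; the half with L0^2 comes
    from [pairDL] ([C]). *)
Lemma calIform_rescale y ga : V y -> calIform gt f y ga =
  (E y)^-1 * (calIform g f y ga + ctr (gi h y) (fun p q => pd q w y * fialkow g f y p ga)).
Proof.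
move=> Vy; have e0 := E_neq0 u (f y).
rewrite [calIform gt _ _ _]/calIform [cotT gt _ _ _]/cotT [weylH gt _ _ _]/weylH [pairDL gt _ _ _]/pairDL !ctr_Ind_rescale //.
have A : ctr (gi h y) (fun be de => CotF gt f y be ga de) = cotT g f y ga
    - ctr (gi h y) (fun be de => WX y be ga de (gradN y)) - ctr (gi h y) (fun p q => pd q w y * weyltr g f y p ga).
  rewrite (eq_ctr _ (fun be de => CotF_rescale be ga de Vy)) ctrD ctrN -addrA; congr (_ + _).
  rewrite -opprD; congr (- _).
  rewrite (@eq_ctr _ _ _ _ (fun be de => WX y be ga de (gradN y)
     + ctr (gi h y) (fun p q => pd q w y * WX y be ga de (F y p)))); last first.
    move=> be de; rewrite grad_fun // WeylF_addr; congr (_ + _); rewrite WeylF_ctr; apply: eq_ctr => p q; exact: WeylF_scaler.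
  rewrite ctrD; congr (_ + _); rewrite ctr_exch; apply: eq_ctr => p q.
  by rewrite ctrZ (tr_WeylF13 Hf).
have B : ctr (gi h y) (fun be de => WeylF gt f y be ga de (Hm gt f y)) = weylH g f y ga
    - ctr (gi h y) (fun be de => WX y be ga de (gradN y)).
  rewrite -ctrN -ctrD; apply: eq_ctr => be de; rewrite WeylF_rescale // Hm_rescale // WeylF_scaler WeylF_addr.
  rewrite (_ : (fun a => - gradN y a) = fun a => -1 * gradN y a); last by apply/funext => a; rewrite mulN1r.
  by rewrite WeylF_scaler; field.
have C : ctr (gi h y) (fun be de => pairD gt f y be (Sff0 gt f y de ga)) = pairDL g f y ga
   - ctr (gi h y) (fun p q => pd q w y * sff0sq g f y p ga).
  rewrite (@eq_ctr _ _ _ _ (fun be de => DD y be (L0 y de ga) + - ctr (gi h y) (fun p q => pd q w y * << L0 y be p, L0 y de ga >>_y))); last first.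
    by move=> be de; rewrite Sff0_rescale // pairD_rescale // => p; exact: (dt_Frm_Sff0 Hf).
  rewrite ctrD ctrN; congr (_ - _); rewrite ctr_exch; apply: eq_ctr => p q; by rewrite ctrZ.
rewrite A B C (@eq_ctr _ _ _ (fun p q => pd q w y * fialkow g f y p ga)
  (fun p q => pd q w y * sff0sq g f y p ga + - (pd q w y * weyltr g f y p ga))); last first.
  by move=> p q; rewrite /fialkow mulrBr.
rewrite ctrD ctrN /calIform; ring.
Qed.

Lemma inn_Frm_gradT y p : V y -> << F y p, gradT y >>_y = pd p w y.
Proof.
move=> Vy; have : << F y p, grad y >>_y = pd p w y by rewrite dw_ev // -grad_low // (dt_sym Hf _ _ Vy).
by rewrite grad_fun // innDr dt_Frm_gradN // add0r.
Qed.

Lemma ev_grad y : V y ->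
  ev (du y) (grad y) = << gradN y, gradN y >>_y + inn (gi h y) (dw y) (dw y).
Proof.
move=> Vy; rewrite -grad_low // [in LHS]grad_fun // innDl !innDr.
have T v : << gradT y, v >>_y = ctr (gi h y) (fun p q => pd q w y * << F y p, v >>_y).
  by rewrite (dt_sym Hf _ _ Vy) inn_ctrr; apply: eq_ctr => p q; rewrite innZr (dt_sym Hf _ _ Vy).
rewrite (dt_sym Hf (gradN y) (gradT y) Vy) !T.
rewrite (@eq_ctr _ _ _ _ (fun _ _ => 0)) ?ctr0; last by move=> p q; rewrite dt_Frm_gradN ?mulr0.
rewrite addr0 add0r; congr (_ + _); rewrite innE; apply: eq_ctr => p q.
by rewrite inn_Frm_gradT // mulrC.
Qed.

Lemma cov1_dw y al be : V y ->
  cov1 h (fun z => dw z) y al be = con2 (Hess g u (f y)) (F y al) (F y be) + ev (du y) (L y al be).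
Proof.
move=> Vy; rewrite cov1E (pd_eq oV (h := fun z => ev (du z) (F z be))) //; last first.
  by move=> z /set_mem Vz; exact: dw_ev.
rewrite (pd_con1 Hf (t := fun x a => pd a u x)) //.
rewrite (_ : D (fun z => F z be) y al = fun a => \sum_m Gh y m al be * F y m a + L y al be a); last first.
  by apply/funext => a; rewrite (Dal_Frm Hf).
rewrite ev_lc -/(Hess g u) (eq_bigr (fun m => Gh y m al be * pd m w y)); last by move=> m _; rewrite -dw_ev.
by rewrite -addrA [X in _ + X]addrAC subrr add0r.
Qed.

(** The ambient change [dP] restricts to the ambient Hessian and the full norm of du. The changes of
    the two terms with H convert these into the Hessian and the norm of dw, so script P changes like
    a Schouten tensor of the induced metric. *)
Lemma scrP_rescale y al be : V y -> scrP gt f y al be = scrP g f y al be + dP h w y al be.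
Proof.
move=> Vy; have e0 := E_neq0 u (f y); rewrite /scrP.
have -> : con2 (Psch gt (f y)) (F y al) (F y be) = con2 (Psch g (f y)) (F y al) (F y be) + con2 (dP g u (f y)) (F y al) (F y be).
  by rewrite -con2D; congr con2; apply/funext => a; apply/funext => b; rewrite (Psch_rescale Hg) //; exact: fVU.
have XL p : << F y p, L0 y al be >>_y = 0 by exact: (dt_Frm_Sff0 Hf).
have XH p : << F y p, H y >>_y = 0 by exact: (dt_Frm_Hm Hf).
rewrite con2_dP // !inn_rescale Sff0_rescale // Hm_rescale // Ind_rescale mxE !innZl !innZr !innDl !innDr !innNl !innNr.
rewrite inn_gradN // (dt_sym Hf (H y) (gradN y) Vy) inn_gradN // -dw_ev // -IndE ev_grad //.
have -> : dP h w y al be = - cov1 h (fun z => dw z) y al be + pd al w y * pd be w y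
   - 2^-1 * inn (gi h y) (dw y) (dw y) * h y al be by [].
rewrite cov1_dw // Sff_fun evDr evZr; by field.
Qed.

(** As [scrD] is normal, its pairings with normal vectors, whose change is given by [pairD_rescale],
    determine it. They amount to subtracting [LU], the tensor L0 contracted once with dw. *)
Lemma trscrD2_rescale y : V y ->
  ctr (gi ht y) (fun al be => inn (gt (f y)) (scrD gt f y al) (scrD gt f y be)) =
  (E y)^-2 * (ctr (gi h y) (fun al be => << scrD g f y al, scrD g f y be >>_y)
    - 2 * ctr (gi h y) (fun p q => pd q w y * pairDL g f y p)
    + ctr (gi h y) (fun p q => pd q w y * ctr (gi h y) (fun r m => pd m w y * sff0sq g f y p r))).
Proof.
move=> Vy; have e0 := E_neq0 u (f y); have gs := gi_sym Hh Vy.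
pose LU al a := ctr (gi h y) (fun p q => pd q w y * L0 y al p a).
pose Q al a := scrD g f y al a + - LU al a.
have LUE al xi : << LU al, xi >>_y = ctr (gi h y) (fun p q => pd q w y * << L0 y al p, xi >>_y).
  by rewrite (dt_sym Hf _ _ Vy) inn_ctrr; apply: eq_ctr => p q; rewrite innZr (dt_sym Hf _ _ Vy).
have NL al p : << F y p, LU al >>_y = 0.
  rewrite (dt_sym Hf _ _ Vy) LUE (@eq_ctr _ _ _ _ (fun _ _ => 0)) ?ctr0 // => r m.
  by rewrite (dt_sym Hf _ _ Vy) (dt_Frm_Sff0 Hf) // mulr0.
have ND al p : << F y p, scrD g f y al >>_y = 0 by exact: (dt_Frm_scrD Hf).
have NQ al p : << F y p, Q al >>_y = 0 by rewrite /Q innDr innNr NL ND subr0.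
have NDt al p : << F y p, scrD gt f y al >>_y = 0.
  by apply: (mulfI e0); rewrite -inn_rescale (dt_Frm_scrD Hft) // mulr0.
have K al xi : (forall p, << F y p, xi >>_y = 0) -> E y * << scrD gt f y al, xi >>_y = << Q al, xi >>_y.
  move=> X; rewrite -inn_rescale (inn_scrD Hft) //; last by move=> p; rewrite inn_rescale X mulr0.
  by rewrite pairD_rescale // /Q innDl innNl LUE (inn_scrD Hf).
(* [K] is applied to one factor after the other, each time with the other factor as the normal test
   vector. *)
have A al be : inn (gt (f y)) (scrD gt f y al) (scrD gt f y be) = (E y)^-1 * << Q al, Q be >>_y.
  rewrite inn_rescale K // (dt_sym Hf _ _ Vy); apply: (mulfI e0); rewrite K // mulVKf //.
  exact: (dt_sym Hf).
rewrite ctr_Ind_rescale // (eq_ctr _ A) ctrZ mulrA -exprVn expr2; congr (_ * _).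
have B : ctr (gi h y) (fun al be => << scrD g f y al, LU be >>_y) = ctr (gi h y) (fun p q => pd q w y * pairDL g f y p).
  rewrite (@eq_ctr _ _ _ _ (fun al be => ctr (gi h y) (fun p q => pd q w y * DD y al (L0 y be p)))); last first.
    move=> al be; rewrite (inn_scrD Hf) // /LU (pairD_ctr g f); apply: eq_ctr => p q; exact: pairD_scale.
  by rewrite ctr_exch; apply: eq_ctr => p q; rewrite ctrZ.
have B' : ctr (gi h y) (fun al be => << LU al, scrD g f y be >>_y) = ctr (gi h y) (fun p q => pd q w y * pairDL g f y p).
  by rewrite -B [RHS]ctr_sym //; apply: eq_ctr => al be; rewrite (dt_sym Hf).
have C : ctr (gi h y) (fun al be => << LU al, LU be >>_y) =
    ctr (gi h y) (fun p q => pd q w y * ctr (gi h y) (fun r m => pd m w y * sff0sq g f y p r)).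
  rewrite (@eq_ctr _ _ _ _ (fun al be => ctr (gi h y) (fun p q => pd q w y * << L0 y al p, LU be >>_y))); last first.
    by move=> al be; rewrite LUE.
  rewrite ctr_exch; apply: eq_ctr => p q; rewrite ctrZ; congr (_ * _).
  rewrite (@eq_ctr _ _ _ _ (fun al be => ctr (gi h y) (fun r m => pd m w y * << L0 y al p, L0 y be r >>_y))); last first.
    by move=> al be; rewrite (dt_sym Hf _ _ Vy) LUE; apply: eq_ctr => r m; rewrite (dt_sym Hf _ _ Vy).
  by rewrite ctr_exch; apply: eq_ctr => r m; rewrite ctrZ.
rewrite (@eq_ctr _ _ _ _ (fun al be => << scrD g f y al, scrD g f y be >>_y + - << scrD g f y al, LU be >>_y
  + (- << LU al, scrD g f y be >>_y + << LU al, LU be >>_y))); last first.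
  by move=> al be; rewrite /Q !innDl !innDr !innNl !innNr; ring.
rewrite !ctrD !ctrN B B' C; ring.
Qed.

Lemma con2_Bach_rescale y v v' : V y -> con2 (Bach gt (f y)) v v' = (E y)^-1 * (con2 (Bach g (f y)) v v'
  + (n%:R - 4) * (con3 (Cot g (f y)) (grad y) v v' + con3 (Cot g (f y)) (grad y) v' v)
  + (n%:R - 4) * con4 (Weyl g (f y)) v (grad y) v' (grad y)).
Proof.
move=> Vy; have e0 := E_neq0 u (f y); apply: (mulfI e0); rewrite mulVKf //.
rewrite -!con2_ev1 -con2_ev24 -con2Z [X in _ + _ * (_ + X)]con2_s12 -!con2D -!con2Z -!con2D.
congr con2; apply/funext => a; apply/funext => b.
rewrite (Bach_rescale Hg) //; last exact: fVU.
rewrite !inn_grad; congr (_ + _ + _ * ev _ _).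
by apply/funext => d; rewrite inn_grad.
Qed.

Lemma cotV_rescale y v : V y -> cotV gt f y v = (E y)^-1 * (cotV g f y v + weylVV g f y v (grad y)).
Proof.
move=> Vy; rewrite /cotV ctr_Ind_rescale // /weylVV -ctrD; congr (_ * _); apply: eq_ctr => al be.
rewrite con4_s12 -con3_ev -con3D; apply: eq_con3 => a b c.
rewrite (Cot_rescale Hg) ?inn_grad //; last exact: fVU.
congr (_ + _); rewrite -evNl; congr ev; apply/funext => d.
by rewrite (Weyl_asym12 g b a c d (fVU Vy)).
Qed.

Lemma weylVV_rescale y v v' : V y -> weylVV gt f y v v' = weylVV g f y v v'.
Proof.
move=> Vy; have e0 := E_neq0 u (f y); rewrite /weylVV ctr_Ind_rescale // -ctrZ; apply: eq_ctr => al be.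
apply: (mulfI e0); rewrite mulVKf // -con4Z; apply: eq_con4 => a b c d.
by rewrite (Weyl_rescale Hg) //; exact: fVU.
Qed.

(** The trace of script B is a quadratic polynomial in the vector H. Replacing H by H minus the
    normal gradient, while the Bach and Cotton terms absorb the full gradient, amounts up to scale
    to evaluating this polynomial at H plus the tangential gradient. *)
Lemma trscrB_rescale y : V y -> trscrB gt f y = (E y)^-2 * (trscrB g f y + (n%:R - 4) *
  (- 2 * ctr (gi h y) (fun p q => pd q w y * (cotT g f y p - weylH g f y p))
   + ctr (gi h y) (fun p q => pd q w y * ctr (gi h y) (fun r m => pd m w y * weyltr g f y p r)))).
Proof.
move=> Vy; have e0 := E_neq0 u (f y); have gs := gi_sym Hh Vy.
have H' : Hm gt f y = fun a => (E y)^-1 * (H y a + -1 * gradN y a).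
  by rewrite Hm_rescale //; apply/funext => a; rewrite mulN1r.
have WL v v' z : weylVV g f y (fun a => v a + v' a) z = weylVV g f y v z + weylVV g f y v' z.
  by rewrite (weylVV_sym Hf _ _ Vy) weylVV_addr !(weylVV_sym Hf z _ Vy).
have WS r v z : weylVV g f y (fun a => r * v a) z = r * weylVV g f y v z.
  by rewrite (weylVV_sym Hf _ _ Vy) weylVV_scaler !(weylVV_sym Hf z _ Vy).
have WT v : weylVV g f y v (gradT y) = ctr (gi h y) (fun p q => pd q w y * weylVV g f y v (F y p)).
  by rewrite /gradT weylVV_ctrr; apply: eq_ctr => p q; rewrite weylVV_scaler.
have CT : cotV g f y (gradT y) = - ctr (gi h y) (fun p q => pd q w y * cotT g f y p).
  by rewrite /gradT cotV_ctr -ctrN; apply: eq_ctr => p q; rewrite cotV_scale cotV_Frm mulrN.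
have WTT : weylVV g f y (gradT y) (gradT y) =
    ctr (gi h y) (fun p q => pd q w y * ctr (gi h y) (fun r m => pd m w y * weyltr g f y p r)).
  rewrite WT; apply: eq_ctr => p q; congr (_ * _); rewrite (weylVV_sym Hf _ _ Vy) WT.
  by apply: eq_ctr => r m; rewrite (weylVV_Frm Hf).
have WHT : weylVV g f y (H y) (gradT y) = ctr (gi h y) (fun p q => pd q w y * weylH g f y p).
  by rewrite WT; apply: eq_ctr => p q; rewrite (weylVV_sym Hf _ _ Vy).
rewrite -WTT (@eq_ctr _ _ _ (fun p q => pd q w y * (cotT g f y p - weylH g f y p))
  (fun p q => pd q w y * cotT g f y p + - (pd q w y * weylH g f y p))); last by move=> p q; rewrite mulrBr.
rewrite ctrD ctrN -WHT /trscrB cotV_rescale // weylVV_rescale // ctr_Ind_rescale //.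
rewrite (eq_ctr _ (fun al be => con2_Bach_rescale (F y al) (F y be) Vy)) ctrZ !ctrD !ctrZ ctrD.
have -> : ctr (gi h y) (fun i j => con3 (Cot g (f y)) (grad y) (F y j) (F y i)) = cotV g f y (grad y) by rewrite ctr_sym.
rewrite -/(cotV g f y (grad y)) -/(weylVV g f y (grad y) (grad y)).
have NT : weylVV g f y (gradT y) (gradN y) = weylVV g f y (gradN y) (gradT y) by exact: (weylVV_sym Hf).
have HN : weylVV g f y (gradN y) (H y) = weylVV g f y (H y) (gradN y) by exact: (weylVV_sym Hf).
rewrite H' grad_fun // !cotV_scale !cotV_add !cotV_scale !WS !WL !WS.
rewrite !weylVV_addr !weylVV_scaler !weylVV_addr !weylVV_scaler NT HN.
have -> : ctr (gi h y) (fun p q => pd q w y * cotT g f y p) = - cotV g f y (gradT y) by rewrite CT opprK.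
by field.
Qed.

End ConformalSubmanifold.

(** * The invariant and its conformal change *)

Section InvariantForm.
Context {R : realType} {k n : nat}.
Variables (V : set 'rV[R]_k) (U : set 'rV[R]_n) (g : 'rV[R]_n -> 'M[R]_n) (f : 'rV[R]_k -> 'rV[R]_n).
Hypotheses (Hf : immersed_in V U g f).
Let Hg : metric_on U g. Proof. by case: Hf. Qed.
Let oV : open V. Proof. by case: Hf. Qed.
Implicit Types (y : 'rV[R]_k) (al be ga de : 'I_k) (a b c d : 'I_n).

Local Notation h := (Ind g f).
Local Notation F := (Frm f).
Local Notation H := (Hm g f).

Let sF p a : smooth_on V (fun y => F y p a). Proof. exact: (smooth_Frm Hf). Qed.
Let sL0 p q a : smooth_on V (fun y => Sff0 g f y p q a). Proof. exact: (smooth_Sff0 Hf). Qed.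
Let sH a : smooth_on V (fun y => H y a). Proof. exact: (smooth_Hm Hf). Qed.
Let sgih p q : smooth_on V (fun y => gi h y p q). Proof. exact: (smooth_giInd Hf). Qed.
Let sfk p q : smooth_on V (fun y => fialkow g f y p q). Proof. exact: (smooth_fialkow Hf). Qed.

Lemma smooth_calIform ga : smooth_on V (fun y => calIform g f y ga).
Proof.
have sC p q r : smooth_on V (fun y => CotF g f y p q r).
  by apply: (smooth_con3 Hf (t := fun z => Cot g (f z))) => // a b c; apply: (smooth_on_sub Hf (p := fun x => Cot g x a b c)); smooth.
have sW p q r : smooth_on V (fun y => WeylF g f y p q r (H y)) by apply: (smooth_WeylF Hf p q r sH).
have sD p q r : smooth_on V (fun y => pairD g f y p (Sff0 g f y q r)).
  apply: smoothB => //.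
    apply: (smooth_con2 Hf (t := fun z => Psch g (f z)) (r := fun z => Sff0 g f z q r)) => // a b.
    by apply: (smooth_on_sub Hf (p := fun x => Psch g x a b)); smooth.
  by apply: (smooth_dt Hf (s := fun z => Dal g f H z p) (t := fun z => Sff0 g f z q r)) => // a; apply: (smooth_Dal Hf).
apply: smoothB => //; first apply: smoothB => //.
- by apply: smooth_ext => [y|]; [exact: ctrE|smooth].
- by apply: smooth_ext => [y|]; [exact: ctrE|smooth].
- by apply: smooth_ext => [y|]; [exact: ctrE|smooth].
Qed.

Definition trF y := ctr (gi h y) (fialkow g f y).

(* calI with (k-1)G replaced by half of [trF]; for k = 1 both vanish. *)
Definition Iform y := 2^-1 * (- divg h (fun z al => pd al trF z) y + 2 * trF y * ctr (gi h y) (scrP g f y))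
  + (k%:R - 6) * (ctr2 (gi h y) (fun i j p q => fialkow g f y i p * scrP g f y j q)
  + divg h (calIform g f) y + (k%:R - 3) / (n%:R - 4) * trscrB g f y
  - (k%:R - 3) * ctr (gi h y) (fun al be => inn (g (f y)) (scrD g f y al) (scrD g f y be))).

Lemma smooth_trF : smooth_on V trF.
Proof. by apply: smooth_ext => [y|]; [exact: ctrE|smooth]. Qed.

End InvariantForm.

Section ConformalInvariance.
Context {R : realType} {k n : nat}.
Variables (V : set 'rV[R]_k) (U : set 'rV[R]_n) (g : 'rV[R]_n -> 'M[R]_n) (f : 'rV[R]_k -> 'rV[R]_n).
Variable (u : 'rV[R]_n -> R).
Hypotheses (Hf : immersed_in V U g f) (su : smooth_on U u) (k0 : (0 < k)%N) (n3 : (3 <= n)%N).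
Hypothesis n4 : n <> 4%N.
Let oV : open V. Proof. by case: Hf. Qed.
Let Hh : metric_on V (Ind g f). Proof. exact: Ind_metric Hf. Qed.
Let hsym y (Vy : V y) := metric_sym Hh Vy.
Let hcmet y (Vy : V y) := ctr_met (hsym Vy) (gi_sym Hh Vy) (giK Hh Vy).
Let hdim y (Vy : V y) := ctr_dim (hsym Vy) (giK Hh Vy).
Implicit Types (y : 'rV[R]_k) (al be ga de : 'I_k) (a b c d : 'I_n).

Local Notation gt := (rescale g u).
Local Notation E y := (expR (2 * u (f y))).
Local Notation h := (Ind g f).
Local Notation ht := (Ind gt f).
Local Notation w := (fun z => u (f z)).
Local Notation dw y := (fun al => pd al w y).
Local Notation "<< v , w >>_ y" := (inn (gi h y) v w) (at level 10, y at level 8).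

Let sw : smooth_on V w. Proof. exact: (smooth_u_sub Hf su). Qed.
Let sdw (al : 'I_k) : smooth_on V (fun z => pd al w z). Proof. by smooth. Qed.
Let sfk p q : smooth_on V (fun y => fialkow g f y p q). Proof. exact: (smooth_fialkow Hf). Qed.
Let stau : smooth_on V (trF g f). Proof. exact: (smooth_trF Hf). Qed.
Let sdtau (al : 'I_k) : smooth_on V (fun z => pd al (trF g f) z). Proof. by smooth. Qed.
Let sX (al : 'I_k) : smooth_on V (fun y => calIform g f y al). Proof. exact: (smooth_calIform Hf). Qed.

Definition fialkow_grad y ga := ctr (gi h y) (fun p q => pd q w y * fialkow g f y p ga).

(** The place where the Codazzi and Bianchi computations enter the proof of invariance:
    [div_fialkow] replaces the divergence of F, which no other term of the invariant could cancel as
    it stands. *)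
Lemma divg_fialkow_grad y : V y -> divg h fialkow_grad y =
  ctr2 (gi h y) (fun i j p q => fialkow g f y i p * Hess h w y j q)
  + (k%:R - 2) * << calIform g f y, dw y >>_y + 2^-1 * << fun al => pd al (trF g f) y, dw y >>_y.
Proof.
move=> Vy; rewrite (divg_con Hh sfk (fun z Vz p q => fialkow_sym Hf p q Vz)) // -addrA; congr (_ + _).
rewrite !innE -!ctrZ -ctrD; apply: eq_ctr => p q.
have := div_fialkow Hf k0 p Vy => /eqP; rewrite subr_eq => /eqP ->.
by rewrite /trF; ring.
Qed.

Lemma trF_rescale y : V y -> trF gt f y = (E y)^-1 * trF g f y.
Proof.
move=> Vy; rewrite /trF (ctr_Ind_rescale Hf su) //; congr (_ * _); apply: eq_ctr => p q.
exact: (fialkow_rescale Hf su).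
Qed.

Lemma Iform_rescale y : V y -> Iform gt f y = (E y)^-2 * Iform g f y.
Proof.
move=> Vy; have e0 := E_neq0 u (f y); have gs := gi_sym Hh Vy; have met := hcmet Vy.
have nn : n%:R - 4 != 0 :> R by rewrite subr_eq0 eqr_nat; apply/eqP.
have sE := smooth_Einv Hh sw.
have is_sym v v' : << v, v' >>_y = << v', v >>_y by apply: inn_sym.
rewrite /Iform.
set Lt := divg ht (fun z al => _) y.
set Dt := divg ht (calIform _ _) y.
(* Since [trF] has weight -2, its differential is the inverse weight times a combination of its old
   differential and dw, which is the form that [divg_rescale] expects. *)
have Lap : Lt = (E y)^-2 * (divg h (fun z al => pd al (trF g f) z) y
   - 2 * (trF g f y * divg h (fun z al => pd al w z) y + << fun al => pd al (trF g f) y, dw y >>_y)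
   + (k%:R - 4) * (<< fun al => pd al (trF g f) y, dw y >>_y - 2 * trF g f y * << dw y, dw y >>_y)).
  rewrite /Lt Ind_rescale.
  rewrite (divg_eq (rescale_metric Hh sw) (t := fun z al => (E z)^-1 * (pd al (trF g f) z + (- 2 * trF g f z) * pd al w z))) //; last first.
    move=> z Vz; apply/funext => al; rewrite (pd_eq oV (h := fun z => (E z)^-1 * trF g f z)) //; last first.
      by move=> z' /set_mem Vz'; exact: trF_rescale.
    by rewrite (pdM oV) // (pd_Einv Hh sw) //; ring.
  have s2 : smooth_on V (fun z => - 2 * trF g f z) by smooth.
  rewrite (divg_rescale Hh sw) //; last by move=> a; smooth.
  rewrite (divgD Hh) //; last by move=> a; smooth.
  rewrite (divgZ Hh) // innDl innZl (_ : (fun al => pd al (fun z => - 2 * trF g f z) y) = fun al => - 2 * pd al (trF g f) y); last first.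
    by apply/funext => a; rewrite (pdZ oV).
  by rewrite innZl; ring.
have Div : Dt = (E y)^-2 * (divg h (calIform g f) y + divg h fialkow_grad y + (k%:R - 4) * (<< calIform g f y, dw y >>_y + << fialkow_grad y, dw y >>_y)).
  rewrite /Dt Ind_rescale.
  rewrite (divg_eq (rescale_metric Hh sw) (t := fun z al => (E z)^-1 * (calIform g f z al + fialkow_grad z al))) //; last first.
    by move=> z Vz; apply/funext => al; rewrite (calIform_rescale Hf su k0 n3).
  have sFU (al : 'I_k) : smooth_on V (fun z => fialkow_grad z al) by apply: smooth_ext => [z|]; [exact: ctrE|smooth].
  rewrite (divg_rescale Hh sw) //; last by move=> a; smooth.
  by rewrite (divgD Hh) // innDl.
have PE p q : scrP gt f y p q = scrP g f y p q + - Hess h w y p q + pd p w y * pd q w y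
   + - (2^-1 * << dw y, dw y >>_y) * h y p q.
  by rewrite (scrP_rescale Hf su k0 n3) // /dP; ring.
have trP : ctr (gi h y) (scrP gt f y) = ctr (gi h y) (scrP g f y) - divg h (fun z al => pd al w z) y
   + << dw y, dw y >>_y - 2^-1 * << dw y, dw y >>_y * k%:R.
  by rewrite (eq_ctr _ PE) !ctrD ctrN !ctrZ hdim // -innE divgE /Hess mulNr.
have FP : ctr2 (gi h y) (fun i j p q => fialkow gt f y i p * scrP gt f y j q) =
   ctr2 (gi h y) (fun i j p q => fialkow g f y i p * scrP g f y j q)
   - ctr2 (gi h y) (fun i j p q => fialkow g f y i p * Hess h w y j q)
   + << fialkow_grad y, dw y >>_y - 2^-1 * << dw y, dw y >>_y * trF g f y.
  rewrite (@eq_ctr2 _ _ _ _ (fun i j p q => fialkow g f y i p * scrP g f y j q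
     + - (fialkow g f y i p * Hess h w y j q) + fialkow g f y i p * (pd j w y * pd q w y)
     + - (2^-1 * << dw y, dw y >>_y) * (fialkow g f y i p * h y j q))); last first.
    by move=> i j p q; rewrite PE (fialkow_rescale Hf su) //; ring.
  rewrite !ctr2D ctr2N ctr2Z mulNr; congr (_ - _ + _ - _ * _).
    rewrite ctr2E innE; apply: eq_ctr => i j; rewrite /fialkow_grad -ctrZr; apply: eq_ctr => p q.
    by rewrite (fialkow_sym Hf i p Vy); ring.
  by rewrite ctr2E; apply: eq_ctr => i j; rewrite met.
have htr2 t : ctr2 (gi ht y) t = (E y)^-2 * ctr2 (gi h y) t.
  rewrite !ctr2E (ctr_Ind_rescale Hf su) // (eq_ctr _ (fun i j => ctr_Ind_rescale Hf su _ Vy)) ctrZ; by field.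
(* The form is rewritten through [calIform] so that the [pairDL] contributions of the traces of
   script B and of D cancel visibly. *)
have CP : ctr (gi h y) (fun p q => pd q w y * (cotT g f y p - weylH g f y p)) =
    << calIform g f y, dw y >>_y + ctr (gi h y) (fun p q => pd q w y * pairDL g f y p).
  by rewrite innE -ctrD; apply: eq_ctr => p q; rewrite /calIform; ring.
(* Similarly L0^2 is written as F plus its Weyl part; the latter cancels against the quadratic term
   of [trscrB]. *)
have FW : ctr (gi h y) (fun p q => pd q w y * ctr (gi h y) (fun r m => pd m w y * sff0sq g f y p r)) =
    << fialkow_grad y, dw y >>_y + ctr (gi h y) (fun p q => pd q w y * ctr (gi h y) (fun r m => pd m w y * weyltr g f y p r)).
  rewrite innE -ctrD; apply: eq_ctr => p q; rewrite [fialkow_grad y p * _]mulrC -mulrDr; congr (_ * _).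
  rewrite /fialkow_grad -ctrD; apply: eq_ctr => r m; rewrite (fialkow_sym Hf) // /fialkow; ring.
rewrite Lap Div htr2 FP (ctr_Ind_rescale Hf su) // trP trF_rescale // (trscrB_rescale Hf su k0 n3) //.
rewrite (trscrD2_rescale Hf su k0 n3) // CP FW divg_fialkow_grad //.
(* The balance in the bracket: <X,dw> has coefficient (k-4) + (k-2) - 2(k-3) = 0 and F(dw,dw) has 1
   + (k-4) - (k-3) = 0, the Hessian terms cancel, and the gradient of [trF] has coefficient 1/2,
   matched by -(k-6)/2 from the scalar part. *)
by field; rewrite e0 nn.
Qed.

End ConformalInvariance.

(** * Identification with the definitions of the statement *)

Section Link.
Context {R : realType} {k n : nat}.
Variables (V : set 'rV[R]_k) (U : set 'rV[R]_n) (g : 'rV[R]_n -> 'M[R]_n) (f : 'rV[R]_k -> 'rV[R]_n).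
Hypotheses (Hf : immersed_in V U g f) (k0 : (0 < k)%N).
Let oV : open V. Proof. by case: Hf. Qed.
Let Hh : metric_on V (Ind g f). Proof. exact: Ind_metric Hf. Qed.
Implicit Types (y : 'rV[R]_k) (al be ga de : 'I_k) (a b c d : 'I_n).
Local Notation h := (Ind g f).
Local Notation F := (Frm f).

Lemma ind_invE y : ind_inv g f y = gi h y.
Proof. by rewrite giE; sexpose. Qed.

Lemma frameE y : frame f y = F y.
Proof. by sexpose. Qed.

Lemma tr2E y t : tr2 g f y t = ctr (gi h y) t.
Proof. by rewrite ctrE /tr2 ind_invE. Qed.

Lemma conn_coefE y ga al be : V y -> conn_coef g f y ga al be = Gamma h y ga al be.
Proof. by move=> Vy; rewrite -(Tg_conn Hf) //; sexpose. Qed.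

Lemma nablaTE t y al be : V y -> nablaT g f t y al be = cov1 h t y al be.
Proof.
move=> Vy; rewrite cov1E /nablaT; congr (_ - _); first by expose.
by apply: eq_bigr => ga _; rewrite conn_coefE.
Qed.

Lemma divergenceE t y : V y -> divergence g f t y = divg h t y.
Proof.
move=> Vy; rewrite /divergence tr2E divgE; apply: eq_ctr => al be; exact: nablaTE.
Qed.

Lemma laplacianE p y : V y -> laplacian g f p y = divg h (fun z al => pd al p z) y.
Proof. by move=> Vy; rewrite /laplacian divergenceE //; expose. Qed.

Lemma meanHE y : meanH g f y = Hm g f y.
Proof. by sexpose. Qed.

Lemma sff0_Sff0 y al be : sff0 g f y al be = Sff0 g f y al be.
Proof. by sexpose. Qed.

Lemma ind_metricE y : ind_metric g f y = h y.
Proof. by sexpose. Qed.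

Lemma sff0_sqE y al be : sff0_sq g f y al be = sff0sq g f y al be.
Proof. by rewrite /sff0_sq tr2E; apply: eq_ctr => p q; rewrite dotE !sff0_Sff0. Qed.

Lemma contract2E (t : 'I_n -> 'I_n -> R) v w : contract2 t v w = con2 t v w.
Proof. by rewrite con2E. Qed.

Lemma contract3E (t : 'I_n -> 'I_n -> 'I_n -> R) u v w : contract3 t u v w = con3 t u v w.
Proof. by rewrite con3E. Qed.

Lemma contract4E (t : 'I_n -> 'I_n -> 'I_n -> 'I_n -> R) u v w z : contract4 t u v w z = con4 t u v w z.
Proof. by rewrite con4E. Qed.

Lemma weylTE y al be ga de : weylT g f y al be ga de = WeylF g f y al be ga (F y de).
Proof. by rewrite /weylT contract4E /WeylF; sexpose. Qed.

Lemma weyl_tr1E y al be : weyl_tr1 g f y al be = weyltr g f y al be.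
Proof. by rewrite /weyl_tr1 tr2E; apply: eq_ctr => p q; rewrite weylTE. Qed.

Lemma sum4_ctr (M : 'M[R]_k) (t : 'I_k -> 'I_k -> 'I_k -> 'I_k -> R) :
  \sum_al \sum_be \sum_ga \sum_de M al ga * M be de * t al be ga de =
  ctr M (fun al ga => ctr M (fun be de => t al be ga de)).
Proof.
rewrite ctrE; apply: eq_bigr => al _; rewrite exchange_big; apply: eq_bigr => ga _.
rewrite ctrE mulr_sumr; apply: eq_bigr => be _; rewrite mulr_sumr; apply: eq_bigr => de _.
by rewrite mulrA.
Qed.

Lemma scriptGE y : V y -> scriptG g f y = (2 * (k%:R - 1))^-1 * trF g f y.
Proof.
move=> Vy; rewrite /scriptG; congr (_ * _); rewrite /trF /fialkow ctrD ctrN; congr (_ - _).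
  rewrite /sff0_norm2 ind_invE sum4_ctr; apply: eq_ctr => al ga; apply: eq_ctr => be de.
  by rewrite dotE !sff0_Sff0 (Sff0_sym Hf al be Vy) (Sff0_sym Hf ga de Vy).
rewrite /weyl_tr2 ind_invE sum4_ctr; apply: eq_ctr => al ga; apply: eq_ctr => be de.
by rewrite weylTE.
Qed.

Lemma scriptDE y al : scriptD g f y al = scrD g f y al.
Proof.
apply/funext => a; rewrite /scriptD /scrD; sexpose; by [].
Qed.

Lemma calPE y al be : calP g f y al be = scrP g f y al be.
Proof.
rewrite /calP /scrP contract2E !dotE meanHE sff0_Sff0 ind_metricE; by sexpose.
Qed.

Lemma calI_formE y al : V y -> calI_form g f y al = calIform g f y al.
Proof.
move=> Vy; have gs := gi_sym Hh Vy; rewrite /calI_form /calIform; congr (_ - _).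
  rewrite /calC_tr tr2E /cotT /weylH -ctrN -ctrD; apply: eq_ctr => be ga.
  rewrite contract3E /CotF /WeylF -con3_ev -con3N -con3D !frameE; apply: eq_con3 => a b c.
  rewrite /calC; congr (_ - _); first by sexpose.
  by rewrite evE; apply: eq_bigr => d _; rewrite mulrC meanHE; sexpose.
rewrite tr2E /pairDL ctr_sym //; apply: eq_ctr => be ga.
rewrite dotE scriptDE sff0_Sff0 (Sff0_sym Hf al ga Vy) (inn_scrD Hf) // => de.
exact: (dt_Frm_Sff0 Hf).
Qed.

Lemma tr_calBE y : V y -> tr2 g f y (calB g f y) = trscrB g f y.
Proof.
move=> Vy; have gs := gi_sym Hh Vy; rewrite tr2E.
rewrite (@eq_ctr _ _ _ (calB g f y) (fun al be => con2 (Bach g (f y)) (F y al) (F y be)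
  + (n%:R - 4) * (con3 (Cot g (f y)) (Hm g f y) (F y al) (F y be) + con3 (Cot g (f y)) (Hm g f y) (F y be) (F y al))
  + (n%:R - 4) * con4 (Weyl g (f y)) (F y al) (Hm g f y) (F y be) (Hm g f y))); last first.
  move=> al be; rewrite /calB contract2E !contract3E contract4E !frameE meanHE.
  rewrite Bach.unlock Cot.unlock Weyl.unlock; by field.
rewrite !ctrD !ctrZ ctrD /trscrB /cotV /weylVV.
have -> : ctr (gi h y) (fun i j => con3 (Cot g (f y)) (Hm g f y) (F y j) (F y i)) =
    ctr (gi h y) (fun i j => con3 (Cot g (f y)) (Hm g f y) (F y i) (F y j)) by rewrite ctr_sym.
ring.
Qed.

(* All indices agree when k = 1, so L0 vanishes by tracelessness and the Weyl term by
   antisymmetry. *)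
Lemma trF_curve : k = 1%N -> forall y, V y -> trF g f y = 0.
Proof.
move=> k1 y Vy; have K (p q : 'I_k) : p = q.
  apply: val_inj => /=; have := leq_trans (ltn_ord p) (eq_leq k1); have := leq_trans (ltn_ord q) (eq_leq k1).
  by rewrite !ltnS !leqn0 => /eqP -> /eqP ->.
rewrite /trF /fialkow ctrD ctrN.
have -> : ctr (gi h y) (sff0sq g f y) = 0.
  rewrite /sff0sq -[RHS](ctr0 (gi h y)); apply: eq_ctr => al ga.
  rewrite (@eq_ctr _ _ _ _ (fun be de => inn (g (f y)) (Sff0 g f y al ga) (Sff0 g f y be de))); last first.
    by move=> be de; congr inn; apply/funext => a; congr (Sff0 g f y _ _ a); exact: K.
  rewrite -inn_ctrr (_ : (fun a => _) = fun a => 0 * Hm g f y a) ?innZr ?mul0r //.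
  by apply/funext => a; rewrite mul0r; exact: (tr_Sff0 Hf).
rewrite sub0r; apply/eqP; rewrite oppr_eq0; apply/eqP.
rewrite -[RHS](ctr0 (gi h y)); apply: eq_ctr => al ga; rewrite /weyltr -[RHS](ctr0 (gi h y)).
apply: eq_ctr => be de; have := WeylF_asym12 Hf al be ga (F y de) Vy.
rewrite (K be al) => /eqP; rewrite -addr_eq0 -mulr2n mulrn_eq0 /= => /eqP ->.
by [].
Qed.

Lemma calI_coordE y : V y -> calI_coord g f y = Iform g f y.
Proof.
move=> Vy; have gs := gi_sym Hh Vy.
have st : smooth_on V (trF g f) by exact: (smooth_trF Hf).
rewrite /calI_coord /Iform laplacianE // divergenceE // tr_calBE // /scriptD_norm2 !tr2E scriptGE //.
have -> : divg h (calI_form g f) y = divg h (calIform g f) y.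
  by apply: (divg_eq Hh) => // z Vz; apply/funext => al; exact: calI_formE.
have -> : divg h (fun z al => pd al (scriptG g f) z) y = (2 * (k%:R - 1))^-1 * divg h (fun z al => pd al (trF g f) z) y.
  rewrite (divg_eq Hh (t := fun z al => (2 * (k%:R - 1))^-1 * pd al (trF g f) z)) //; last first.
    move=> z Vz; apply/funext => al; rewrite -(pdZ oV) //.
    by apply: (pd_eq oV) => // z' /set_mem Vz'; exact: scriptGE.
  rewrite !divgE -ctrZ; apply: eq_ctr => al be; rewrite !cov1E (pdZ oV) //; last by smooth.
  rewrite sumMZ; ring.
have -> : ctr (gi h y) (calP g f y) = ctr (gi h y) (scrP g f y).
  by apply: eq_ctr => al be; exact: calPE.
have -> : \sum_al \sum_be (sff0_sq g f y al be - weyl_tr1 g f y al be) *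
    (\sum_ga \sum_de ind_inv g f y al ga * ind_inv g f y be de * calP g f y ga de) =
    ctr2 (gi h y) (fun i j p q => fialkow g f y i p * scrP g f y j q).
  rewrite ctr2E ctrE; apply: eq_bigr => i _; rewrite (eq_bigr (fun p => \sum_j \sum_q gi h y i j * (gi h y p q * (fialkow g f y i p * scrP g f y j q)))).
    by rewrite exchange_big; apply: eq_bigr => j _; rewrite ctrE mulr_sumr; apply: eq_bigr => p _; rewrite mulr_sumr.
  move=> p _; rewrite mulr_sumr; apply: eq_bigr => j _; rewrite mulr_sumr; apply: eq_bigr => q _.
  rewrite sff0_sqE weyl_tr1E ind_invE calPE /fialkow; ring.
have -> : ctr (gi h y) (fun al be => dot g f y (scriptD g f y al) (scriptD g f y be)) =
   ctr (gi h y) (fun al be => inn (g (f y)) (scrD g f y al) (scrD g f y be)).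
  by apply: eq_ctr => al be; rewrite dotE !scriptDE.
congr (_ + _).
(* For k = 1 the product of k-1 with the inverse of 2(k-1) is 0 and not 1/2, because the inverse of
   0 is 0; both sides agree since [trF], and hence its Laplacian, vanishes on V. *)
have [k1|k1] := eqVneq k 1%N; last first.
  have kn : k%:R - 1 != 0 :> R by rewrite subr_eq0 (eqr_nat R k 1).
  by field.
rewrite (trF_curve k1 Vy) (divg_eq Hh (t := fun _ _ => 0)) //; last first.
  move=> z Vz; apply/funext => al; rewrite -(pd_cst 0 al z); apply: (pd_eq oV) => // z' /set_mem.
  exact: trF_curve.
have -> : divg h (fun _ _ => 0) y = 0.
  rewrite divgE -[RHS](ctr0 (gi h y)); apply: eq_ctr => al be; rewrite cov1E pd_cst big1 ?subr0 // => d _.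
  by rewrite mulr0.
ring.
Qed.

End Link.

(** * Charts *)

Section PositiveDefinite.
Context {R : realType}.

Lemma posdef_unit n (A : 'M[R]_n) :
  (forall v : 'rV[R]_n, v != 0 -> 0 < (v *m A *m v^T) 0 0) -> A \in unitmx.
Proof.
move=> pA; rewrite unitmxE unitfE; apply/negP => /det0P [v v0 vA].
by have := pA v v0; rewrite vA mul0mx mxE ltxx.
Qed.

Lemma posdef_congr k n (J : 'M[R]_(k, n)) (A : 'M[R]_n) : row_free J ->
  (forall v : 'rV[R]_n, v != 0 -> 0 < (v *m A *m v^T) 0 0) -> J *m A *m J^T \in unitmx.
Proof.
move=> fJ pA; apply: posdef_unit => v v0.
have -> : v *m (J *m A *m J^T) *m v^T = (v *m J) *m A *m (v *m J)^T by rewrite trmx_mul !mulmxA.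
by apply: pA; rewrite mulmx_free_eq0.
Qed.

Lemma Ind_jacobian k n (g : 'rV[R]_n -> 'M[R]_n) (f : 'rV[R]_k -> 'rV[R]_n) y : differentiable f y ->
  Ind g f y = 'J f y *m g (f y) *m ('J f y)^T.
Proof.
move=> df; have JE al a : 'J f y al a = Frm f y al a.
  rewrite FrmE pd.unlock pderiv_coord //; transitivity (row al ('J f y) 0 a); first by rewrite [RHS]mxE.
  by rewrite rowE -deriveEjacobian.
move: ('J f y) JE => J JE; apply/matrixP => al be; rewrite IndE innE ctrE mxE exchange_big; apply: eq_bigr => b _.
rewrite !mxE mulr_suml; apply: eq_bigr => a _; rewrite !JE; ring.
Qed.

End PositiveDefinite.

Section Charts.
Context {R : realType} {k n : nat}.
Variables (Y : manifold R k) (X : manifold R n) (i : Y -> X) (g : tensor2 X).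
Hypotheses (im : immersion i) (rg : riemannian_metric g).
Variables (phi : chart R k Y) (psi : chart R n X).
Hypotheses (aphi : atlas phi) (apsi : atlas psi).

Let V := [set y | ran phi y /\ dom psi (i (bwd phi y))].

Lemma open_chart_preimage : open V.
Proof.
case: im => ci _; rewrite openE => y [ry dy]; apply: filterI.
  by apply: open_nbhs_nbhs; split => //; exact: ran_open.
have c : {for y, continuous (i \o bwd phi)}.
  by apply: continuous_comp; [exact: bwd_continuous|exact: ci].
by apply: c; apply: open_nbhs_nbhs; split => //; exact: dom_open.
Qed.

Lemma metric_on_chart : metric_on (ran psi) (g psi).
Proof.
have [/(_ psi apsi) [sg symg pg] _] := rg.
split.
- exact: ran_open.
- by move=> a b; apply: smooth_coord; [exact: ran_open|exact: sg].
- by move=> x rx a b; rewrite -{1}(symg x rx) mxE.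
- by move=> x rx; apply: posdef_unit; exact: pg.
Qed.

Lemma immersed_in_charts : immersed_in V (ran psi) (g psi) (in_charts i phi psi).
Proof.
have [ci /(_ phi psi aphi apsi) [sf ff]] := im.
have maps y : V y -> ran psi (in_charts i phi psi y) by case=> _; exact: fwd_ran.
split => //; [exact: metric_on_chart|exact: open_chart_preimage|].
move=> y Vy; rewrite Ind_jacobian; last exact: (sf [::]).
have [/(_ psi apsi) [_ _ pg] _] := rg.
by apply: posdef_congr; [exact: ff|apply: pg; exact: maps].
Qed.

End Charts.

Theorem proposition5p5 (R : realType) (k n : nat)
    (hk : (1 <= k < n)%N) (hn : (3 <= n)%N) (hn4 : n <> 4%N) :
  conformally_invariant (calI R k n) (- 4).
Proof.
move=> Y X i g u im rg su p; have k0 : (0 < k)%N by case/andP: hk.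
rewrite /calI; set phi := chart_at p; set psi := chart_at (i p).
have aphi : atlas phi by exact: chart_at_atlas.
have apsi : atlas psi by exact: chart_at_atlas.
have Hf := immersed_in_charts im rg aphi apsi.
have suc : smooth_on (ran psi) (fun x => u (bwd psi x)) by exact: su.
have dp : dom phi p by exact: chart_at_dom.
have dip : dom psi (i p) by exact: chart_at_dom.
have Vp : [set y | ran phi y /\ dom psi (i (bwd phi y))] (fwd phi p).
  by split; [exact: fwd_ran|rewrite /= fwdK].
(* True by conversion, since both metrics are read in the same chart [psi]. *)
have -> : conformal_change u g psi = rescale (g psi) (fun x => u (bwd psi x)) by [].
rewrite (calI_coordE Hf k0 Vp) (calI_coordE (rescale_immersed Hf suc) k0 Vp).
rewrite (Iform_rescale Hf suc k0 hn hn4 Vp); congr (_ * _).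
(* Undoing the charts, the factor is the power -2 of expR (2 u(i p)), which is where the weight -4
   comes from. *)
rewrite /in_charts /= fwdK // fwdK // expr2 -expRD -expRN; congr expR; ring.
Qed.
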